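(* Let $E$ be a translation-invariant Banach space of tempered distributions on $\mathbb{R}^n$ with growth function $\omega$. The convolution $(\varphi,\psi)\mapsto\varphi\ast\psi$ of functions in $\mathcal{S}(\mathbb{R}^n)$ extends to a mapping $\ast:L^{1}_{\omega}\times E\rightarrow E$, and $E$ becomes a Banach module over the Beurling algebra $L^{1}_{\omega}$, i.e., $\|u\ast g\|_{E}\leq \|u\|_{1,\omega}\|g\|_{E}$ for all $u\in L^1_\omega$ and $g\in E$.
   Context: Notation: $(T_hg)(x)=g(x+h)$. $X\hookrightarrow Y$ means a dense and continuous linear embedding. A translation-invariant Banach space of tempered distributions is a Banach space $E$ such that: $(a)'$ $\mathcal{D}(\mathbb{R}^n)\hookrightarrow E\hookrightarrow \mathcal{D}'(\mathbb{R}^n)$; $(b)'$ $T_h(E)\subseteq E$ for every $h\in\mathbb{R}^{n}$; $(c)'$ for any $g\in E$ there are $M=M_g>0$, $\tau=\tau_{g}\geq 0$ with $\|T_{h} g\|_E\leq M(1+|h|)^\tau$ for all $h\in \mathbb{R}^n$. For such $E$ one has $\mathcal{S}(\mathbb{R}^n)\hookrightarrow E\hookrightarrow \mathcal{S}'(\mathbb{R}^n)$ and each $T_h:E\to E$ is continuous. The growth function of the translation group is $\omega(h):=\|T_{-h}\|_{L(E)}$ (operator norm on $E$). It is measurable, $\omega(0)=1$, $\log\omega$ is subadditive, and $\omega(h)\le M(1+|h|)^\tau$ for some constants $M,\tau$. The Beurling algebra $L^1_\omega$ is the Banach algebra (under convolution) of measurable functions $u$ with $\|u\|_{1,\omega}:=\int_{\mathbb{R}^{n}}|u(x)|\,\omega(x)\,dx<\infty$.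 *)

(* Defs.v *)
From HB Require Import structures.
From mathcomp Require Import all_boot all_order all_algebra.
From mathcomp Require Import complex.
From mathcomp Require Import all_classical all_reals all_analysis.

Set Implicit Arguments.
Unset Strict Implicit.
Unset Printing Implicit Defensive.

Import Order.TTheory GRing.Theory Num.Theory.
Import numFieldNormedType.Exports.

Local Open Scope classical_set_scope.
Local Open Scope ring_scope.
Local Open Scope complex_scope.

(* The sigma-algebra on 'rV[R]_n generated by the coordinates, i.e. the Borel
   sets of R^n. *)
Section rV_measurable.
Variables (R : realType) (n : nat).

Let coord (i : 'I_n) (x : 'rV[R]_n) : measurableTypeR R := x ord0 i.

Let rV_set0 : g_sigma_preimage coord set0.
Proof. exact: sigma_algebra0. Qed.

Let rV_setC A : g_sigma_preimage coord A -> g_sigma_preimage coord (~` A).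
Proof. exact: sigma_algebraC. Qed.

Let rV_bigcup (F : (set _)^nat) : (forall i, g_sigma_preimage coord (F i)) ->
  g_sigma_preimage coord (\bigcup_i (F i)).
Proof. exact: sigma_algebra_bigcup. Qed.

HB.instance Definition _ := @isMeasurable.Build default_measure_display
  'rV[R]_n (g_sigma_preimage coord) rV_set0 rV_setC rV_bigcup.

End rV_measurable.

Section lebesgue_rV.
Variable R : realType.

Definition rV_cons n (p : measurableTypeR R * 'rV[R]_n) : 'rV[R]_n.+1 :=
  row_mx p.1%:M p.2.

Definition rV_uncons n (x : 'rV[R]_n.+1) : measurableTypeR R * 'rV[R]_n :=
  (x ord0 ord0, \row_j x ord0 (lift ord0 j)).

Lemma rV_consK n : cancel (@rV_cons n) (@rV_uncons n).
Proof.
move=> [a v]; rewrite /rV_uncons /rV_cons /=; congr pair.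
  transitivity (row_mx a%:M v ord0 (lshift n (ord0 : 'I_1))).
    by congr (row_mx _ _ _ _); exact: val_inj.
  by rewrite row_mxEl mxE.
apply/rowP => j; rewrite mxE.
transitivity (row_mx a%:M v ord0 (rshift 1 j)); last by rewrite row_mxEr.
by congr (row_mx _ _ _ _); exact: val_inj.
Qed.

Lemma measurable_coord n (i : 'I_n) :
  measurable_fun [set: 'rV[R]_n] (fun x => x ord0 i : measurableTypeR R).
Proof.
move=> _ Y mY; rewrite setTI; apply: sub_sigma_algebra => /=.
rewrite -bigcup_seq/=; exists i => /=; first by rewrite mem_index_enum.
by exists Y => //; rewrite setTI.
Qed.

Lemma measurable_fun_coordP d (T : measurableType d) n (f : T -> 'rV[R]_n) :
  (forall i, measurable_fun [set: T] (fun x => f x ord0 i : measurableTypeR R)) ->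
  measurable_fun [set: T] f.
Proof.
move=> mf _ Y mY; rewrite setTI.
pose G := [set A : set 'rV[R]_n | measurable (f @^-1` A)].
suff : G Y by [].
apply: mY; split.
  split => /=.
  - by rewrite /G/= preimage_set0.
  - by move=> A; rewrite /G/= setTD preimage_setC => mA; exact: (measurableC mA).
  - by move=> F mF; rewrite /G/= preimage_bigcup; apply: bigcup_measurable => k _; exact: mF.
move=> A; rewrite -bigcup_seq/= => -[i _ [B mB]]; rewrite !setTI => <-.
by rewrite /G/= -[X in measurable X]setTI; exact: mf.
Qed.

Lemma measurable_rV_cons n : measurable_fun setT (@rV_cons n).
Proof.
apply: measurable_fun_coordP => i; rewrite /rV_cons.
case: (@split_ordP 1 n i) => j ->.
  apply: (eq_measurable_fun fst) => [p _|]; last exact: measurable_fst.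
  by rewrite [RHS](row_mxEl p.1%:M) mxE (ord1 j).
apply: (eq_measurable_fun (fun p : measurableTypeR R * 'rV[R]_n =>
    p.2 ord0 j : measurableTypeR R)) => [p _|].
  by rewrite [RHS](row_mxEr p.1%:M).
exact: measurableT_comp (measurable_coord j) measurable_snd.
Qed.

Lemma measurable_rV_uncons n : measurable_fun setT (@rV_uncons n).
Proof.
apply: measurable_fun_pair; first exact: measurable_coord.
apply: measurable_fun_coordP => i.
under eq_fun do rewrite mxE.
exact: measurable_coord.
Qed.

Section step.
Variables (n : nat) (m : {sigma_finite_measure set 'rV[R]_n -> \bar R}).

Definition lebesgue_rV_step : set 'rV[R]_n.+1 -> \bar R :=
  pushforward (lebesgue_measure \x m)%E (@rV_cons n).

Let P : {measure set 'rV[R]_n.+1 -> \bar R} :=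
  measure_function_pushforward__canonical__measure_function_Measure
    (lebesgue_measure \x m)%E (@measurable_rV_cons n).

HB.instance Definition _ := isMeasure.Build _ _ _ lebesgue_rV_step
  (measure0 P) (measure_ge0 P) (@measure_semi_sigma_additive _ _ _ P).

Let lebesgue_rV_step_sigma_finite : sigma_finite setT lebesgue_rV_step.
Proof.
have /sigma_finiteP[F [TF ndF mF]] :=
  sigma_finiteT (@lebesgue_measure R).
have /sigma_finiteP[G [TG ndG mG]] := sigma_finiteT m.
exists (fun k => @rV_uncons n @^-1` (F k `*` G k)).
  rewrite -preimage_bigcup [X in _ @^-1` X](_ : _ = setT) ?preimage_setT//.
  apply/esym; apply/seteqP; split => // -[x y] _.
  have : (\bigcup_i F i) x by rewrite -TF.
  have : (\bigcup_i G i) y by rewrite -TG.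
  move=> [i _ Giy] [j _ Fjx]; exists (maxn i j) => //; split => /=.
    by move: Fjx; apply/subsetPset/ndF; rewrite leq_maxr.
  by move: Giy; apply/subsetPset/ndG; rewrite leq_maxl.
move=> k; have [mFk Fkoo] := mF k; have [mGk Gkoo] := mG k; split.
  rewrite -[X in measurable X]setTI; apply: measurable_rV_uncons => //.
  exact: measurableX.
rewrite /lebesgue_rV_step /pushforward -comp_preimage.
rewrite (_ : _ \o _ = id); last by apply/funext => x /=; rewrite rV_consK.
rewrite preimage_id product_measure1E//.
by rewrite lte_mul_pinfty// ge0_fin_numE.
Qed.

HB.instance Definition _ := Measure_isSigmaFinite.Build _ _ _ lebesgue_rV_step
  lebesgue_rV_step_sigma_finite.

End step.

(* n-dimensional Lebesgue measure: the n-fold product of lebesgue_measure,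
   transported along R * R^n -> R^(n+1). *)
Fixpoint lebesgue_rV (n : nat) : {sigma_finite_measure set 'rV[R]_n -> \bar R} :=
  match n with
  | 0 => dirac (0 : 'rV[R]_0)
  | n'.+1 => lebesgue_rV_step (lebesgue_rV n')
  end.

End lebesgue_rV.

Section smooth.
Variables (R : realType) (n : nat).
Local Notation Rn := 'rV[R]_n.
Implicit Types (f g : Rn -> R[i]^o) (s : seq 'I_n).

(* Complex-valued functions of n real variables are differentiated, tested for
   measurability and integrated through their real and imaginary parts. The
   codomain is R[i]^o so that scalar multiplication is over the complex
   numbers (R[i] alone also carries a structure of R-module). *)
Definition ReF f : Rn -> R := fun x => complex.Re (f x).
Definition ImF f : Rn -> R := fun x => complex.Im (f x).

Definition partial (i : 'I_n) f : Rn -> R[i]^o := fun x =>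
  ('D_(delta_mx 0 i) (ReF f) x +i*
   'D_(delta_mx 0 i) (ImF f) x).

(* The multi-index derivative is indexed by the list of successive directions. *)
Definition partials s f : Rn -> R[i]^o := foldr partial f s.

Definition C1 f :=
  [/\ continuous (ReF f),
      continuous (ImF f) &
      forall (i : 'I_n) (x : Rn),
        derivable (ReF f) x (delta_mx 0 i) /\
        derivable (ImF f) x (delta_mx 0 i)].

Definition smooth f := forall s, C1 (partials s f).

Definition compactly_supported f :=
  exists2 K : set Rn, compact K & forall x, ~ K x -> f x = 0.

Definition is_testfun : set (Rn -> R[i]^o) :=
  [set f | smooth f /\ compactly_supported f].

(* (T_h f)(x) = f(x + h) *)
Definition shiftf (h : Rn) f : Rn -> R[i]^o := fun x => f (x + h).

Lemma ReF_lin (a : R[i]) f g : ReF (a *: f + g) =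
  complex.Re a *: ReF f - complex.Im a *: ImF f + ReF g.
Proof.
apply/funext => x; rewrite !fctE /ReF /ImF.
by case: a => a b; case: (f x) => c d; case: (g x).
Qed.

Lemma ImF_lin (a : R[i]) f g : ImF (a *: f + g) =
  complex.Re a *: ImF f + complex.Im a *: ReF f + ImF g.
Proof.
apply/funext => x; rewrite !fctE /ReF /ImF.
by case: a => a b; case: (f x) => c d; case: (g x).
Qed.

Lemma partialD (a : R[i]) i f g : C1 f -> C1 g ->
  partial i (a *: f + g) = a *: partial i f + partial i g.
Proof.
move=> [_ _ df] [_ _ dg]; apply/funext => x.
have [df1 df2] := df i x; have [dg1 dg2] := dg i x.
rewrite /partial ReF_lin ImF_lin.
have Z1 := @derivableZ _ _ _ _ (complex.Re a) _ _ df1; have Z2 := @derivableZ _ _ _ _ (complex.Im a) _ _ df2.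
have Z3 := @derivableZ _ _ _ _ (complex.Re a) _ _ df2; have Z4 := @derivableZ _ _ _ _ (complex.Im a) _ _ df1.
rewrite (deriveD (derivableB Z1 Z2) dg1) (deriveB Z1 Z2).
rewrite (deriveD (derivableD Z3 Z4) dg2) (deriveD Z3 Z4) !deriveZ//.
by case: a {Z1 Z2 Z3 Z4} => a b; rewrite !fctE.
Qed.

Lemma C1D (a : R[i]) f g : C1 f -> C1 g -> C1 (a *: f + g).
Proof.
move=> [cf1 cf2 df] [cg1 cg2 dg]; rewrite /C1 ReF_lin ImF_lin; split.
- move=> x; exact: cvgD (cvgB (cvgZl_tmp (cf1 x)) (cvgZl_tmp (cf2 x))) (cg1 x).
- move=> x; exact: cvgD (cvgD (cvgZl_tmp (cf2 x)) (cvgZl_tmp (cf1 x))) (cg2 x).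
- move=> i x; have [df1 df2] := df i x; have [dg1 dg2] := dg i x.
  split; apply: derivableD => //.
    exact: derivableB (derivableZ df1) (derivableZ df2).
  exact: derivableD (derivableZ df2) (derivableZ df1).
Qed.

Lemma partialsD (a : R[i]) s f g : smooth f -> smooth g ->
  partials s (a *: f + g) = a *: partials s f + partials s g.
Proof.
move=> sf sg; elim: s => //= i s IH.
by rewrite IH partialD.
Qed.

Lemma smoothD (a : R[i]) f g : smooth f -> smooth g -> smooth (a *: f + g).
Proof. by move=> sf sg s; rewrite partialsD//; exact: C1D. Qed.

Lemma derive_shift (F : Rn -> R) (h v x : Rn) :
  'D_v (fun y => F (y + h)) x = 'D_v F (x + h).
Proof.
rewrite /derive (_ : (fun y => F (y + h)) \o shift x = F \o shift (x + h))//.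
by apply/funext => t /=; rewrite addrA.
Qed.

Lemma derivable_shift (F : Rn -> R) (h v x : Rn) :
  derivable F (x + h) v -> derivable (fun y => F (y + h)) x v.
Proof.
rewrite /derivable (_ : (fun y => F (y + h)) \o shift x = F \o shift (x + h))//.
by apply/funext => t /=; rewrite addrA.
Qed.

Lemma continuous_shift (F : Rn -> R) (h : Rn) :
  continuous F -> continuous (fun y : Rn => F (y + h)).
Proof.
move=> cF x; apply: (@continuous_comp _ _ _ (fun y : Rn => y + h) F).
  exact: cvgD cvg_id (cvg_cst h).
exact: cF.
Qed.

Lemma partials_shiftf s h f : partials s (shiftf h f) = shiftf h (partials s f).
Proof.
elim: s => //= i s ->; apply/funext => x.
by rewrite /partial [in RHS]/shiftf; congr Complex; exact: derive_shift.
Qed.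

Lemma C1_shiftf h f : C1 f -> C1 (shiftf h f).
Proof.
move=> [cf1 cf2 df]; split; [exact: continuous_shift cf1|exact: continuous_shift cf2|].
by move=> i x; have [df1 df2] := df i (x + h); split;
  [exact: (@derivable_shift (ReF f))|exact: (@derivable_shift (ImF f))].
Qed.

Lemma is_testfun_shiftf h f : is_testfun f -> is_testfun (shiftf h f).
Proof.
move=> [sf [K cK Kf]]; split.
  by move=> s; rewrite partials_shiftf; exact: C1_shiftf.
exists [set y - h | y in K].
  apply: continuous_compact => //; apply: continuous_subspaceT => x.
  exact: cvgB cvg_id (cvg_cst h).
move=> x Kx; apply: Kf => Kxh; apply: Kx; exists (x + h) => //.
by rewrite addrK.
Qed.

Lemma is_testfunP (a : R[i]) f g :
  is_testfun f -> is_testfun g -> is_testfun (a *: f + g).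
Proof.
move=> [sf [K cK Kf]] [sg [L cL Lg]]; split; first exact: smoothD.
exists (K `|` L); first exact: compactU.
move=> x /not_orP[Kx Lx].
by rewrite !fctE Kf// Lg// scaler0 addr0.
Qed.

Lemma is_testfun0 : is_testfun 0.
Proof.
split; last by exists set0 => //; exact: compact0.
have Re0 : ReF (0 : Rn -> R[i]^o) = cst 0 by [].
have Im0 : ImF (0 : Rn -> R[i]^o) = cst 0 by [].
have C10 : C1 (0 : Rn -> R[i]^o).
  rewrite /C1 Re0 Im0; split; [exact: cst_continuous|exact: cst_continuous|].
  by move=> i x; split; apply: derivable_cst.
suff p0 s : partials s (0 : Rn -> R[i]^o) = 0 by move=> s; rewrite p0.
by elim: s => //= i s ->; apply/funext => x; rewrite /partial Re0 Im0 !derive_cst.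
Qed.

End smooth.

(* The norm of a normed space over R[i] takes its values in R[i]; rnorm is the
   same number seen in R. *)
Definition rnorm (R : realType) (V : normedZmodType R[i]) (x : V) : R :=
  complex.Re `|x|.

Section testfun.
Variables (R : realType) (n : nat).
Local Notation Rn := 'rV[R]_n.

Definition testfun_pred : {pred Rn -> R[i]^o} := mem (@is_testfun R n).

Record testfun := Testfun {
  testfun_val :> Rn -> R[i]^o;
  _ : testfun_val \in testfun_pred }.

HB.instance Definition _ := [isSub for testfun_val].
HB.instance Definition _ := [Choice of testfun by <:].

Lemma testfun_submod_closed : submod_closed testfun_pred.
Proof.
split; first by apply/mem_set; exact: is_testfun0.
by move=> a f g /set_mem Df /set_mem Dg; apply/mem_set; exact: is_testfunP.
Qed.

HB.instance Definition _ := GRing.isSubmodClosed.Build R[i] (Rn -> R[i]^o)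
  testfun_pred testfun_submod_closed.
HB.instance Definition _ := [SubChoice_isSubLmodule of testfun by <:].
HB.instance Definition _ := isPointed.Build testfun 0.

Lemma testfunP (f : testfun) : is_testfun f.
Proof. exact/set_mem/(valP f). Qed.

Definition shift_testfun (h : Rn) (f : testfun) : testfun :=
  Testfun (mem_set (is_testfun_shiftf h (testfunP f))).

Definition Cm_norm (m : nat) (f : testfun) : \bar R :=
  ereal_sup [set (rnorm (partials s f x))%:E |
             s in [set s : seq 'I_n | (size s <= m)%N] & x in [set: Rn]].

Definition is_seminorm (p : testfun -> R) :=
  (forall f g, p (f + g) <= p f + p g) /\
  (forall (a : R[i]) f, p (a *: f) = rnorm a * p f).

(* The continuous seminorms of the inductive limit topology of the spaces
   D_K: their restriction to each D_K is continuous. *)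
Definition LF_seminorm (p : testfun -> R) :=
  is_seminorm p /\
  forall K : set Rn, compact K -> exists (m : nat) (C : R), 0 <= C /\
    forall f : testfun, (forall x, ~ K x -> f x = 0) ->
      ((p f)%:E <= C%:E * Cm_norm m f)%E.

(* The topology of D(R^n): locally convex inductive limit, i.e. the topology
   generated by the balls of the seminorms above. *)
HB.instance Definition _ := @isSubBaseTopological.Build testfun
  ((testfun -> R) * (testfun * R))%type
  [set i | LF_seminorm i.1]
  (fun i => [set f : testfun | i.1 (f - i.2.1) < i.2.2]).

Definition testfun_bounded (B : set testfun) :=
  forall p, LF_seminorm p -> exists M : R, forall f, B f -> p f <= M.

Definition is_distribution : set (testfun -> R[i]^o) :=
  [set u : testfun -> R[i]^o | linear u /\ continuous u].

Definition distrib_pred : {pred testfun -> R[i]^o} := mem is_distribution.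

Record distrib := Distrib {
  distrib_val :> testfun -> R[i]^o;
  _ : distrib_val \in distrib_pred }.

HB.instance Definition _ := [isSub for distrib_val].
HB.instance Definition _ := [Choice of distrib by <:].

Lemma distrib_submod_closed : submod_closed distrib_pred.
Proof.
split.
  apply/mem_set; split; last exact: cst_continuous.
  by move=> a f g; rewrite scaler0 addr0.
move=> a u v /set_mem[lu cu] /set_mem[lv cv]; apply/mem_set; split.
  move=> b f g; rewrite !fctE lu lv !scalerDr !scalerA [b * a]mulrC.
  by rewrite addrACA.
move=> f; exact: cvgD (cvgZl_tmp (cu f)) (cv f).
Qed.

HB.instance Definition _ := GRing.isSubmodClosed.Build R[i]
  (testfun -> R[i]^o) distrib_pred distrib_submod_closed.
HB.instance Definition _ := [SubChoice_isSubLmodule of distrib by <:].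
HB.instance Definition _ := isPointed.Build distrib 0.

(* The strong dual topology on D'(R^n): uniform convergence on the bounded
   subsets of D(R^n). *)
HB.instance Definition _ := @isSubBaseTopological.Build distrib
  (set testfun * (distrib * R))%type
  [set i | testfun_bounded i.1]
  (fun i => [set v : distrib |
    (ereal_sup [set (rnorm (v f - i.2.1 f))%:E | f in i.1] < i.2.2%:E)%E]).

End testfun.

Definition dense_embedding (K : numDomainType)
  (X Y : preTopologicalLmodType K)
  (f : {linear X -> Y}) := [/\ injective f, continuous f & dense (range f)].

Section integral.
Variables (R : realType) (n : nat).
Local Notation Rn := 'rV[R]_n.
Local Notation mu := (lebesgue_rV R n).
Implicit Types f g : Rn -> R[i]^o.

Definition cintegral f : R[i]^o :=
  (\int[mu]_x ReF f x) +i* (\int[mu]_x ImF f x).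

Definition convolution f g : Rn -> R[i]^o :=
  fun x => cintegral (fun y => f (x - y) * g y).

Definition cmeasurable f :=
  measurable_fun [set: Rn] (ReF f : Rn -> measurableTypeR R) /\
  measurable_fun [set: Rn] (ImF f : Rn -> measurableTypeR R).

Definition enorm (x : Rn) : R := Num.sqrt (\sum_i x ord0 i ^+ 2).

Definition schwartz f := smooth f /\
  forall (s : seq 'I_n) (k : nat), exists C : R,
    forall x, (1 + enorm x) ^+ k * rnorm (partials s f x) <= C.

End integral.

Section tib.
Variables (R : realType) (n : nat) (E : completeNormedModType R[i]).
Variables (iota : {linear testfun R n -> E}) (j : {linear E -> distrib R n}).
Local Notation Rn := 'rV[R]_n.
Local Notation mu := (lebesgue_rV R n).

(* iota and j realize the inclusions of D in E and of E in D'; g' = T_h g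
   in E means equality in D', where <T_h u, f> = <u, T_{-h} f>. *)
Definition is_transl (h : Rn) (g g' : E) :=
  forall f : testfun R n, j g' f = j g (shift_testfun (- h) f).

(* Under tib_transl and the injectivity of j, the g' is unique. *)
Definition transl (h : Rn) (g : E) : E := xget 0 [set g' | is_transl h g g'].

Record translation_invariant_Banach_space : Prop := {
  tib_testfun : dense_embedding iota;
  tib_distrib : dense_embedding j;
  (* j \o iota is the usual inclusion of D in D' *)
  tib_inclusion : forall f g : testfun R n,
    j (iota f) g = cintegral (fun x => f x * g x);
  tib_transl : forall (h : Rn) (g : E), exists g', is_transl h g g';
  tib_growth : forall g : E, exists M tau : R, [/\ 0 < M, 0 <= tau &
    forall h : Rn, rnorm (transl h g) <= M * (1 + enorm h) `^ tau] }.

(* The operator norm of T_{-h} on E. *)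
Definition growth (h : Rn) : \bar R :=
  ereal_sup [set (rnorm (transl (- h) g))%:E | g in [set g : E | rnorm g <= 1]].

Definition beurling_norm (u : Rn -> R[i]^o) : \bar R :=
  (\int[mu]_x ((rnorm (u x))%:E * growth x))%E.

(* Functions rather than classes modulo a.e. equality; see act_ae. *)
Definition beurling : set (Rn -> R[i]^o) :=
  [set u | cmeasurable u /\ (beurling_norm u < +oo)%E].

(* The distribution of g is the regular distribution of f, i.e. g is f. *)
Definition represents (g : E) (f : Rn -> R[i]^o) :=
  forall k : testfun R n, j g k = cintegral (fun x => f x * k x).

(* Each pair of Schwartz functions lies in L^1_omega * E, and its image is
   the usual convolution. *)
Definition extends_convolution (act : (Rn -> R[i]^o) -> E -> E) :=
  forall f1 f2, schwartz f1 -> schwartz f2 ->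
    beurling f1 /\
    exists2 g, represents g f2 & represents (act f1 g) (convolution f1 f2).

Record beurling_module (act : (Rn -> R[i]^o) -> E -> E) : Prop := {
  act_ae : forall u v g, beurling u -> beurling v ->
    {ae mu, forall x, u x = v x} -> act u g = act v g;
  act_linearl : forall (a : R[i]) u v g, beurling u -> beurling v ->
    act (a *: u + v) g = a *: act u g + act v g;
  act_linearr : forall u, beurling u -> linear (act u);
  act_assoc : forall u v g, beurling u -> beurling v ->
    beurling (convolution u v) /\ act (convolution u v) g = act u (act v g);
  act_norm : forall u g, beurling u ->
    ((rnorm (act u g))%:E <= beurling_norm u * (rnorm g)%:E)%E }.

End tib.

(* Main.v *)
(** The element u * g is defined weakly, as the integral of u(y) T_{-y} g dy: it
is the vector e with <e, f> = \int u(y) <T_{-y} g, f> dy for all f in D.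
Uniqueness comes from the injectivity of E -> D', and the module laws from
Fubini's theorem under the pairing with D.

Existence needs h |-> T_h g to be norm continuous. Continuity of the individual
T_h is not assumed; a polynomial bound for their operator norms follows from
Baire's theorem, the growth of each orbit, and completeness of E. Strong
continuity then holds on the dense subspace D, hence on E, and the integral is
the limit of integrals of finitely-valued approximations.

A Schwartz function f lies in E as the integral over h of the test functions
chi(. + h) f, for a test function chi of integral 1. No bump function has to be
constructed: if all test functions had integral 0, then D, its dual, and so E would
be trivial. *)

Require Import Defs.
From HB Require Import structures.
From mathcomp Require Import all_boot all_order all_algebra.
From mathcomp Require Import complex.
From mathcomp Require Import all_classical all_reals all_analysis.
From mathcomp Require Import measurable_realfun ring lra.

Import Order.TTheory GRing.Theory Num.Theory.
Import numFieldNormedType.Exports.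

Local Open Scope classical_set_scope.
Local Open Scope ring_scope.
Local Open Scope complex_scope.

(** Continuity of the embeddings enters only through two inequalities: [iota_bound] turns continuity
    of [iota] into a C^m estimate for functions supported in a fixed ball, and [jev_bound] makes
    each evaluation at a test function a bounded functional on [E].

    A vector-valued integral needs an integrable scalar density, and [u] is integrable only against
    the growth function, which may be small at infinity. Since g = T_y T_{-y} g, the polynomial
    bound on translations also bounds the growth from below, by a multiple of a negative power of 1
    + |y|. A power of 1 + |y| can therefore be moved from the scalar factor to the vector factor
    without changing their product. The same device serves when a Schwartz function is rebuilt from
    its localised pieces; there the polynomial bound is absorbed by the rapid decay.

    A convolution is given at every point by an integral that may diverge on a null set, so
    identities between integrands hold only almost everywhere. This is enough, because they are used
    only under one more integral. *)

Section rnorm.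
Context {R : realType}.

Lemma rnormE (V : normedZmodType R[i]) (x : V) : `|x| = (rnorm x)%:C.
Proof.
have : 0 <= `|x| by [].
by rewrite /rnorm lecE/= => /andP[/eqP + _]; case: `|x| => a b /= ->.
Qed.

Lemma rnorm_ge0 (V : normedZmodType R[i]) (x : V) : 0 <= rnorm x.
Proof. by have : 0 <= `|x| by []; rewrite /rnorm lecE/= => /andP[_]. Qed.

Lemma rnorm0 (V : normedZmodType R[i]) : rnorm (0 : V) = 0.
Proof. by rewrite /rnorm normr0. Qed.

Lemma rnorm0_eq0 (V : normedZmodType R[i]) (x : V) : rnorm x = 0 -> x = 0.
Proof. by move=> x0; apply/normr0_eq0; rewrite rnormE x0. Qed.

Lemma rnormN (V : normedZmodType R[i]) (x : V) : rnorm (- x) = rnorm x.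
Proof. by rewrite /rnorm normrN. Qed.

Lemma rnormBC (V : normedZmodType R[i]) (x y : V) : rnorm (x - y) = rnorm (y - x).
Proof. by rewrite /rnorm distrC. Qed.

Lemma rnormD (V : normedZmodType R[i]) (x y : V) :
  rnorm (x + y) <= rnorm x + rnorm y.
Proof. by have := ler_normD x y; rewrite !rnormE -rmorphD/= lecR. Qed.

Lemma rnormZ (V : normedModType R[i]) (a : R[i]) (x : V) :
  rnorm (a *: x) = rnorm a * rnorm x.
Proof.
apply: (@complexI R); rewrite rmorphM/= -!rnormE normrZ.
by congr (_ * _).
Qed.

Lemma rnormM (a b : R[i]) : rnorm (a * b) = rnorm a * rnorm b.
Proof. by apply: (@complexI R); rewrite rmorphM/= -!rnormE normrM. Qed.

Lemma rnormC_def (z : R[i]) : rnorm z = Num.sqrt (complex.Re z ^+ 2 + complex.Im z ^+ 2).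
Proof. by rewrite /rnorm normc_def. Qed.

Lemma rnorm_real (a : R) : rnorm a%:C = `|a|.
Proof. by rewrite rnormC_def /= expr0n addr0 sqrtr_sqr. Qed.

Lemma normRe_le (z : R[i]) : `|complex.Re z| <= rnorm z.
Proof.
by rewrite rnormC_def -sqrtr_sqr ler_sqrt ?lerDl ?addr_ge0 ?sqr_ge0.
Qed.

Lemma normIm_le (z : R[i]) : `|complex.Im z| <= rnorm z.
Proof.
by rewrite rnormC_def -sqrtr_sqr ler_sqrt ?lerDr ?addr_ge0 ?sqr_ge0.
Qed.

Lemma rnorm_leD (z : R[i]) : rnorm z <= `|complex.Re z| + `|complex.Im z|.
Proof.
rewrite rnormC_def -[leRHS]ger0_norm ?addr_ge0// -sqrtr_sqr ler_sqrt ?sqr_ge0//.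
by rewrite sqrrD !real_normK ?num_real// lerD2r lerDl mulrn_wge0 ?mulr_ge0.
Qed.

(* Rotating the integral onto the positive axis gives rnorm_cint. *)
Lemma rnorm_rotation (z : R[i]) : exists2 c : R[i], rnorm c = 1 & (rnorm z)%:C = c * z.
Proof.
have [->|z0] := eqVneq z 0; first by exists 1; rewrite ?mulr0 ?rnorm0// rnorm_real normr1.
have rz0 : rnorm z != 0 by apply: contra_neq z0; exact: rnorm0_eq0.
have cz0 : (rnorm z)%:C != 0 :> R[i] by rewrite (inj_eq (@complexI R) _ 0).
exists ((rnorm z)%:C / z); last by rewrite divfK.
have : rnorm ((rnorm z)%:C / z) * rnorm z = rnorm z.
  by rewrite -rnormM divfK// rnorm_real ger0_norm// rnorm_ge0.
by move=> h; apply: (mulIf rz0); rewrite h mul1r.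
Qed.

(** Balls of a normed space over [R[i]] have complex radii, but a positive complex number is real.
    This restates completeness with real epsilons, the only form used below. *)
Lemma rnorm_cauchy_cvg (V : completeNormedModType R[i]) (x : V ^nat) :
  (forall e : R, 0 < e -> exists N, forall m n, (N <= m)%N -> (N <= n)%N ->
     rnorm (x m - x n) <= e) ->
  exists l, forall e : R, 0 < e -> exists N, forall n, (N <= n)%N -> rnorm (x n - l) <= e.
Proof.
move=> Cx.
have posC (e : R[i]) : 0 < e -> exists2 r : R, 0 < r & e = r%:C.
  by case: e => a b; rewrite ltcE/= => /andP[/eqP -> a0]; exists a.
have : cvg (x @ \oo).
  apply: cauchy_cvg; apply: cauchy_exP => e /posC[r r0 ->].
  have [N HN] := Cx (r / 2) (divr_gt0 r0 (ltr0n _ 2)).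
  exists (x N); rewrite /fmapE -ball_normE; exists N => // n /= Nn.
  rewrite rnormE ltcR (le_lt_trans (HN _ _ _ _))//.
  by rewrite ltr_pdivrMr// mulr_natr mulr2n ltrDl.
rewrite cvg_ex => -[l /cvgrPdist_lt xl]; exists l => e e0.
have /xl[N _ HN] : 0 < e%:C :> R[i] by rewrite ltcR.
exists N => n Nn; have := HN n Nn; rewrite rnormE ltcR rnormBC.
exact: ltW.
Qed.

End rnorm.

(** * Complex-valued integrals *)

Section complex_measurable.
Context {R : realType} {d : measure_display} {T : measurableType d}.
Implicit Types f g : T -> R[i].

Definition cmeas f :=
  measurable_fun [set: T] (fun x => complex.Re (f x)) /\
  measurable_fun [set: T] (fun x => complex.Im (f x)).

Lemma cmeas_cst (c : R[i]) : cmeas (fun=> c).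
Proof. by split; exact: measurable_cst. Qed.

Lemma cmeasD f g : cmeas f -> cmeas g -> cmeas (fun x => f x + g x).
Proof.
move=> [f1 f2] [g1 g2]; split.
  under eq_fun do rewrite raddfD/=; exact: measurable_funD.
by under eq_fun do rewrite raddfD/=; exact: measurable_funD.
Qed.

Lemma ReMc (a b : R[i]) : complex.Re (a * b) =
  complex.Re a * complex.Re b - complex.Im a * complex.Im b.
Proof. by case: a b => a1 a2 [b1 b2]. Qed.

Lemma ImMc (a b : R[i]) : complex.Im (a * b) =
  complex.Re a * complex.Im b + complex.Im a * complex.Re b.
Proof. by case: a b => a1 a2 [b1 b2]. Qed.

Lemma cmeasM f g : cmeas f -> cmeas g -> cmeas (fun x => f x * g x).
Proof.
move=> [f1 f2] [g1 g2]; split.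
  under eq_fun do rewrite ReMc.
  by apply: measurable_funB; exact: measurable_funM.
under eq_fun do rewrite ImMc.
by apply: measurable_funD; exact: measurable_funM.
Qed.

Lemma cmeas_real (g : T -> R) : measurable_fun [set: T] g -> cmeas (fun x => (g x)%:C).
Proof. by move=> mg; split => //=; exact: measurable_cst. Qed.

Lemma measurable_rnorm f : cmeas f -> measurable_fun [set: T] (fun x => rnorm (f x)).
Proof.
move=> [f1 f2]; under eq_fun do rewrite rnormC_def.
apply: (@measurableT_comp _ _ _ _ _ _ (@Num.sqrt R)).
  apply: continuous_measurable_fun; exact: sqrt_continuous.
by apply: measurable_funD; exact: measurable_funX.
Qed.

End complex_measurable.

Lemma cmeas_comp {R : realType} {d d' : measure_display} {T : measurableType d}
  {T' : measurableType d'} (f : T' -> R[i]) (h : T -> T') :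
  cmeas f -> measurable_fun [set: T] h -> cmeas (fun x => f (h x)).
Proof.
by move=> [f1 f2] mh; split; [apply: measurableT_comp f1 mh|apply: measurableT_comp f2 mh].
Qed.

Section complex_integral.
Context {R : realType} {d : measure_display} {T : measurableType d}.
Variable m : {measure set T -> \bar R}.
Implicit Types f g : T -> R[i].

Definition cint f : R[i] :=
  (\int[m]_x complex.Re (f x)) +i* (\int[m]_x complex.Im (f x)).

Definition cintegrable f :=
  cmeas f /\ (\int[m]_x (rnorm (f x))%:E < +oo)%E.

Lemma cintegrableP f : cintegrable f <->
  m.-integrable [set: T] (fun x => (complex.Re (f x))%:E) /\
  m.-integrable [set: T] (fun x => (complex.Im (f x))%:E).
Proof.
split=> [[[f1 f2] fi]|[/[dup] i1 /measurable_int/measurable_EFinP f1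
                        /[dup] i2 /measurable_int/measurable_EFinP f2]].
  have mf : measurable_fun [set: T] (fun x => rnorm (f x)) by apply: measurable_rnorm.
  split; apply/integrableP; (split; first by apply/measurable_EFinP).
    apply: le_lt_trans fi; apply: ge0_le_integral => //=.
    - by apply/measurable_EFinP; exact: measurableT_comp.
    - exact/measurable_EFinP.
    - by move=> x _; rewrite lee_fin normRe_le.
  apply: le_lt_trans fi; apply: ge0_le_integral => //=.
  - by apply/measurable_EFinP; exact: measurableT_comp.
  - exact/measurable_EFinP.
  - by move=> x _; rewrite lee_fin normIm_le.
have mf : cmeas f by split.
split => //.
apply: (@le_lt_trans _ _ (\int[m]_x (`|(complex.Re (f x))%:E| + `|(complex.Im (f x))%:E|))%E).
  apply: ge0_le_integral => //=.
  - by move=> x _; rewrite lee_fin rnorm_ge0.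
  - by apply/measurable_EFinP/measurable_rnorm.
  - by apply: emeasurable_funD; apply/measurable_EFinP; exact: measurableT_comp.
  - by move=> x _; rewrite lee_fin rnorm_leD.
rewrite ge0_integralD//=; first last.
- by apply/measurable_EFinP; exact: measurableT_comp.
- by apply/measurable_EFinP; exact: measurableT_comp.
by apply: lte_add_pinfty; [case/integrableP: i1|case/integrableP: i2].
Qed.

Lemma cintegrableD f g : cintegrable f -> cintegrable g -> cintegrable (fun x => f x + g x).
Proof.
move=> /cintegrableP[f1 f2] /cintegrableP[g1 g2]; apply/cintegrableP; split.
  by under eq_fun do rewrite raddfD EFinD; exact: integrableD.
by under eq_fun do rewrite raddfD EFinD; exact: integrableD.
Qed.

Lemma cintegrableZ (c : R[i]) f : cintegrable f -> cintegrable (fun x => c * f x).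
Proof.
move=> [mf fi]; split; first exact: cmeasM (cmeas_cst _) mf.
under eq_integral do rewrite rnormM EFinM.
rewrite ge0_integralZl//=.
- by rewrite lte_mul_pinfty ?lee_fin ?rnorm_ge0.
- exact/measurable_EFinP/measurable_rnorm.
- by move=> x _; rewrite lee_fin rnorm_ge0.
- by rewrite lee_fin rnorm_ge0.
Qed.

Lemma le_cintegrable f (g : T -> \bar R) : cmeas f -> measurable_fun [set: T] g ->
  (forall x, (rnorm (f x))%:E <= g x)%E -> (\int[m]_x g x < +oo)%E -> cintegrable f.
Proof.
move=> mf mg fg gi; split => //; apply: le_lt_trans gi; apply: ge0_le_integral => //=.
- by move=> x _; rewrite lee_fin rnorm_ge0.
- exact/measurable_EFinP/measurable_rnorm.
Qed.

Lemma cintD f g : cintegrable f -> cintegrable g ->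
  cint (fun x => f x + g x) = cint f + cint g.
Proof.
move=> /cintegrableP[f1 f2] /cintegrableP[g1 g2]; rewrite /cint.
rewrite -[RHS]/((_ + _) +i* (_ + _)) -!RintegralD//.
by congr Complex; apply: eq_Rintegral => x _; rewrite raddfD.
Qed.

Lemma cintZ (c : R[i]) f : cintegrable f -> cint (fun x => c * f x) = c * cint f.
Proof.
move=> /cintegrableP[f1 f2]; rewrite /cint.
have Z a : m.-integrable setT (fun x => (a * complex.Re (f x))%:E).
  by under eq_fun do rewrite EFinM; exact: integrableZl.
have Z' a : m.-integrable setT (fun x => (a * complex.Im (f x))%:E).
  by under eq_fun do rewrite EFinM; exact: integrableZl.
rewrite [X in X +i* _](_ : _ = \int[m]_x
    (complex.Re c * complex.Re (f x) - complex.Im c * complex.Im (f x))); last first.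
  by apply: eq_Rintegral => x _; rewrite ReMc.
rewrite [X in _ +i* X](_ : _ = \int[m]_x
    (complex.Re c * complex.Im (f x) + complex.Im c * complex.Re (f x))); last first.
  by apply: eq_Rintegral => x _; rewrite ImMc.
rewrite RintegralB; [|by []|exact: Z|exact: Z'].
rewrite RintegralD; [|by []|exact: Z'|exact: Z].
do 2 rewrite (@RintegralZl _ _ _ _ _ (fun x => complex.Re (f x)))//.
do 2 rewrite (@RintegralZl _ _ _ _ _ (fun x => complex.Im (f x)))//.
by case: c.
Qed.

Lemma cint0 : cint (fun=> 0) = 0.
Proof. by rewrite /cint/= /Rintegral integral0. Qed.

Lemma eq_cint f g : f =1 g -> cint f = cint g.
Proof. by move=> fg; congr cint; apply/funext. Qed.

Lemma ae_eq_cint f g : cmeas f -> cmeas g ->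
  {ae m, forall x, f x = g x} -> cint f = cint g.
Proof.
move=> [f1 f2] [g1 g2] fg; rewrite /cint /Rintegral; congr (fine _ +i* fine _);
  (apply: ae_eq_integral => //; [exact/measurable_EFinP|exact/measurable_EFinP|]);
  by apply: filterS fg => x /= ->.
Qed.

Lemma rnorm_cint f : cmeas f -> ((rnorm (cint f))%:E <= \int[m]_x (rnorm (f x))%:E)%E.
Proof.
move=> mf; have [fi|] := ltP (\int[m]_x (rnorm (f x))%:E)%E +oo%E; last first.
  by rewrite leye_eq => /eqP ->; rewrite leey.
have [c c1 cE] := rnorm_rotation (cint f).
have intf : cintegrable f by [].
have /cintegrableP[h1 h2] := cintegrableZ c f intf.
rewrite -[rnorm _]/(complex.Re (rnorm (cint f))%:C) cE -cintZ//=.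
rewrite fineK; last exact: integrable_fin_num.
apply: le_integral => //.
  by case: intf => /measurable_rnorm/measurable_EFinP mr _; apply/integrableP; split => //;
  under eq_integral do rewrite gee0_abs ?lee_fin ?rnorm_ge0//.
by move=> x _; rewrite lee_fin (le_trans (ler_norm _))// (le_trans (normRe_le _))// rnormM c1 mul1r.
Qed.

End complex_integral.

Section complex_fubini.
Context {R : realType} {d1 d2 : measure_display}.
Context {T1 : measurableType d1} {T2 : measurableType d2}.
Variables (m1 : {sigma_finite_measure set T1 -> \bar R}).
Variables (m2 : {sigma_finite_measure set T2 -> \bar R}).
Implicit Types h : T1 * T2 -> R[i].

(** No integrability is required: the inner integral is the difference of the integrals of the
    positive and negative parts, each measurable by Tonelli, even where the difference is a
    conventional value. *)
Let measurable_fubini (k : T1 * T2 -> R) : measurable_fun [set: T1 * T2] k ->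
  measurable_fun [set: T1] (fun x => \int[m2]_y (k (x, y))%:E)%E.
Proof.
move=> mk; pose f := EFin \o k.
have mf : measurable_fun setT f by exact/measurable_EFinP.
rewrite (_ : (fun _ => _) = fun x => (\int[m2]_y (f ^\+ (x, y)) - \int[m2]_y (f ^\- (x, y)))%E).
  by apply: emeasurable_funB; apply: measurable_fun_fubini_tonelli_F => //;
    [exact: measurable_funepos|exact: measurable_funeneg].
by apply/funext => x; rewrite integralE; congr (_ - _)%E; apply: eq_integral => y _;
  rewrite ?funeposE ?funenegE.
Qed.

Lemma cmeas_cint h : cmeas h -> cmeas (fun x => cint m2 (fun y => h (x, y))).
Proof.
move=> [h1 h2]; split.
  by apply: (@measurableT_comp _ _ _ _ _ _ (@fine R)) => //;
    exact: (measurable_fubini (fun p => complex.Re (h p))).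
by apply: (@measurableT_comp _ _ _ _ _ _ (@fine R)) => //;
  exact: (measurable_fubini (fun p => complex.Im (h p))).
Qed.

Lemma measurable_int_rnorm h : cmeas h ->
  measurable_fun [set: T1] (fun x => \int[m2]_y (rnorm (h (x, y)))%:E)%E.
Proof.
by move=> mh; apply: (measurable_fubini (fun p => rnorm (h p))); exact: measurable_rnorm.
Qed.

Lemma cmeas_pair1 h x : cmeas h -> cmeas (fun y => h (x, y)).
Proof. by move=> mh; apply: (@cmeas_comp _ _ _ _ _ h (pair x)) => //; exact: pair1_measurable. Qed.

Lemma rnorm_cint_pair h : cmeas h -> forall x,
  ((rnorm (cint m2 (fun y => h (x, y))))%:E <= \int[m2]_y (rnorm (h (x, y)))%:E)%E.
Proof. by move=> mh x; apply: rnorm_cint; exact: cmeas_pair1. Qed.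

Lemma ae_cintegrable h : cmeas h ->
  (\int[m1]_x \int[m2]_y (rnorm (h (x, y)))%:E < +oo)%E ->
  {ae m1, forall x, cintegrable m2 (fun y => h (x, y))}.
Proof.
move=> mh hoo.
have ih : m1.-integrable setT (fun x => \int[m2]_y (rnorm (h (x, y)))%:E)%E.
  apply/integrableP; split; first exact: measurable_int_rnorm.
  rewrite (eq_integral (fun x => \int[m2]_y (rnorm (h (x, y)))%:E)%E)// => x _.
  by rewrite gee0_abs// integral_ge0// => y _; rewrite lee_fin rnorm_ge0.
have := integrable_ae measurableT ih; apply: filterS => x /= /(_ I) /fin_numPlt/andP[_ xoo].
by split=> //; exact: cmeas_pair1.
Qed.

(** [Rintegral] truncates an infinite inner integral to a real number. Integrability on the product
    confines these points to a null set, so the truncated and the extended inner integrals agree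
    almost everywhere, on both sides. *)
Let fubini_R (k : T1 * T2 -> R) : (m1 \x m2)%E.-integrable setT (EFin \o k) ->
  \int[m1]_x \int[m2]_y k (x, y) = \int[m2]_y \int[m1]_x k (x, y).
Proof.
move=> ik; have mk : measurable_fun setT k by move/measurable_int : ik => /measurable_EFinP.
rewrite /Rintegral.
have mks : measurable_fun setT ((EFin \o k) \o (fun p : T2 * T1 => (p.2, p.1))).
  by apply: measurableT_comp; [exact/measurable_EFinP|
    apply: measurable_fun_pair; [exact: measurable_snd|exact: measurable_fst]].
have iF := integrable_fubini_F ik.
have iG : m2.-integrable setT (fubini_G m1 (EFin \o k)).
  apply: (@integrable_fubini_F _ _ _ _ _ m2 m1 ((EFin \o k) \o (fun p : T2 * T1 => (p.2, p.1)))).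
  apply/(integrable12ltyP _ _ mks)/(integrable21ltyP m1 m2 _).1 => //.
  exact: measurable_int ik.
transitivity (fine (\int[m1]_x fubini_F m2 (EFin \o k) x)).
  congr fine; apply: ae_eq_integral => //.
  - by apply/measurable_EFinP/measurableT_comp => //; exact: (measurable_int _ iF).
  - exact: measurable_int iF.
  - by have := integrable_ae measurableT iF; apply: filterS => x /= + _ => /(_ I) /fineK.
rewrite [X in fine X](Fubini ik).
congr fine; apply/esym; apply: ae_eq_integral => //.
- by apply/measurable_EFinP/measurableT_comp => //; exact: (measurable_int _ iG).
- exact: measurable_int iG.
- by have := integrable_ae measurableT iG; apply: filterS => x /= + _ => /(_ I) /fineK.
Qed.

Lemma cfubini h : cmeas h ->
  (\int[m1]_x \int[m2]_y (rnorm (h (x, y)))%:E < +oo)%E ->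
  cint m1 (fun x => cint m2 (fun y => h (x, y))) =
  cint m2 (fun y => cint m1 (fun x => h (x, y))).
Proof.
move=> mh hoo.
have /cintegrableP[i1 i2] : cintegrable (m1 \x m2)%E h.
  split => //; rewrite fubini_tonelli1//=.
    by apply/measurable_EFinP; exact: measurable_rnorm.
  by move=> x; rewrite lee_fin rnorm_ge0.
by rewrite /cint /=; congr Complex;
  [exact: (fubini_R (fun z => complex.Re (h z)))|exact: (fubini_R (fun z => complex.Im (h z)))].
Qed.

End complex_fubini.

Section cintZ.
Context {R : realType} {d : measure_display} {T : measurableType d}.
Variable m : {measure set T -> \bar R}.

(** Here only the product is known to be integrable, which says nothing about [f] when [c] is 0; in
    that case both sides vanish. [conv_pairing] needs this form, since its factor [G x] may be 0. *)
Lemma cintZ_integrable (c : R[i]) (f : T -> R[i]) : cintegrable m (fun x => c * f x) ->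
  cint m (fun x => c * f x) = c * cint m f.
Proof.
have [->|c0] := eqVneq c 0.
  by move=> _; under eq_cint do rewrite mul0r; rewrite mul0r cint0.
move=> /(cintegrableZ m c^-1) cf; rewrite cintZ//.
by rewrite (_ : f = fun x => c^-1 * (c * f x))//; apply/funext => x; rewrite mulKf.
Qed.

End cintZ.

(** * Translation invariance of n-dimensional Lebesgue measure *)

Section translation.
Variable R : realType.

(** The pushforward under the shift is a measure with the same values on half-open intervals, and
    these determine Lebesgue measure. *)
Lemma lebesgue_measure_shift (a : R) (A : set (measurableTypeR R)) : measurable A ->
  lebesgue_measure ((fun x : measurableTypeR R => x + a : measurableTypeR R) @^-1` A) =
  lebesgue_measure A.
Proof.
move=> mA.
have ms : measurable_fun setT (fun x : measurableTypeR R => x + a : measurableTypeR R).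
  by apply: measurable_funD => //; exact: measurable_cst.
pose P : {measure set (measurableTypeR R) -> \bar R} :=
  measure_function_pushforward__canonical__measure_function_Measure lebesgue_measure ms.
rewrite -[LHS]/(P A); apply/esym/lebesgue_measure_unique => // _ [[b c] _ <-].
rewrite -[RHS]/(lebesgue_measure ((fun x : R => x + a) @^-1` `]b, c]%classic)).
rewrite (_ : _ @^-1` _ = `]b - a, c - a]%classic); last first.
  by apply/seteqP; split => x /=; rewrite !in_itv/= ltrBlDr lerBrDr.
rewrite [LHS]lebesgue_measure_itv [RHS]lebesgue_measure_itv/= !lte_fin ltrD2r.
by case: ifPn => // _; rewrite -!EFinB opprB addrA addrNK.
Qed.

Lemma measurable_shift n (h : 'rV[R]_n) : measurable_fun setT (fun x : 'rV[R]_n => x + h).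
Proof.
apply: measurable_fun_coordP => i; under eq_fun do rewrite mxE.
apply: measurable_funD; [exact: measurable_coord|exact: measurable_cst].
Qed.

(** Induction on the dimension: after splitting off the first coordinate, the shift acts on each
    factor separately, so it preserves the measure of rectangles, and a product measure is unique.
    In dimension 0 there is only one point. *)
Lemma lebesgue_rV_shift n (h : 'rV[R]_n) (A : set 'rV[R]_n) : measurable A ->
  lebesgue_rV R n ((fun x => x + h) @^-1` A) = lebesgue_rV R n A.
Proof.
elim: n h A => [h A mA|n IH h A mA].
  by congr (lebesgue_rV R 0 _); apply/seteqP; split => x /=; rewrite (_ : x + h = x)//;
    apply/rowP => -[].
pose h' := (rV_uncons h).2; pose a := (rV_uncons h).1.
pose tau (p : measurableTypeR R * 'rV[R]_n) : measurableTypeR R * 'rV[R]_n := (p.1 + a, p.2 + h').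
have mtau : measurable_fun setT tau.
  apply: measurable_fun_pair.
    by apply: measurable_funD => //; exact: measurable_cst.
  exact: measurableT_comp (measurable_shift _ h') measurable_snd.
pose P : {measure set (measurableTypeR R * 'rV[R]_n) -> \bar R} :=
  measure_function_pushforward__canonical__measure_function_Measure
    (lebesgue_measure \x lebesgue_rV R n)%E mtau.
have consD p : rV_cons p + h = rV_cons (tau p).
  rewrite -[RHS]/(rV_cons (p.1 + a, p.2 + h')) /rV_cons/= /a /h' /rV_uncons/=.
  apply/rowP => i; rewrite !mxE.
  by case: (@split_ordP 1 n i) => j ->; rewrite !mxE ?(ord1 j)/= ?eqxx ?mulr1n;
    congr (_ + h _ _); exact: val_inj.
rewrite /= /lebesgue_rV_step /pushforward.
rewrite (_ : _ @^-1` (_ @^-1` A) = tau @^-1` (@rV_cons R n @^-1` A)); last first.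
  by apply/seteqP; split => p; rewrite /preimage/= consD.
rewrite -[LHS]/(P _); apply/esym/product_measure_unique => //; last first.
  by rewrite -[X in measurable X]setTI; exact: measurable_rV_cons.
move=> X Y mX mY.
rewrite -[LHS]/((lebesgue_measure \x lebesgue_rV R n)%E
  (((fun x : measurableTypeR R => x + a : measurableTypeR R) @^-1` X) `*`
   ((fun x => x + h') @^-1` Y))).
rewrite [LHS]product_measure1E.
- by congr (_ * _)%E; [exact: lebesgue_measure_shift|exact: IH].
- rewrite -[X in measurable X]setTI; apply: measurable_funD => //; exact: measurable_cst.
- by rewrite -[X in measurable X]setTI; exact: measurable_shift.
Qed.

Local Notation mu n := (lebesgue_rV R n).

Lemma ge0_integral_shift n (h : 'rV[R]_n) (f : 'rV[R]_n -> \bar R) :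
  measurable_fun setT f -> (forall x, 0 <= f x)%E ->
  (\int[mu n]_x f (x + h)%R = \int[mu n]_x f x)%E.
Proof.
move=> mf f0.
rewrite -(@ge0_integral_pushforward _ _ _ _ _ _ (measurable_shift n h) (mu n) setT f)//.
apply: eq_measure_integral; first exact: measurable_shift.
by move=> ms A mA _; exact: lebesgue_rV_shift.
Qed.

Let integral_shift n (h : 'rV[R]_n) (f : 'rV[R]_n -> R) : measurable_fun setT f ->
  (\int[mu n]_x (f (x + h)%R)%:E = \int[mu n]_x (f x)%:E)%E.
Proof.
move=> /measurable_EFinP mf; rewrite [LHS]integralE [RHS]integralE.
rewrite -(@ge0_integral_shift n h ((EFin \o f)^\+)%E)//; last exact: measurable_funepos.
rewrite -(@ge0_integral_shift n h ((EFin \o f)^\-)%E)//; last exact: measurable_funeneg.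
by congr (_ - _)%E; apply: eq_integral => y _; rewrite ?funeposE ?funenegE.
Qed.

Lemma cint_shift n (h : 'rV[R]_n) (f : 'rV[R]_n -> R[i]) : cmeas f ->
  cint (mu n) (fun x => f (x + h)) = cint (mu n) f.
Proof.
move=> [f1 f2]; rewrite /cint /Rintegral.
by rewrite (integral_shift _ h (fun x => complex.Re (f x)))//
  (integral_shift _ h (fun x => complex.Im (f x))).
Qed.

End translation.

(** * Topology and measurability in R^n *)

Section rV_topology.
Context {R : realType} {n : nat}.
Local Notation Rn := 'rV[R]_n.

Lemma coord_le_norm (x : Rn) i : `|x ord0 i| <= `|x|.
Proof.
rewrite [leRHS]/Num.norm /= mx_normrE.
by apply: (le_bigmax_cond _ (j := (ord0, i)) (fun i : 'I_1 * 'I_n => `|x i.1 i.2|)).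
Qed.

Lemma norm_lt_coord (x : Rn) (r : R) : 0 < r -> (forall i, `|x ord0 i| < r) -> `|x| < r.
Proof.
move=> r0 H; rewrite [ltLHS]/Num.norm /= mx_normrE.
by apply/bigmax_ltP; split => // -[i j] _; rewrite /= (ord1 i).
Qed.

Lemma measurable_norm_rV : measurable_fun setT (fun x : Rn => `|x|).
Proof.
under eq_fun do rewrite /Num.norm /= mx_normrE.
elim: (index_enum _) => [|i s IH].
  by under eq_fun do rewrite big_nil; exact: measurable_cst.
under eq_fun do rewrite big_cons; apply: measurable_maxr => //.
apply: measurableT_comp => //; rewrite (ord1 i.1); exact: measurable_coord.
Qed.

(** An enumeration of the points with rational coordinates; numbers that encode no vector give 0. It
    serves both second countability of R^n and separability of the ranges of continuous
    vector-valued maps. *)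
Definition ratpoint (k : nat) : Rn :=
  if @unpickle ('rV[rat]_n) k is Some q then map_mx ratr q else 0.

Lemma ratpoint_dense (x : Rn) (e : R) : 0 < e -> exists k, `|x - ratpoint k| < e.
Proof.
move=> e0.
have /choice[q qP] : forall i, exists q : rat, `|x ord0 i - ratr q| < e.
  move=> i; have /rat_in_itvoo[q] : x ord0 i - e < x ord0 i + e.
    by rewrite ltrBlDr -addrA ltrDl addr_gt0.
  rewrite in_itv/= => /andP[h1 h2]; exists q.
  by rewrite ltr_norml; apply/andP; split; [rewrite ltrBrDr addrC ltrBlDr|rewrite ltrBlDr -ltrBlDl].
exists (pickle (\row_i q i)); rewrite /ratpoint pickleK.
by apply: norm_lt_coord => // i; rewrite !mxE.
Qed.

(** The sigma-algebra is generated by the coordinates, so the topology has to be reached through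
    countably many sets: sup-norm balls with rational centre and radius 1/(m+1). They are measurable
    because the norm is a finite maximum of coordinates. *)
Lemma open_measurable_rV (U : set Rn) : open U -> measurable U.
Proof.
move=> oU.
rewrite (_ : U = \bigcup_k \bigcup_(m in [set m | [set y | `|y - ratpoint k| < m.+1%:R^-1] `<=` U])
    [set y | `|y - ratpoint k| < m.+1%:R^-1]); last first.
  apply/seteqP; split => [x Ux|x [k _ [m /= mU xm]]]; last exact: mU.
  have /nbhs_ballP[e /= e0 eU] : nbhs x U by exact: open_nbhs_nbhs.
  rewrite -ball_normE/= in eU.
  (* With radius below e/2 and [x] inside the ball, every other point of the ball is within e of
     [x]. *)
  have [m me] : exists m, m.+1%:R^-1 < e / 2.
    have e20 : 0 < e / 2 by rewrite divr_gt0.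
    by have [m _ /(_ m (leqnn m))] := near_infty_natSinv_lt (PosNum e20); exists m.
  have [k xk] : exists k, `|x - ratpoint k| < m.+1%:R^-1.
    by apply: ratpoint_dense; rewrite invr_gt0.
  exists k => //; exists m => //= y /= yk; apply: eU => /=.
  rewrite (_ : x - y = (x - ratpoint k) + (ratpoint k - y)); last by rewrite addrA subrK.
  rewrite (le_lt_trans (ler_normD _ _))// (splitr e) ltrD//.
    exact: lt_trans me.
  by rewrite distrC (lt_trans yk).
apply: bigcupT_measurable => k; apply: bigcup_measurable => m _.
rewrite (_ : mkset _ = (fun y : Rn => `|y - ratpoint k|) @^-1` `]-oo, m.+1%:R^-1[); last first.
  by apply/seteqP; split => y /=; rewrite in_itv.
rewrite -[X in measurable X]setTI.
have : measurable_fun setT (fun y : Rn => `|y - ratpoint k|).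
  exact: measurableT_comp measurable_norm_rV (measurable_shift _ _ _).
by apply.
Qed.

(** Lower semicontinuity suffices for measurability. The growth function, a supremum over an
    uncountable family, offers nothing stronger directly. *)
Lemma open_gt_measurable (f : Rn -> \bar R) :
  (forall a : R, open [set x | (a%:E < f x)%E]) -> measurable_fun setT f.
Proof.
move=> of_; apply: (measurability _ (ErealGenOInfty.measurableE R)).
move=> _ [_ [a ->] <-]; rewrite setTI; apply: open_measurable_rV.
rewrite (_ : _ @^-1` _ = [set x | (a%:E < f x)%E])//.
by apply/seteqP; split => x /=; rewrite in_itv/= andbT.
Qed.

Lemma continuous_measurable_rV (f : Rn -> R) : continuous f -> measurable_fun setT f.
Proof.
move=> cf; apply/measurable_EFinP; apply: open_gt_measurable => a.
rewrite (_ : mkset _ = f @^-1` [set y | a < y]).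
  by apply: open_comp => [x _|]; [exact: cf|exact: open_gt].
by apply/seteqP; split => x /=; rewrite lte_fin.
Qed.

End rV_topology.

(** * Integrable polynomial weights *)

Section weight.
Context {R : realType}.

Definition wgt n k (x : 'rV[R]_n) : R := ((1 + `|x|) ^+ k)^-1.

Lemma onePnorm_ge1 n (x : 'rV[R]_n) : 1 <= 1 + `|x|.
Proof. by rewrite lerDl. Qed.

Lemma onePnorm_gt0 n (x : 'rV[R]_n) : 0 < 1 + `|x|.
Proof. by rewrite (lt_le_trans ltr01 (onePnorm_ge1 n x)). Qed.

Lemma onePnormX_gt0 n k (x : 'rV[R]_n) : 0 < (1 + `|x|) ^+ k.
Proof. by rewrite exprn_gt0// onePnorm_gt0. Qed.

Lemma wgt_gt0 n k (x : 'rV[R]_n) : 0 < wgt n k x.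
Proof. by rewrite invr_gt0 onePnormX_gt0. Qed.

Lemma wgt_ge0 n k (x : 'rV[R]_n) : 0 <= wgt n k x.
Proof. exact/ltW/wgt_gt0. Qed.

Lemma continuous_onePnormX n k : continuous (fun x : 'rV[R]_n => (1 + `|x|) ^+ k).
Proof.
move=> x; apply: (@continuous_comp _ _ _ (fun x : 'rV[R]_n => 1 + `|x|) (fun y => y ^+ k)).
  exact: (cvgD (cvg_cst (1 : R)) (@norm_continuous _ 'rV[R]_n x)).
exact: exprn_continuous.
Qed.

Lemma continuous_wgt n k : continuous (wgt n k).
Proof.
move=> x; apply: (@continuousV _ _ (fun x : 'rV[R]_n => (1 + `|x|) ^+ k)).
  by rewrite gt_eqF// onePnormX_gt0.
exact: continuous_onePnormX.
Qed.

Lemma measurable_wgt n k : measurable_fun setT (wgt n k).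
Proof. by apply: continuous_measurable_rV; exact: continuous_wgt. Qed.

(** The unnormalised product Cauchy density. Unlike a weight in the sup norm, it factors over the
    coordinates, so its integral can be computed one variable at a time. *)
Let pw n (x : 'rV[R]_n) : R := \prod_i (oneDsqr (x ord0 i))^-1.

Let pw_ge0 n x : 0 <= pw n x.
Proof. by apply: prodr_ge0 => i _; rewrite invr_ge0 (le_trans ler01)// oneDsqr_ge1. Qed.

Let mpw n : measurable_fun setT (pw n).
Proof.
rewrite /pw; elim: (index_enum _) => [|i s IH].
  by under eq_fun do rewrite big_nil; exact: measurable_cst.
under eq_fun do rewrite big_cons; apply: measurable_funM => //.
apply: (@measurableT_comp _ _ _ _ _ _ (fun x : R => (oneDsqr x)^-1)).
  by apply: continuous_measurable_fun; exact: continuous_oneDsqrV.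
exact: measurable_coord.
Qed.

Let int1 : (\int[@lebesgue_measure R]_x (oneDsqr x)^-1%:E < +oo)%E.
Proof.
have mf : measurable_fun setT (fun x : R => (oneDsqr x)^-1%:E).
  by apply/measurable_EFinP; apply: continuous_measurable_fun; exact: continuous_oneDsqrV.
have f0 x : (0 <= (oneDsqr x)^-1%:E :> \bar R)%E.
  by rewrite lee_fin invr_ge0 (le_trans ler01)// oneDsqr_ge1.
rewrite (_ : setT = `[0, +oo[ `|` `]-oo, 0[); last first.
  by apply/seteqP; split => // x _ /=; rewrite !in_itv/= andbT; case: (leP 0 x); [left|right].
rewrite ge0_integral_setU//=; last 2 first.
- exact: measurable_funS mf.
- by apply/disj_setPS => x [] /=; rewrite !in_itv/= andbT => /le_lt_trans h /h; rewrite ltxx.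
rewrite integral0y_oneDsqr lte_add_pinfty ?ltry//.
apply: (@le_lt_trans _ _ (\int[@lebesgue_measure R]_(x in `]-oo, 0%R]) (oneDsqr x)^-1%:E)%E).
  apply: ge0_subset_integral => //=; first exact: measurable_funS mf.
  by apply: subset_itvl; rewrite bnd_simp.
have := ge0_integration_by_substitution0 mf f0.
under [X in _ = X -> _]eq_integral do rewrite /oneDsqr sqrrN -/(oneDsqr _).
by move=> <-; rewrite integral0y_oneDsqr ltry.
Qed.

Let intpw n : (\int[lebesgue_rV R n]_x (pw n x)%:E < +oo)%E.
Proof.
elim: n => [|n IH].
  rewrite integral_dirac//=; last by apply/measurable_EFinP; exact: mpw.
  by rewrite diracE in_setT mul1e ltry.
rewrite /= /lebesgue_rV_step.
rewrite (@ge0_integral_pushforward _ _ _ _ _ _ (@measurable_rV_cons R n))//; last 2 first.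
- by apply/measurable_EFinP; exact: mpw.
- by move=> x _; rewrite lee_fin pw_ge0.
rewrite fubini_tonelli1//=; last 2 first.
- apply: measurableT_comp; last exact: measurable_rV_cons.
  by apply/measurable_EFinP; exact: mpw.
- by move=> x; rewrite lee_fin pw_ge0.
have pwS a v : (pw n.+1 (rV_cons (a, v)))%:E = ((oneDsqr a)^-1%:E * (pw n v)%:E)%E.
  have := rV_consK (a, v); rewrite /rV_uncons => -[h1 /rowP h2].
  rewrite -EFinM /pw big_ord_recl h1; congr (_ * _)%:E.
  by apply: eq_bigr => i _; have := h2 i; rewrite mxE => ->.
have o0 a : 0 <= (oneDsqr a)^-1 :> R by rewrite invr_ge0 (le_trans ler01)// oneDsqr_ge1.
rewrite (eq_integral (fun a : measurableTypeR R =>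
    (oneDsqr a)^-1%:E * \int[lebesgue_rV R n]_v (pw n v)%:E)%E); last first.
  move=> a _; rewrite /fubini_F -ge0_integralZl//=.
  - by apply: eq_integral => v _; exact: pwS.
  - by apply/measurable_EFinP; exact: mpw.
  - by move=> x _; rewrite lee_fin pw_ge0.
have i0 : (0 <= \int[lebesgue_rV R n]_v (pw n v)%:E)%E.
  by apply: integral_ge0 => x _; rewrite lee_fin pw_ge0.
rewrite ge0_integralZr//=.
- have i1 : (0 <= \int[@lebesgue_measure R]_x (oneDsqr x)^-1%:E)%E.
    by apply: integral_ge0 => x _; rewrite lee_fin o0.
  by apply: lte_mul_pinfty => //; rewrite ge0_fin_numE.
- by apply/measurable_EFinP; apply: continuous_measurable_fun; exact: continuous_oneDsqrV.
Qed.

(** The exponent 2n is chosen for a crude comparison: (1 + |x|)^(2n) is a product of n factors (1 +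
    |x|)^2, and each of them is at least 1 + x_i^2 for its own coordinate. *)
Lemma integral_wgt n : (\int[lebesgue_rV R n]_x (wgt n n.*2 x)%:E < +oo)%E.
Proof.
apply: le_lt_trans (intpw n); apply: ge0_le_integral => //=.
- by move=> x _; rewrite lee_fin wgt_ge0.
- by apply/measurable_EFinP; exact: measurable_wgt.
- by apply/measurable_EFinP; exact: mpw.
move=> x _; rewrite lee_fin /wgt /pw prodfV lef_pV2 ?posrE ?onePnormX_gt0//; last first.
  by apply: prodr_gt0 => i _; rewrite (lt_le_trans ltr01)// oneDsqr_ge1.
rewrite -mul2n exprM -[X in _ ^+ X](card_ord n) -prodr_const.
apply: ler_prod => i _; rewrite (le_trans ler01) ?oneDsqr_ge1//=.
rewrite /oneDsqr sqrrD expr1n mul1r -addrA lerD2l -[leLHS]add0r lerD ?mulrn_wge0//.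
by rewrite -real_normK ?num_real// lerXn2r ?nnegrE// coord_le_norm.
Qed.

End weight.

(** * Integrals of vector-valued functions *)

Section simple_integral.
Context {R : realType} {d : measure_display} {T : measurableType d}.
Variable m : {measure set T -> \bar R}.
Context {E : normedModType R[i]}.
Variable u : T -> R[i].
Hypothesis iu : cintegrable m u.

(* Decision lists spare us from making the sets disjoint. *)
Fixpoint dlval (s : seq (set T * E)) (y : T) : E :=
  if s is (A, e) :: s' then if y \in A then e else dlval s' y else 0.

Fixpoint dlmeas (s : seq (set T * E)) : Prop :=
  if s is (A, _) :: s' then measurable A /\ dlmeas s' else True.

(** The value at [B] of the complex measure with density [u] with respect to [m]. *)
Definition cset (B : set T) : R[i] := cint m (fun y => (\1_B y)%:C * u y).

(** The integral over [B] of [u] times [dlval s]. The domain is an argument so that it can shrink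
    along the list: what the head has claimed is removed before the tail is read. *)
Fixpoint dlint (B : set T) (s : seq (set T * E)) : E :=
  if s is (A, e) :: s' then cset (B `&` A) *: e + dlint (B `\` A) s' else 0.

Let cmeas_indic (B : set T) : measurable B -> cmeas (fun y => (\1_B y : R)%:C).
Proof. by move=> mB; apply: cmeas_real; exact: measurable_indic. Qed.

Let mu_ : cmeas u. Proof. by case: iu. Qed.

Let mru : measurable_fun setT (fun y => rnorm (u y)).
Proof. exact: measurable_rnorm. Qed.

Lemma cintegrable_indicM (f : T -> R[i]) (B : set T) : measurable B ->
  cintegrable m f -> cintegrable m (fun y => (\1_B y)%:C * f y).
Proof.
move=> mB [mf fi]; apply: (@le_cintegrable _ _ _ _ _ (fun y => (rnorm (f y))%:E)) => //.
- by apply: cmeasM => //; exact: cmeas_indic.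
- by apply/measurable_EFinP; exact: measurable_rnorm.
- move=> y; rewrite lee_fin rnormM rnorm_real indicE ger0_norm//.
  by rewrite ler_piMl ?rnorm_ge0//; case: (_ \in _).
Qed.

Lemma rnorm_cint_indic (f : T -> R[i]) (B : set T) : measurable B -> cmeas f ->
  ((rnorm (cint m (fun y => (\1_B y)%:C * f y)))%:E <= \int[m]_(y in B) (rnorm (f y))%:E)%E.
Proof.
move=> mB mf; apply: le_trans (rnorm_cint m _ _) _.
  by apply: cmeasM => //; exact: cmeas_indic.
rewrite [leRHS]integral_mkcond; apply: ge0_le_integral => //.
- by move=> y _; rewrite lee_fin rnorm_ge0.
- by apply/measurable_EFinP; apply: measurable_rnorm; apply: cmeasM => //; exact: cmeas_indic.
- apply/(measurable_restrictT _ mB); apply/measurable_EFinP/measurable_funTS.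
  exact: measurable_rnorm.
- move=> y _; rewrite patchE rnormM rnorm_real indicE ger0_norm//.
  by case: (_ \in _); rewrite ?mul1r ?mul0r.
Qed.

Lemma cint_indic_split (f : T -> R[i]) (A B : set T) : measurable A -> measurable B ->
  cintegrable m f ->
  cint m (fun y => (\1_B y)%:C * f y) =
  cint m (fun y => (\1_(B `&` A) y)%:C * f y) + cint m (fun y => (\1_(B `\` A) y)%:C * f y).
Proof.
move=> mA mB fi; rewrite -cintD; last 2 first.
- by apply: cintegrable_indicM => //; exact: measurableI.
- by apply: cintegrable_indicM => //; exact: measurableD.
apply: eq_cint => y; rewrite -mulrDl -rmorphD/= !indicE in_setI in_setD.
by case: (y \in A); case: (y \in B); rewrite ?addr0 ?add0r.
Qed.

Lemma csetD (A B : set T) : measurable A -> measurable B ->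
  cset B = cset (B `&` A) + cset (B `\` A).
Proof. by move=> mA mB; exact: cint_indic_split. Qed.

Lemma cset_le (B : set T) : measurable B ->
  ((rnorm (cset B))%:E <= \int[m]_(y in B) (rnorm (u y))%:E)%E.
Proof. by move=> mB; exact: rnorm_cint_indic. Qed.

Lemma dlint_split s (A B : set T) : dlmeas s -> measurable A -> measurable B ->
  dlint B s = dlint (B `&` A) s + dlint (B `\` A) s.
Proof.
move=> + mA; elim: s B => [B _ _|[A' e] s IH B [mA' ms] mB]/=; first by rewrite addr0.
rewrite (IH (B `\` A'))//; last exact: measurableD.
rewrite (csetD A (B `&` A'))//; last exact: measurableI.
rewrite scalerDl addrACA; congr (_ *: _ + _ + (_ *: _ + _)).
- by rewrite setIAC.
- by congr dlint; rewrite !setDE setIAC.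
- by rewrite !setDE setIAC.
- by congr dlint; rewrite !setDE setIAC.
Qed.

Lemma measurable_dlval s (F : T -> E) : dlmeas s ->
  (forall e, measurable_fun setT (fun y => rnorm (F y - e))) ->
  measurable_fun setT (fun y => rnorm (dlval s y - F y)).
Proof.
move=> + mF; elim: s => [_|[A e] s IH [mA ms]].
  by under eq_fun do rewrite rnormBC; exact: mF.
rewrite (_ : (fun _ => _) =
    fun y => if y \in A then rnorm (F y - e) else rnorm (dlval s y - F y)); last first.
  by apply/funext => y /=; case: ifP => //; rewrite rnormBC.
apply: measurable_fun_ifT => //; last exact: IH.
apply: (measurable_fun_bool true) => //=.
rewrite setTI (_ : _ @^-1` _ = A)//; apply/seteqP; split => y /=; first exact: set_mem.
exact: mem_set.
Qed.

Let mdl s v : dlmeas s -> measurable_fun setT (fun y => rnorm (u y) * rnorm (dlval s y - v)).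
Proof.
move=> ms; apply: measurable_funM => //.
by apply: (measurable_dlval s (fun=> v)) => // e; exact: measurable_cst.
Qed.

Let mdl2 s s' : dlmeas s -> dlmeas s' ->
  measurable_fun setT (fun y => rnorm (u y) * rnorm (dlval s y - dlval s' y)).
Proof.
move=> ms ms'; apply: measurable_funM => //.
apply: measurable_dlval => // e.
by apply: (measurable_dlval s' (fun=> e)) => // e'; exact: measurable_cst.
Qed.

Let integral_split (g : T -> R) (A B : set T) : measurable A -> measurable B ->
  measurable_fun setT g -> (forall y, 0 <= g y) ->
  (\int[m]_(y in B) (g y)%:E =
   \int[m]_(y in B `&` A) (g y)%:E + \int[m]_(y in B `\` A) (g y)%:E)%E.
Proof.
move=> mA mB mg g0; rewrite -[in LHS](setUIDK B A) ge0_integral_setU//.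
- exact: measurableI.
- exact: measurableD.
- by apply: measurable_funTS; apply/measurable_EFinP.
- by move=> y _; rewrite lee_fin.
- by apply/disj_setPS => y [[_ ?] [_ ?]].
Qed.

(** The constant [v] is spread over the same cells as the list, by additivity of [cset]; each cell
    then contributes [cset] of the cell times a difference of two vectors. *)
Let dlint_cst B s v : measurable B -> dlmeas s ->
  ((rnorm (dlint B s - cset B *: v))%:E <=
    \int[m]_(y in B) (rnorm (u y) * rnorm (dlval s y - v))%:E)%E.
Proof.
elim: s B => [B mB _|[A e] s IH B mB [mA ms]].
  rewrite /= !sub0r rnormN rnormZ EFinM.
  rewrite [leRHS](eq_integral (fun y => (rnorm v)%:E * (rnorm (u y))%:E)%E); last first.
    by move=> y _; rewrite rnormN EFinM muleC.
  rewrite ge0_integralZl//=.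
  - by rewrite muleC lee_wpmul2l ?lee_fin ?rnorm_ge0//; exact: cset_le.
  - by apply/measurable_EFinP; exact: measurable_funTS.
  - by move=> x _; rewrite lee_fin rnorm_ge0.
  - by rewrite lee_fin rnorm_ge0.
rewrite (integral_split _ A B)//;
  [|exact: (mdl ((A, e) :: s))|by move=> y; rewrite mulr_ge0 ?rnorm_ge0].
rewrite (csetD A B)//= scalerDl opprD addrACA -scalerBr.
apply: (@le_trans _ _ ((rnorm (cset (B `&` A) *: (e - v)))%:E +
    (rnorm (dlint (B `\` A) s - cset (B `\` A) *: v))%:E)%E).
  by rewrite -EFinD lee_fin rnormD.
apply: leeD.
  rewrite rnormZ EFinM.
  rewrite [leRHS](eq_integral (fun y => (rnorm (e - v))%:E * (rnorm (u y))%:E)%E); last first.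
    by move=> y; rewrite in_setI => /andP[_ ->]; rewrite EFinM muleC.
  rewrite ge0_integralZl//=.
  - by rewrite muleC lee_wpmul2l ?lee_fin ?rnorm_ge0//; apply: cset_le; exact: measurableI.
  - exact: measurableI.
  - by apply/measurable_EFinP; exact: measurable_funTS.
  - by move=> x _; rewrite lee_fin rnorm_ge0.
  - by rewrite lee_fin rnorm_ge0.
rewrite [leRHS](eq_integral (fun y => (rnorm (u y) * rnorm (dlval s y - v))%:E)%E).
  by apply: IH => //; exact: measurableD.
by move=> y; rewrite in_setD => /andP[_ /negbTE ->].
Qed.

(** This is the L^1 estimate that makes approximating integrals Cauchy. The domain is cut along the
    first set of [s']: inside, [s'] is constant and [dlint_cst] applies; outside, the induction
    does. *)
Lemma dlint_le B s s' : measurable B -> dlmeas s -> dlmeas s' ->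
  ((rnorm (dlint B s - dlint B s'))%:E <=
    \int[m]_(y in B) (rnorm (u y) * rnorm (dlval s y - dlval s' y))%:E)%E.
Proof.
move=> + ms; elim: s' B => [B mB _|[A e] s' IH B mB [mA ms']].
  by have := dlint_cst B s 0 mB ms; rewrite scaler0.
rewrite (integral_split _ A B)//;
  [|exact: (mdl2 s ((A, e) :: s'))|by move=> y; rewrite mulr_ge0 ?rnorm_ge0].
rewrite (dlint_split s A B)//= opprD addrACA.
apply: (@le_trans _ _ ((rnorm (dlint (B `&` A) s - cset (B `&` A) *: e))%:E +
    (rnorm (dlint (B `\` A) s - dlint (B `\` A) s'))%:E)%E).
  by rewrite -EFinD lee_fin rnormD.
apply: leeD.
  rewrite [leRHS](eq_integral (fun y => (rnorm (u y) * rnorm (dlval s y - e))%:E)%E).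
    by apply: dlint_cst => //; exact: measurableI.
  by move=> y; rewrite in_setI => /andP[_ ->].
rewrite [leRHS](eq_integral (fun y => (rnorm (u y) * rnorm (dlval s y - dlval s' y))%:E)%E).
  by apply: IH => //; exact: measurableD.
by move=> y; rewrite in_setD => /andP[_ /negbTE ->].
Qed.

Lemma cintegrable_dlval (l : {linear E -> R[i]^o}) s : dlmeas s ->
  cintegrable m (fun y => u y * l (dlval s y)).
Proof.
elim: s => [_|[A e] s IH [mA ms]] /=.
  under eq_fun do rewrite linear0 mulr0.
  by have := cintegrableZ m 0 _ iu; under eq_fun do rewrite mul0r.
have i1 := cintegrable_indicM _ _ mA (cintegrableZ m (l e) _ iu).
have i2 := cintegrable_indicM _ _ (measurableC mA) (IH ms).
have := cintegrableD m _ _ i1 i2; congr cintegrable; apply/funext => y.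
rewrite !indicE in_setC; case: (y \in A) => /=.
  by rewrite mul1r mul0r addr0 mulrC.
by rewrite mul1r mul0r add0r.
Qed.

Lemma linear_dlint (l : {linear E -> R[i]^o}) B s : measurable B -> dlmeas s ->
  l (dlint B s) = cint m (fun y => (\1_B y)%:C * (u y * l (dlval s y))).
Proof.
elim: s B => [B mB _|[A e] s IH B mB [mA ms]].
  by rewrite /= linear0; under eq_cint do rewrite mulr0 mulr0; rewrite cint0.
rewrite (cint_indic_split _ A B)//; last exact: (cintegrable_dlval l ((A, e) :: s)).
rewrite /= linearD linearZ/= IH//; last exact: measurableD.
congr (_ + _).
  rewrite -[LHS]/(cset (B `&` A) * l e) mulrC -cintZ; last first.
    by apply: cintegrable_indicM => //; exact: measurableI.
  apply: eq_cint => y; rewrite indicE in_setI; case: (y \in A); last by rewrite andbF !mul0r mulr0.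
  by rewrite mulrCA (mulrC (l e)).
apply: eq_cint => y; rewrite indicE in_setD; case: (y \in A) => //=.
by rewrite andbF !mul0r.
Qed.

End simple_integral.

Section bochner.
Context {R : realType} {d : measure_display} {T : measurableType d}.
Variable m : {measure set T -> \bar R}.
Context {E : completeNormedModType R[i]}.
Variable u : T -> R[i].
Hypothesis iu : cintegrable m u.

(** Measurability in the manner of Pettis, stated without a sigma-algebra on [E]: distances to fixed
    vectors are measurable, and the range lies in the closure of a countable set. *)
Definition strongly_measurable (F : T -> E) :=
  (forall e, measurable_fun setT (fun y => rnorm (F y - e))) /\
  exists dn : nat -> E, forall y (e : R), 0 < e -> exists k, rnorm (F y - dn k) < e.

Variable F : T -> E.
Hypothesis sF : strongly_measurable F.
Hypothesis uF : (\int[m]_y (rnorm (u y) * rnorm (F y))%:E < +oo)%E.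

Let mF e : measurable_fun setT (fun y => rnorm (F y - e)).
Proof. by case: sF. Qed.

Let mF0 : measurable_fun setT (fun y => rnorm (F y)).
Proof. by have := mF 0; under eq_fun do rewrite subr0. Qed.

Let mru : measurable_fun setT (fun y => rnorm (u y)).
Proof. by apply: measurable_rnorm; case: iu. Qed.

Let muF : measurable_fun setT (fun y => (rnorm (u y) * rnorm (F y))%:E).
Proof. by apply/measurable_EFinP; exact: measurable_funM. Qed.

Let mud s : dlmeas s ->
  measurable_fun setT (fun y => (rnorm (u y) * rnorm (dlval s y - F y))%:E).
Proof.
by move=> ms; apply/measurable_EFinP; apply: measurable_funM => //; exact: measurable_dlval.
Qed.

(** On the points reached by the first N vectors of the countable set, the list is uniformly close
    to [F]. Elsewhere it is 0, and the error is a tail of the finite integral of |u| |F|, small for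
    large N by monotone convergence. *)
Lemma dlval_approx (e : R) : 0 < e -> exists s, dlmeas s /\
  (\int[m]_y (rnorm (u y) * rnorm (dlval s y - F y))%:E <= e%:E)%E.
Proof.
move=> e0; have [_ [dn dnP]] := sF.
set U := (\int[m]_y (rnorm (u y))%:E)%E.
have U0 : (0 <= U)%E by apply: integral_ge0 => y _; rewrite lee_fin rnorm_ge0.
have Ufin : U \is a fin_num by rewrite ge0_fin_numE//; case: iu.
(* The uniform error [dl] has to cost at most e/2 after integration against |u|; the added 1 avoids
   dividing by a zero integral. *)
pose dl : R := e / 2 / (1 + fine U).
have U1 : 0 < 1 + fine U by rewrite ltr_wpDr// fine_ge0.
have dl0 : 0 < dl by rewrite !divr_gt0.
pose A k := [set y | rnorm (F y - dn k) < dl].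
have mA k : measurable (A k).
  rewrite (_ : A k = (fun y => rnorm (F y - dn k)) @^-1` `]-oo, dl[); last first.
    by apply/seteqP; split => y /=; rewrite in_itv.
  by rewrite -[X in measurable X]setTI; apply: mF.
pose C N := \bigcup_(k < N) A k.
have mC N : measurable (C N) by apply: bigcup_measurable.
have CT : \bigcup_N C N = setT.
  apply/seteqP; split => // y _; have [k ky] := dnP y _ dl0.
  by exists k.+1 => //; exists k => /=.
(* At a point of [C N] the list returns [dn k] for the first k whose set [A k] contains the
   point. *)
pose s N := [seq (A k, dn k) | k <- iota 0 N].
have ms N : dlmeas (s N) by rewrite /s; elim: (iota 0 N) => //= k l IH.
have sC N y : C N y -> rnorm (dlval (s N) y - F y) <= dl.
  move=> [k /= kN Ak]; have : k \in iota 0 N by rewrite mem_iota add0n.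
  rewrite /s; elim: (iota 0 N) => //= k' l IH.
  case: ifPn => [/set_mem|/negP Ak']; first by rewrite /A/= rnormBC => /ltW.
  rewrite in_cons => /predU1P[kk'|]; last exact: IH.
  by exfalso; apply: Ak'; rewrite inE -kk'.
have sD N y : ~ C N y -> dlval (s N) y = 0.
  move=> nC; have : forall k, k \in iota 0 N -> ~ A k y.
    by move=> k; rewrite mem_iota add0n => kN Ak; apply: nC; exists k.
  rewrite /s; elim: (iota 0 N) => //= k l IH H.
  rewrite memNset; first by apply: IH => k' kl; apply: H; rewrite in_cons kl orbT.
  by apply: H; rewrite in_cons eqxx.
have ndC : nondecreasing_seq C.
  move=> N N' NN'; apply/subsetPset => y [k kN Ak]; exists k => //=.
  exact: leq_trans NN'.
have g0 y : (0 <= (rnorm (u y) * rnorm (F y))%:E :> \bar R)%E.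
  by rewrite lee_fin mulr_ge0 ?rnorm_ge0.
have := @ge0_nondecreasing_set_cvg_integral _ _ _ C
  (fun y => (rnorm (u y) * rnorm (F y))%:E) m ndC mC
  (fun N => measurable_funTS muF) (fun N y _ => g0 y).
rewrite CT.
set J := (\int[m]_x _)%E.
have Jfin : J \is a fin_num.
  by rewrite ge0_fin_numE//; apply: integral_ge0 => y _; rewrite lee_fin mulr_ge0 ?rnorm_ge0.
move=> cvJ.
have [N JN] : exists N, (J - (e / 2)%:E < \int[m]_(y in C N) (rnorm (u y) * rnorm (F y))%:E)%E.
  have : (J - (e / 2)%:E < J)%E by rewrite lteBlDr// lteDl// lte_fin divr_gt0.
  move=> /open_ereal_gt' oJ.
  have [N _ /(_ N (leqnn N))] := cvJ _ oJ.
  by exists N.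
exists (s N); split => //.
have splitT : setT = C N `|` ~` C N by rewrite setUv.
have sub0 : (\int[m]_(y in ~` C N) (rnorm (u y) * rnorm (F y))%:E <= (e / 2)%:E)%E.
  have : (J = \int[m]_(y in C N) (rnorm (u y) * rnorm (F y))%:E +
              \int[m]_(y in ~` C N) (rnorm (u y) * rnorm (F y))%:E)%E.
    rewrite /J splitT ge0_integral_setU//.
    - exact: measurableC.
    - exact: measurable_funTS.
    - exact/disj_setPCl.
  set a := (\int[m]_(y in C N) _)%E; set b := (\int[m]_(y in ~` C N) _)%E => Jab.
  have a0 : (0 <= a)%E by apply: integral_ge0.
  have b0 : (0 <= b)%E by apply: integral_ge0.
  have af : a \is a fin_num.
    by rewrite ge0_fin_numE// (le_lt_trans _ uF)// -/J Jab leeDl.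
  have bf : b \is a fin_num.
    by rewrite ge0_fin_numE// (le_lt_trans _ uF)// -/J Jab leeDr.
  move: JN; rewrite -/a Jab -(fineK af) -(fineK bf) -EFinN -!EFinD lte_fin lee_fin.
  by rewrite ltrBlDl addrC ltrD2r => /ltW.
rewrite splitT ge0_integral_setU//; last 4 first.
- exact: measurableC.
- by apply: measurable_funTS; exact: mud.
- by move=> y _; rewrite lee_fin mulr_ge0 ?rnorm_ge0.
- exact/disj_setPCl.
rewrite (splitr e) EFinD leeD//; last first.
  apply: le_trans sub0; apply: ge0_le_integral => //.
  - exact: measurableC.
  - by move=> y _; rewrite lee_fin mulr_ge0 ?rnorm_ge0.
  - by apply: measurable_funTS; exact: mud.
  - exact: measurable_funTS.
  - by move=> y /= /sD ->; rewrite sub0r rnormN.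
apply: (@le_trans _ _ (\int[m]_(y in C N) (dl%:E * (rnorm (u y))%:E))%E).
  apply: ge0_le_integral => //.
  - by move=> y _; rewrite lee_fin mulr_ge0 ?rnorm_ge0.
  - by apply: measurable_funTS; exact: mud.
  - by apply: measurable_funTS; apply: measurable_funeM; exact/measurable_EFinP.
  - by move=> y /sC sdl; rewrite -EFinM lee_fin mulrC ler_wpM2r ?rnorm_ge0.
rewrite ge0_integralZl//; last 3 first.
- by apply/measurable_EFinP; exact: measurable_funTS.
- by move=> y _; rewrite lee_fin rnorm_ge0.
- by rewrite lee_fin ltW.
apply: (@le_trans _ _ (dl%:E * U)%E).
  apply: lee_wpmul2l; first by rewrite lee_fin ltW.
  apply: ge0_subset_integral => //; first exact/measurable_EFinP.
  by move=> y _; rewrite lee_fin rnorm_ge0.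
rewrite -(fineK Ufin) -EFinM lee_fin /dl mulrAC ler_pdivrMr// ler_wpM2l ?divr_ge0 ?ltW//.
by rewrite ltrDr.
Qed.

(** The vector is the limit of the integrals of decision lists whose L^1 distance to [F] is at most
    1/(k+1). A bounded functional commutes with each of these finite sums, and boundedness carries
    the identity to the limit. *)
Lemma bochner : exists e : E,
  ((rnorm e)%:E <= \int[m]_y (rnorm (u y) * rnorm (F y))%:E)%E /\
  forall (l : {linear E -> R[i]^o}) (C : R), (forall x, rnorm (l x) <= C * rnorm x) ->
    cmeas (fun y => l (F y) : R[i]) -> l e = cint m (fun y => u y * l (F y)).
Proof.
set J := (\int[m]_y _)%E.
have J0 : (0 <= J)%E by apply: integral_ge0 => y _; rewrite lee_fin mulr_ge0 ?rnorm_ge0.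
have Jfin : J \is a fin_num by rewrite ge0_fin_numE.
have iS k : 0 < k.+1%:R^-1 :> R by rewrite invr_gt0.
have /choice[s sP] : forall k : nat, exists s, dlmeas s /\
    (\int[m]_y (rnorm (u y) * rnorm (dlval s y - F y))%:E <= (k.+1%:R^-1)%:E)%E.
  by move=> k; apply: dlval_approx.
pose I k := dlint m u setT (s k).
have small (e : R) : 0 < e -> exists N, forall k, (N <= k)%N -> k.+1%:R^-1 <= e.
  move=> e0; have [N _ HN] := near_infty_natSinv_lt (PosNum e0).
  by exists N => k /HN/ltW.
have mdd k k' : measurable_fun setT
    (fun y => (rnorm (u y) * rnorm (dlval (s k) y - dlval (s k') y))%:E).
  apply/measurable_EFinP; apply: measurable_funM => //; apply: measurable_dlval => //.
    by case: (sP k).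
  by move=> e; apply: (measurable_dlval (s k') (fun=> e)) => //; case: (sP k').
have m1 k := mud (s k) (sP k).1.
have Icauchy k k' : rnorm (I k - I k') <= k.+1%:R^-1 + k'.+1%:R^-1.
  have := dlint_le m u iu setT (s k) (s k') measurableT (sP k).1 (sP k').1.
  rewrite -lee_fin => /le_trans; apply; rewrite EFinD.
  apply: le_trans (leeD (sP k).2 (sP k').2); rewrite -ge0_integralD//; last 2 first.
  - by move=> y _; rewrite lee_fin mulr_ge0 ?rnorm_ge0.
  - by move=> y _; rewrite lee_fin mulr_ge0 ?rnorm_ge0.
  apply: ge0_le_integral => //.
  - by move=> y _; rewrite lee_fin mulr_ge0 ?rnorm_ge0.
  - exact: emeasurable_funD.
  - move=> y _; rewrite -EFinD lee_fin -mulrDr ler_wpM2l ?rnorm_ge0//.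
    rewrite (rnormBC _ (dlval (s k') y) (F y)) (le_trans _ (rnormD _ _ _))//.
    by rewrite addrA subrK.
have Ile k : ((rnorm (I k))%:E <= J + (k.+1%:R^-1)%:E)%E.
  (* Comparison with the empty list, whose integral is 0, bounds [I k] itself. *)
  have := dlint_le m u iu setT (s k) [::] measurableT (sP k).1 Logic.I.
  rewrite /= subr0 => /le_trans; apply.
  apply: le_trans (leeD (lexx J) (sP k).2); rewrite -ge0_integralD//; last 2 first.
  - by move=> y _; rewrite lee_fin mulr_ge0 ?rnorm_ge0.
  - by move=> y _; rewrite lee_fin mulr_ge0 ?rnorm_ge0.
  apply: ge0_le_integral => //.
  - by move=> y _; rewrite lee_fin mulr_ge0 ?rnorm_ge0.
  - apply/measurable_EFinP; apply: measurable_funM => //.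
    by apply: (measurable_dlval (s k) (fun=> 0)) => //; case: (sP k).
  - exact: emeasurable_funD.
  - move=> y _; rewrite -EFinD lee_fin -mulrDr ler_wpM2l ?rnorm_ge0//.
    by rewrite subr0 (le_trans _ (rnormD _ _ _))// addrC subrK.
have [|e eP] := @rnorm_cauchy_cvg _ _ I.
  move=> e e0; have [N HN] := small (e / 2) (divr_gt0 e0 (ltr0n _ 2)).
  by exists N => k k' /HN h1 /HN h2; rewrite (le_trans (Icauchy _ _))// (splitr e) lerD.
exists e; split.
  rewrite -(fineK Jfin) lee_fin; apply/ler_addgt0Pr => d0 d0_gt0.
  have [N HN] := small (d0 / 2) (divr_gt0 d0_gt0 (ltr0n _ 2)).
  have [N' HN'] := eP (d0 / 2) (divr_gt0 d0_gt0 (ltr0n _ 2)).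
  pose k := maxn N N'.
  have h1 := HN k (leq_maxl _ _); have h2 := HN' k (leq_maxr _ _).
  have h3 : rnorm (I k) <= fine J + k.+1%:R^-1 by rewrite -lee_fin EFinD fineK.
  rewrite (_ : e = (e - I k) + I k); last by rewrite subrK.
  rewrite (le_trans (rnormD _ _ _))// rnormBC (@le_trans _ _ (d0 / 2 + (fine J + d0 / 2)))//.
    by rewrite lerD// (le_trans h3)// lerD2l.
  by rewrite addrCA -splitr.
move=> l C lC ml.
have C0 (x : E) : 0 <= C * rnorm x by exact: le_trans (rnorm_ge0 _ _) (lC x).
have mlu : cmeas (fun y => u y * l (F y)) by apply: cmeasM => //; case: iu.
have ilF : cintegrable m (fun y => u y * l (F y)).
  apply: (@le_cintegrable _ _ _ _ _ (fun y => C%:E * (rnorm (u y) * rnorm (F y))%:E)%E) => //.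
  - by apply: measurable_funeM.
  - by move=> y; rewrite rnormM -EFinM lee_fin mulrCA ler_wpM2l ?rnorm_ge0.
  have [C0'|C0'] := leP 0 C.
    rewrite ge0_integralZl//; last by move=> y _; rewrite lee_fin mulr_ge0 ?rnorm_ge0.
    by rewrite lte_mul_pinfty.
  (* For negative [C], the inequality [0 <= C * rnorm (F y)] forces [F y] to have norm 0. *)
  rewrite integral0_eq ?ltry// => y _.
  have : rnorm (F y) <= 0 by rewrite -(ler_nM2l C0') mulr0.
  move=> F0; have -> : rnorm (F y) = 0 by apply/le_anti; rewrite F0 rnorm_ge0.
  by rewrite mulr0 mule0.
have lI k : l (I k) = cint m (fun y => u y * l (dlval (s k) y)).
  rewrite (linear_dlint m u iu l setT (s k) measurableT (sP k).1).
  by apply: eq_cint => y; rewrite indicE in_setT mul1r.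
have lk k : rnorm (l (I k) - cint m (fun y => u y * l (F y))) <= `|C| * k.+1%:R^-1.
  have is_ : cintegrable m (fun y => u y * l (dlval (s k) y)).
    by apply: cintegrable_dlval => //; case: (sP k).
  rewrite lI -mulN1r -cintZ// -cintD//; last exact: cintegrableZ.
  rewrite -lee_fin (le_trans (rnorm_cint _ _ _))//.
    by apply: cmeasD; [case: is_|apply: cmeasM => //; exact: cmeas_cst].
  rewrite EFinM; apply: le_trans (lee_wpmul2l _ (sP k).2); last by rewrite lee_fin.
  rewrite -ge0_integralZl//; last first.
    by move=> y _; rewrite lee_fin mulr_ge0 ?rnorm_ge0.
  apply: ge0_le_integral => //.
  - by move=> y _; rewrite lee_fin rnorm_ge0.
  - apply/measurable_EFinP; apply: measurable_rnorm.
    by apply: cmeasD; [case: is_|apply: cmeasM => //; exact: cmeas_cst].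
  - by apply: measurable_funeM.
  - move=> y _; rewrite -EFinM lee_fin mulN1r -mulrBr -linearB rnormM mulrCA ler_wpM2l ?rnorm_ge0//.
    by rewrite (le_trans (lC _))// ler_wpM2r ?rnorm_ge0// ler_norm.
apply/eqP; rewrite -subr_eq0; apply/eqP/rnorm0_eq0/le_anti; rewrite rnorm_ge0 andbT.
apply/ler_addgt0Pr => d0 d0_gt0; rewrite add0r.
have C1 : 0 < 1 + `|C| by rewrite ltr_pwDl.
have dC : 0 < d0 / 2 / (1 + `|C|) by rewrite !divr_gt0.
have [N HN] := small _ dC; have [N' HN'] := eP _ dC.
pose k := maxn N N'.
have h1 := HN k (leq_maxl _ _); have h2 := HN' k (leq_maxr _ _).
rewrite (_ : l e - _ = l (e - I k) + (l (I k) - cint m (fun y => u y * l (F y)))); last first.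
  by rewrite linearB addrA subrK.
have tail x : 0 <= x -> x <= d0 / 2 / (1 + `|C|) -> `|C| * x <= d0 / 2.
  move=> x0 xd; rewrite (@le_trans _ _ ((1 + `|C|) * x))// ?ler_wpM2r// ?lerDr//.
  by rewrite mulrC -ler_pdivlMr.
rewrite (le_trans (rnormD _ _ _))// (splitr d0) lerD//.
  rewrite (le_trans (lC _))// (@le_trans _ _ (`|C| * rnorm (e - I k)))//.
    by rewrite ler_wpM2r ?rnorm_ge0// ler_norm.
  by rewrite tail ?rnorm_ge0// rnormBC.
by rewrite (le_trans (lk k))// tail// ltW.
Qed.

End bochner.

(** * Smooth functions and the topologies of D and D' *)

Section smooth_calculus.
Context {R : realType} {n : nat}.
Local Notation Rn := 'rV[R]_n.
Implicit Types (f g : Rn -> R[i]^o) (s : seq 'I_n).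

Definition mulf f g : Rn -> R[i]^o := fun x => f x * g x.

Lemma ReF_mulf f g : ReF (mulf f g) = ReF f * ReF g - ImF f * ImF g.
Proof. by apply/funext => x; rewrite /ReF /mulf ReMc. Qed.

Lemma ImF_mulf f g : ImF (mulf f g) = ReF f * ImF g + ImF f * ReF g.
Proof. by apply/funext => x; rewrite /ImF /mulf ImMc. Qed.

Lemma C1_mulf f g : C1 f -> C1 g -> C1 (mulf f g).
Proof.
move=> [f1 f2 df] [g1 g2 dg]; rewrite /C1 ReF_mulf ImF_mulf; split.
- move=> x; exact: cvgB (cvgM (f1 x) (g1 x)) (cvgM (f2 x) (g2 x)).
- move=> x; exact: cvgD (cvgM (f1 x) (g2 x)) (cvgM (f2 x) (g1 x)).
- move=> i x; have [df1 df2] := df i x; have [dg1 dg2] := dg i x; split.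
    exact: derivableB (derivableM df1 dg1) (derivableM df2 dg2).
  exact: derivableD (derivableM df1 dg2) (derivableM df2 dg1).
Qed.

Lemma partial_mulf i f g : C1 f -> C1 g ->
  partial i (mulf f g) = mulf (partial i f) g + mulf f (partial i g).
Proof.
move=> [f1 f2 df] [g1 g2 dg]; apply/funext => x.
have [df1 df2] := df i x; have [dg1 dg2] := dg i x.
rewrite {1}/partial ReF_mulf ImF_mulf.
rewrite (deriveB (derivableM df1 dg1) (derivableM df2 dg2)).
rewrite (deriveD (derivableM df1 dg2) (derivableM df2 dg1)).
rewrite (deriveM df1 dg1) (deriveM df2 dg2) (deriveM df1 dg2) (deriveM df2 dg1).
rewrite -[RHS]/(partial i f x * g x + f x * partial i g x) /partial.
set a := 'D__ (ReF f) x; set b := 'D__ (ImF f) x.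
set c := 'D__ (ReF g) x; set d := 'D__ (ImF g) x.
rewrite /ReF /ImF; case: (f x) => p q; case: (g x) => r s.
by rewrite /GRing.scale/=; congr Complex; ring.
Qed.

Lemma partial0 i : partial i (0 : Rn -> R[i]^o) = 0.
Proof.
have C0 : C1 (0 : Rn -> R[i]^o) by exact: ((is_testfun0 R n).1 [::]).
have := partialD (-1) i C0 C0.
by rewrite scaler0 addr0 scaleN1r addNr.
Qed.

Lemma C1_sum (I : Type) (r : seq I) (F : I -> Rn -> R[i]^o) :
  (forall k, C1 (F k)) -> C1 (\sum_(k <- r) F k).
Proof.
move=> CF; elim: r => [|k r IH].
  by rewrite big_nil; exact: ((is_testfun0 R n).1 [::]).
by rewrite big_cons -[F k]scale1r; exact: C1D.
Qed.

Lemma partial_sum i (I : Type) (r : seq I) (F : I -> Rn -> R[i]^o) :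
  (forall k, C1 (F k)) -> partial i (\sum_(k <- r) F k) = \sum_(k <- r) partial i (F k).
Proof.
move=> CF; elim: r => [|k r IH]; first by rewrite !big_nil partial0.
rewrite !big_cons -[F k]scale1r partialD ?scale1r ?IH//; exact: C1_sum.
Qed.

(** All ways of sending each direction to one factor or to the other. Derivatives are indexed by
    lists of directions, so the Leibniz rule carries no binomial coefficients: equal terms are
    simply repeated, 2^|s| in all. *)
Fixpoint leib s : seq (seq 'I_n * seq 'I_n) :=
  if s is i :: s' then
    [seq (i :: p.1, p.2) | p <- leib s'] ++ [seq (p.1, i :: p.2) | p <- leib s']
  else [:: ([::], [::])].

Lemma leib_size s p : p \in leib s -> (size p.1 <= size s)%N /\ (size p.2 <= size s)%N.
Proof.
elim: s p => [p|i s IH p] /=; first by rewrite inE => /eqP ->.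
by rewrite mem_cat => /orP[] /mapP[q /IH[h1 h2] ->] /=; rewrite !ltnS ?h1 ?h2 // !leqW.
Qed.

Lemma size_leib s : size (leib s) = (2 ^ size s)%N.
Proof. by elim: s => //= i s IH; rewrite size_cat !size_map IH expnS mul2n addnn. Qed.

Lemma leibniz s f g : smooth f -> smooth g ->
  partials s (mulf f g) = \sum_(p <- leib s) mulf (partials p.1 f) (partials p.2 g).
Proof.
move=> sf sg; elim: s => [|i s IH]; first by rewrite big_seq1.
rewrite [LHS]/= -/(partials s _) IH partial_sum; last by move=> p; exact: C1_mulf.
rewrite [leib _]/= big_cat !big_map/= -big_split/=.
by apply: eq_bigr => p _; rewrite partial_mulf.
Qed.

Lemma smooth_mulf f g : smooth f -> smooth g -> smooth (mulf f g).
Proof.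
by move=> sf sg s; rewrite leibniz//; apply: C1_sum => p; exact: C1_mulf.
Qed.

Lemma is_testfun_mulf f g : is_testfun f -> smooth g -> is_testfun (mulf f g).
Proof.
move=> [sf [K cK Kf]] sg; split; first exact: smooth_mulf.
by exists K => // x Kx; rewrite /mulf Kf// mul0r.
Qed.

Lemma leibniz_le s f g x (A B : R) : smooth f -> smooth g -> 0 <= A ->
  (forall s', (size s' <= size s)%N -> rnorm (partials s' f x) <= A) ->
  (forall s', (size s' <= size s)%N -> rnorm (partials s' g x) <= B) ->
  rnorm (partials s (mulf f g) x) <= 2 ^+ size s * (A * B).
Proof.
move=> sf sg A0 fA gB; rewrite leibniz// fct_sumE.
have : rnorm (\sum_(p <- leib s) mulf (partials p.1 f) (partials p.2 g) x)
   <= \sum_(p <- leib s) (A * B).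
  rewrite big_seq [leRHS]big_seq; elim/big_ind2 : _ => [|a b c d h1 h2|p /leib_size[p1 p2]].
  - by rewrite rnorm0.
  - by rewrite (le_trans (rnormD _ _ _))// lerD.
  - by rewrite /mulf rnormM ler_pM ?rnorm_ge0 ?fA ?gB.
move=> /le_trans; apply.
by rewrite big_const_seq count_predT size_leib iter_addr_0 -natrX mulr_natl.
Qed.

(** There are finitely many lists of length at most m over ['I_n], so finitely many eventual
    properties hold together. It gives one constant, or one neighbourhood, valid for all derivatives
    up to order m. *)
Lemma near_partials (U : Type) (F : set_system U) (P : seq 'I_n -> set U) m :
  Filter F -> (forall s, F (P s)) ->
  \forall t \near F, forall s, (size s <= m)%N -> P s t.
Proof.
move=> FF; elim: m P => [P FP|m IH P FP].
  by apply: filterS (FP [::]) => t Pt [|].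
have H1 : \forall t \near F, forall i s, (size s <= m)%N -> P (i :: s) t.
  by apply: filter_forall => i; exact: (IH (fun s => P (i :: s))).
by apply: filterS2 (FP [::]) H1 => t h0 h1 [|i s]//= /h1.
Qed.

Lemma partials_far r f : (forall x, r < `|x| -> f x = 0) ->
  forall s x, r < `|x| -> partials s f x = 0.
Proof.
move=> fr; elim=> [//|i s IH] x rx /=.
have xr : \forall y \near x, r < `|y|.
  have : open [set y : Rn | r < `|y|].
    by apply: open_comp (@open_gt _ r) => y _; exact: norm_continuous.
  by rewrite openE => /(_ x rx).
rewrite /partial (@near_eq_derive _ _ _ _ (cst 0)); last first.
  by apply: filterS xr => y ry; rewrite /ReF IH.
rewrite (@near_eq_derive _ _ _ (ImF _) (cst 0)); last first.
  by apply: filterS xr => y ry; rewrite /ImF IH.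
by rewrite !derive_cst.
Qed.

Lemma testfun_supp f : is_testfun f -> exists2 r : R, 0 <= r & forall x, r < `|x| -> f x = 0.
Proof.
move=> [_ [K /compact_bounded[M [Mr HM]] Kf]].
exists (Num.max 0 (M + 1)); first by rewrite le_max lexx.
move=> x; rewrite gt_max => /andP[_ Mx]; apply: Kf => Kx.
by have := HM (M + 1); rewrite ltrDl ltr01 => /(_ isT x Kx)/=; rewrite leNgt Mx.
Qed.

Lemma compact_closed_ball_rV r : compact [set x : Rn | `|x| <= r].
Proof.
apply: bounded_closed_compact.
  by exists r; split; rewrite ?num_real// => M rM x /= xr; rewrite (le_trans xr)// ltW.
by apply: closed_comp (@closed_le _ r) => x _; exact: norm_continuous.
Qed.

Lemma rnorm_continuous f : continuous (ReF f) -> continuous (ImF f) ->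
  forall x (e : R), 0 < e -> \forall y \near x, rnorm (f y - f x) < e.
Proof.
move=> f1 f2 x e e0; have e20 : 0 < e / 2 by rewrite divr_gt0.
have /cvgrPdist_lt/(_ _ e20) h1 := f1 x; have /cvgrPdist_lt/(_ _ e20) h2 := f2 x.
apply: filterS2 h1 h2 => y h1 h2; rewrite (le_lt_trans (rnorm_leD _))// (splitr e).
by rewrite raddfB raddfB/= ltrD//= distrC.
Qed.

Lemma locally_bounded_partials g (r : R) m : smooth g -> exists2 B : R, 0 < B &
  forall s, (size s <= m)%N -> forall x : Rn, `|x| <= r -> rnorm (partials s g x) <= B.
Proof.
move=> sg.
suff : \forall B \near +oo, forall s, (size s <= m)%N ->
    forall x : Rn, `|x| <= r -> rnorm (partials s g x) <= B.
  move=> H; have [B [B0 HB]] : exists B : R, 0 < B /\ forall s, (size s <= m)%N ->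
      forall x : Rn, `|x| <= r -> rnorm (partials s g x) <= B.
    near (pinfty_nbhs R) => B; exists B; split; near: B => //.
    exact: nbhs_pinfty_gt.
  by exists B.
apply: near_partials => s.
have [c1 c2 _] := sg s.
have cont : continuous (fun x => rnorm (partials s g x)).
  move=> x; apply/(@cvgrPdist_lt _ _ _ (nbhs x)) => e e0.
  have H := rnorm_continuous _ c1 c2 x e e0; apply: filterS H => y ye.
  rewrite (le_lt_trans _ ye)//; rewrite ler_norml; apply/andP; split.
    by rewrite lerNl opprB lerBlDr (le_trans _ (rnormD _ _ _))// subrK.
  by rewrite lerBlDr rnormBC (le_trans _ (rnormD _ _ _))// subrK.
have /compact_bounded[M [Mr HM]] :=
  continuous_compact (continuous_subspaceT cont) (compact_closed_ball_rV r).
near=> B => x xr; have MB : M < B by near: B; exact: nbhs_pinfty_gt.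
by rewrite (le_trans (ler_norm _))//; apply: (HM _ MB); exists x.
Unshelve. all: by end_near. Qed.

(** For h within 1 of [h0], both shifts vanish once |x| exceeds r + |h0| + 1. On the remaining ball,
    compactness turns continuity at each point into a single neighbourhood of [h0]. *)
Lemma shift_unif_continuous f r (h0 : Rn) (e : R) :
  continuous (ReF f) -> continuous (ImF f) -> (forall x, r < `|x| -> f x = 0) -> 0 < e ->
  \forall h \near h0, forall x, rnorm (f (x + h) - f (x + h0)) <= e.
Proof.
move=> c1 c2 fr e0; pose K := [set x : Rn | `|x| <= r + `|h0| + 1].
have nc := (compact_near_coveringP K).1 (compact_closed_ball_rV _).
have H : \forall h \near h0, K `<=` (fun x => rnorm (f (x + h) - f (x + h0)) <= e).
  apply: (nc _ (nbhs h0) (fun h x => rnorm (f (x + h) - f (x + h0)) <= e)) => x Kx.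
  have e20 : 0 < e / 2 by rewrite divr_gt0.
  have fc := rnorm_continuous _ c1 c2 (x + h0) _ e20.
  have /nbhs_ballP[dl /= dl0 dlP] := fc; rewrite -ball_normE/= in dlP.
  have dl20 : 0 < dl / 2 by rewrite divr_gt0.
  have near2 (y : Rn) : nbhs y [set z | `|y - z| < dl / 2].
    by apply/nbhs_ballP; exists (dl / 2) => //=; rewrite -ball_normE.
  exists ([set y | `|x - y| < dl / 2], [set h | `|h0 - h| < dl / 2]); first by split; exact: near2.
  move=> [x' h] /= [xx' hh'].
  have q1 : rnorm (f (x' + h) - f (x + h0)) < e / 2.
    by apply: dlP => /=; rewrite opprD addrACA (le_lt_trans (ler_normD _ _))// (splitr dl) ltrD.
  have q2 : rnorm (f (x' + h0) - f (x + h0)) < e / 2.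
    apply: dlP => /=; rewrite opprD addrACA subrr addr0 (lt_trans xx')//.
    by rewrite ltr_pdivrMr// mulr_natr mulr2n ltrDl.
  rewrite (_ : _ - _ = (f (x' + h) - f (x + h0)) + (f (x + h0) - f (x' + h0))); last first.
    by rewrite addrA subrK.
  by rewrite (le_trans (rnormD _ _ _))// (splitr e) lerD// ltW// rnormBC.
have H1 : \forall h \near h0, `|h - h0| < 1.
  apply/nbhs_ballP; exists 1 => //=; rewrite -ball_normE => h /=.
  by rewrite distrC.
apply: filterS2 H H1 => h Hh hh x.
have [xK|xK] := leP `|x| (r + `|h0| + 1); first exact: Hh.
have hh0 : `|h| <= `|h0| + 1.
  by rewrite -lerBlDl (le_trans _ (ltW hh))// lerB_dist.
have far k : `|k| <= `|h0| + 1 -> f (x + k) = 0.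
  move=> kh; apply: fr.
  have : `|x| - `|k| <= `|x + k| by have := lerB_normD x k.
  by apply: lt_le_trans; rewrite ltrBrDr (le_lt_trans _ xK)// -addrA lerD2l.
by rewrite !far ?lerDl// subr0 rnorm0 ltW.
Qed.

End smooth_calculus.

(** * Continuity of the two embeddings as explicit estimates *)

Section subbase.
Context {R : realType} {n : nat}.

(** The topology of D is given by a subbase, so a neighbourhood contains a finite intersection of
    seminorm balls around [f], whose centres need not be [f]. *)
Lemma nbhs_testfun (f : testfun R n) (A : set (testfun R n)) : nbhs f A ->
  exists s : seq ((testfun R n -> R) * (testfun R n * R)),
    (forall i, i \in s -> LF_seminorm i.1 /\ i.1 (f - i.2.1) < i.2.2) /\
    (forall g, (forall i, i \in s -> i.1 (g - i.2.1) < i.2.2) -> A g).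
Proof.
rewrite nbhsE => -[_ [[B sB <-] [C BC Cf]] sA].
have [D' sD' DC] : finI_from
  [set i : (testfun R n -> R) * (testfun R n * R) | LF_seminorm i.1]
  (fun i => [set f : testfun R n | i.1 (f - i.2.1) < i.2.2]) C := sB _ BC.
exists (finmap.enum_fset D'); split.
  move=> i iD; split; first by have := sD' _ iD; rewrite inE.
  by have : C f by []; rewrite -DC => /(_ i iD).
by move=> g gA; apply: sA; exists C => //; suff : C g by []; rewrite -DC => i iD; exact: gA.
Qed.

Lemma nbhs_distrib (B : set (testfun R n)) (r : R) : testfun_bounded B -> 0 < r ->
  nbhs (0 : distrib R n) [set v : distrib R n |
    (ereal_sup [set (rnorm (v f - (0 : distrib R n) f))%:E | f in B] < r%:E)%E].
Proof.
move=> bB r0; rewrite nbhsE.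
eexists; last by apply: subset_refl.
split; last first.
  apply: (@le_lt_trans _ _ 0%E); last by rewrite lte_fin.
  by apply: ge_ereal_sup => _ [f _ <-]; rewrite subrr rnorm0.
set A := [set v | _].
exists [set A]; last by rewrite bigcup_set1.
move=> _ ->; exists (finmap.fset1 (B, ((0 : distrib R n), r))).
  by move=> i; rewrite finmap.in_fset1 inE => /eqP ->.
by apply/seteqP; split => [v /(_ (B, (0, r)))|v Av i]; rewrite /= finmap.in_fset1; [apply|move/eqP->].
Qed.

End subbase.

Section rnorm_balls.
Context {R : realType}.

Lemma rnorm_ball_nbhs (E : normedModType R[i]) (e : R) : 0 < e ->
  nbhs (0 : E) [set x | rnorm x < e].
Proof.
move=> e0; apply/nbhs_ballP; exists e%:C; first by rewrite /= ltcR.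
by move=> x; rewrite -ball_normE /= sub0r normrN rnormE ltcR.
Qed.

Lemma nbhs_rnorm_ball (E : normedModType R[i]) (A : set E) : nbhs 0 A ->
  exists2 e : R, 0 < e & forall x, rnorm x < e -> A x.
Proof.
move=> /nbhs_ballP[[e e'] /=]; rewrite ltcE/= => /andP[/eqP -> e0] H.
by exists e => // x xe; apply: H; rewrite -ball_normE /= sub0r normrN rnormE ltcR.
Qed.

End rnorm_balls.

Section embeddings.
Context {R : realType} {n : nat} {E : completeNormedModType R[i]}.
Variables (iota : {linear testfun R n -> E}) (j : {linear E -> distrib R n}).
Local Notation Rn := 'rV[R]_n.

Lemma Cm_norm_le m (f : testfun R n) (M : R) :
  (forall s, (size s <= m)%N -> forall x, rnorm (partials s f x) <= M) ->
  (Cm_norm m f <= M%:E)%E.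
Proof.
by move=> H; apply: ge_ereal_sup => _ [s /= sm [x _ <-]]; rewrite lee_fin H.
Qed.

(** The preimage of the unit ball contains a finite intersection of seminorm balls. On functions
    supported in a fixed ball each of these seminorms is dominated by a C^m norm, and homogeneity
    turns the resulting implication into a linear bound. *)
Lemma iota_bound (r : R) : continuous iota -> exists m, exists2 C : R, 0 <= C &
  forall (f : testfun R n) (M : R), 0 <= M -> (forall x, r < `|x| -> f x = 0) ->
  (forall s, (size s <= m)%N -> forall x, rnorm (partials s f x) <= M) ->
  rnorm (iota f) <= C * M.
Proof.
move=> ci; have := ci 0 [set x | rnorm x < 1].
rewrite linear0 => /(_ (rnorm_ball_nbhs _ 1 ltr01)).
move=> /nbhs_testfun[s [s0 sP]].
suff [m [C C0 HC]] : exists m, exists2 C : R, 0 < C & forall (f : testfun R n) (M : R), 0 <= M ->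
    (forall x, r < `|x| -> f x = 0) ->
    (forall s, (size s <= m)%N -> forall x, rnorm (partials s f x) <= M) ->
    C * M < 1 -> forall i, i \in s -> i.1 (f - i.2.1) < i.2.2.
  exists m, C; first exact: ltW.
  move=> f M M0 fr fM; apply/ler_addgt0Pr => e e0.
  (* [f] is divided by [K], so that [C * M / K < 1]; the summand [e] keeps [K] positive when [C * M]
     is 0. *)
  pose K := C * M + e.
  have K0 : 0 < K by rewrite ltr_wpDl// mulr_ge0// ltW.
  have Ci0 : 0 <= K^-1 by rewrite invr_ge0 ltW.
  have pZ t : partials t ((K^-1)%:C *: f) = (K^-1)%:C *: partials t f.
    have [sf _] := testfunP f.
    have := @partialsD _ _ (K^-1)%:C t f 0 sf (is_testfun0 R n).1.
    rewrite addr0 => ->; have -> : partials t (0 : Rn -> R[i]^o) = 0.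
      by elim: t => //= i t ->; exact: partial0.
    by rewrite addr0.
  have := sP ((K^-1)%:C *: f); rewrite /= linearZ/= rnormZ rnorm_real ger0_norm//.
  rewrite mulrC ltr_pdivrMr// mul1r => h; apply/ltW/h.
  apply: (HC ((K^-1)%:C *: f) (K^-1 * M)).
  - by rewrite mulr_ge0.
  - by move=> x /fr fx; rewrite -[LHS]/((K^-1)%:C * f x) fx mulr0.
  - move=> t tm x; rewrite [partials _ _](pZ t) -[X in rnorm X]/((K^-1)%:C * partials t f x).
    by rewrite rnormM rnorm_real ger0_norm// ler_wpM2l// fM.
  by rewrite mulrCA mulrC ltr_pdivrMr// mul1r ltrDl.
elim: s s0 {sP} => [_|i s IH s0]; first by exists 0%N, 1.
have [|m [C C0 HC]] := IH; first by move=> k ks; apply: s0; rewrite in_cons ks orbT.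
have [[[pD pZ] pK] pi] := s0 i (mem_head _ _).
have [m' [C' [C'0 HC']]] := pK [set x : Rn | `|x| <= r] (compact_closed_ball_rV r).
rewrite sub0r in pi.
(* The room left by the off-centre ball: subadditivity bounds [i.1 (f - i.2.1)] by
   [i.1 f + i.1 (- i.2.1)], so [i.1 f < dl] is enough. This is why the constant grows by
   [C' / dl]. *)
pose dl := i.2.2 - i.1 (- i.2.1).
have dl0 : 0 < dl by rewrite subr_gt0.
exists (maxn m m'), (C + C' / dl); first by rewrite ltr_pwDl// divr_ge0// ltW.
move=> f M M0 fr fM CM k; rewrite in_cons => /predU1P[->|ks]; last first.
  apply: (HC f M) => //.
    by move=> t tm; apply: fM; rewrite (leq_trans tm)// leq_maxl.
  by rewrite (le_lt_trans _ CM)// ler_wpM2r// lerDl divr_ge0// ltW.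
rewrite (le_lt_trans (pD _ _))// -ltrBrDr -/dl.
have : i.1 f <= C' * M.
  rewrite -lee_fin (le_trans (HC' f _))//.
    by move=> x /negP; rewrite -ltNge => /fr.
  rewrite EFinM lee_wpmul2l ?lee_fin//; apply: Cm_norm_le => t tm; apply: fM.
  by rewrite (leq_trans tm)// leq_maxr.
move=> /le_lt_trans; apply.
have : C' / dl * M < 1.
  by rewrite (le_lt_trans _ CM)// ler_wpM2r// lerDr ltW.
by rewrite mulrAC ltr_pdivrMr// mul1r.
Qed.

Lemma jD (a : R[i]) g g' (f : testfun R n) : j (a *: g + g') f = a * j g f + j g' f.
Proof. by rewrite linearP. Qed.

(** Evaluation at a fixed test function, packaged as a scalar linear map on [E], the shape that
    [bochner] expects. *)
Definition jev (f : testfun R n) (g : E) : R[i]^o := j g f.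

Fact jev_linear f : linear (jev f).
Proof. by move=> a g g'; rewrite /jev jD. Qed.

HB.instance Definition _ f := GRing.isLinear.Build _ _ _ _ (jev f) (jev_linear f).

(** A single test function is a bounded set, so the strong dual topology controls evaluation at it.
    A continuous linear functional is bounded: [g] is rescaled to norm e/2, inside the ball given by
    continuity at 0. *)
Lemma jev_bound f : continuous j -> exists2 C : R, 0 <= C & forall g, rnorm (j g f) <= C * rnorm g.
Proof.
move=> cj.
have bf : testfun_bounded [set f] by move=> p _; exists (p f) => _ ->.
have := cj 0 _; rewrite linear0 => /(_ _ (nbhs_distrib _ _ bf ltr01)).
move=> /nbhs_rnorm_ball[e e0 eP]; exists (e / 2)^-1; first by rewrite invr_ge0 divr_ge0// ltW.
move=> g; have [->|g0] := eqVneq g 0.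
  by rewrite rnorm0 mulr0 -/(jev f 0) linear0 rnorm0.
have rg : 0 < rnorm g.
  by rewrite lt_neqAle rnorm_ge0 andbT eq_sym; apply: contra_neq g0; exact: rnorm0_eq0.
pose a := e / 2 / rnorm g; have a0 : 0 < a by rewrite !divr_gt0.
have := eP (a%:C *: g); rewrite rnormZ rnorm_real gtr0_norm// /a divfK ?gt_eqF//.
rewrite ltr_pdivrMr// mulr_natr mulr2n ltrDl => /(_ e0) /=.
move=> H; have : ((rnorm (j (a%:C *: g) f))%:E < 1%:E)%E.
  apply: le_lt_trans H; apply: ereal_sup_ubound; exists f => //.
  by rewrite subr0.
rewrite lte_fin -/(jev f _) linearZ/= -[_ *: _]/(_ * _) rnormM rnorm_real gtr0_norm//.
move=> /ltW; rewrite /a -ler_pdivlMl; last by rewrite !divr_gt0.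
by rewrite mulr1 invf_div mulrC.
Qed.

End embeddings.

(** * Boundedness and strong continuity of translations *)

Section testfun_integrable.
Context {R : realType} {n : nat}.
Local Notation Rn := 'rV[R]_n.
Local Notation mu := (lebesgue_rV R n).
Implicit Types f g : Rn -> R[i]^o.

Lemma C1_cmeas f : C1 f -> cmeas (f : Rn -> R[i]).
Proof. by move=> [c1 c2 _]; split; exact: continuous_measurable_rV. Qed.

Lemma testfun_cmeas (f : testfun R n) : cmeas (f : Rn -> R[i]).
Proof. by have [sf _] := testfunP f; exact: C1_cmeas _ (sf [::]). Qed.

Lemma cintegralE f : cintegral f = cint mu f.
Proof. by []. Qed.

Lemma decay_cintegrable f (C : R) : cmeas (f : Rn -> R[i]) ->
  (forall x, rnorm (f x) <= C * wgt n n.*2 x) -> cintegrable mu (f : Rn -> R[i]).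
Proof.
move=> mf fC; apply: (@le_cintegrable _ _ _ _ _ (fun x => C%:E * (wgt n n.*2 x)%:E)%E) => //.
- by apply: measurable_funeM; apply/measurable_EFinP; exact: measurable_wgt.
have [C0|C0] := leP 0 C.
  rewrite ge0_integralZl//=.
  - by rewrite lte_mul_pinfty// integral_wgt.
  - by apply/measurable_EFinP; exact: measurable_wgt.
  - by move=> x _; rewrite lee_fin wgt_ge0.
have := fC 0; rewrite leNgt => /negP[]; rewrite (lt_le_trans _ (rnorm_ge0 _ _))//.
by rewrite nmulr_rlt0// wgt_gt0.
Qed.

Lemma testfun_decay (f : testfun R n) s k : exists2 C : R, 0 <= C &
  forall x, rnorm (partials s f x) <= C * wgt n k x.
Proof.
have [sf _] := testfunP f; have [r r0 fr] := testfun_supp _ (testfunP f).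
have [B B0 HB] := locally_bounded_partials _ r (size s) sf.
exists (B * (1 + r) ^+ k); first by rewrite mulr_ge0 ?exprn_ge0 ?addr_ge0// ltW.
move=> x; have [xr|xr] := leP `|x| r; last first.
  by rewrite (partials_far r)// rnorm0 !mulr_ge0 ?wgt_ge0 ?exprn_ge0 ?addr_ge0// ltW.
rewrite (le_trans (HB s _ x xr))// -mulrA ler_peMr ?(ltW B0)//.
rewrite /wgt ler_pdivlMr ?onePnormX_gt0// mul1r lerXn2r ?nnegrE ?addr_ge0//.
by rewrite lerD2l.
Qed.

End testfun_integrable.

Section translations.
Context {R : realType} {n : nat} {E : completeNormedModType R[i]}.
Variables (iota : {linear testfun R n -> E}) (j : {linear E -> distrib R n}).
Hypothesis tibE : translation_invariant_Banach_space iota j.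
Local Notation Rn := 'rV[R]_n.
Local Notation mu := (lebesgue_rV R n).
Local Notation T := (transl j).

Lemma j_ext g g' : (forall f, j g f = j g' f) -> g = g'.
Proof.
have [ij _ _] := tib_distrib tibE.
by move=> H; apply: ij; apply: val_inj; apply/funext.
Qed.

Lemma translP h g (f : testfun R n) : j (T h g) f = j g (shift_testfun (- h) f).
Proof.
by have /(_ f) := xgetPex 0 (tib_transl tibE h g).
Qed.

Lemma transl_unique h g g' : is_transl j h g g' -> T h g = g'.
Proof. by move=> H; apply: j_ext => f; rewrite translP H. Qed.

Lemma shift_testfunD h k (f : testfun R n) :
  shift_testfun h (shift_testfun k f) = shift_testfun (h + k) f.
Proof. by apply: val_inj; apply/funext => x /=; rewrite /shiftf addrA. Qed.

Lemma shift_testfun0 (f : testfun R n) : shift_testfun 0 f = f.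
Proof. by apply: val_inj; apply/funext => x /=; rewrite /shiftf addr0. Qed.

Lemma translD h k g : T h (T k g) = T (h + k) g.
Proof. by apply: j_ext => f; rewrite !translP shift_testfunD -opprD addrC. Qed.

Lemma transl0 g : T 0 g = g.
Proof. by apply: j_ext => f; rewrite translP oppr0 shift_testfun0. Qed.

Lemma transl_linear h : linear (T h).
Proof. by move=> a g g'; apply: j_ext => f; rewrite jD !translP jD. Qed.

Lemma transl_at0 h : T h 0 = 0.
Proof. by have := transl_linear h (-1) 0 0; rewrite scaler0 addr0 scaleN1r addNr. Qed.

Lemma translZ h a g : T h (a *: g) = a *: T h g.
Proof. by have := transl_linear h a g 0; rewrite !addr0 transl_at0 addr0. Qed.

Lemma translB h g g' : T h (g - g') = T h g - T h g'.
Proof.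
rewrite addrC [RHS]addrC -(scaleN1r g') -(scaleN1r (T h g')); exact: transl_linear.
Qed.

(** Translation in [E] is known only through the pairing; substitution in the integral of
    [tib_inclusion] identifies it on D with the actual shift. *)
Lemma transl_iota h (f : testfun R n) : T h (iota f) = iota (shift_testfun h f).
Proof.
apply: transl_unique => g; rewrite !(tib_inclusion tibE) !cintegralE.
rewrite -(@cint_shift _ _ h (fun x : Rn => f x * g (x + - h) : R[i])); last first.
  apply: cmeasM (testfun_cmeas f) _; apply: cmeas_comp (testfun_cmeas g) _.
  exact: measurable_shift.
by apply: eq_cint => x; rewrite /= /shiftf addrK.
Qed.

(** One integer serves as constant and as exponent, so that countably many sets exhaust [E], as a
    Baire argument requires. *)
Definition tame m := [set g : E | forall h : Rn, rnorm (T h g) <= m%:R * (1 + `|h|) ^+ m].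

Lemma enorm_le (h : Rn) : enorm h <= n%:R * `|h|.
Proof.
rewrite /enorm -[leRHS]ger0_norm ?mulr_ge0// -sqrtr_sqr ler_sqrt ?sqr_ge0//.
rewrite (@le_trans _ _ (\sum_(i < n) `|h| ^+ 2))//.
  apply: ler_sum => i _; rewrite -real_normK ?num_real// lerXn2r ?nnegrE//.
  exact: coord_le_norm.
rewrite sumr_const card_ord -[leLHS]mulr_natl exprMn ler_wpM2r ?sqr_ge0//.
by case: (n) => [|k]; [rewrite expr0n|rewrite expr2 ler_peMr ?ler1n].
Qed.

Lemma le_enorm (h : Rn) : `|h| <= enorm h.
Proof.
have e0 : 0 <= enorm h by exact: sqrtr_ge0.
apply/ler_addgt0Pr => e e0'; apply/ltW; apply: norm_lt_coord.
  by rewrite ltr_wpDl.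
move=> i; rewrite ltr_pwDr// /enorm -sqrtr_sqr ler_sqrt; last first.
  by apply: sumr_ge0 => k _; rewrite sqr_ge0.
by rewrite (bigD1 i)//= lerDl; apply: sumr_ge0 => k _; rewrite sqr_ge0.
Qed.

(** The real exponent is rounded up, and the factor (1 + n)^N in [K] pays for replacing the
    Euclidean norm of [tib_growth] by the sup norm. *)
Lemma tame_cover g : exists m, tame m g.
Proof.
have [M [tau [M0 tau0 H]]] := tib_growth tibE g.
pose N := (Num.truncn tau).+1; pose K := M * (1 + n%:R) ^+ N.
pose m := maxn N (Num.truncn K).+1; exists m => h.
have h1 : 0 <= enorm h by exact: sqrtr_ge0.
have K0 : 0 <= K by rewrite mulr_ge0 ?exprn_ge0// ltW.
apply: (@le_trans _ _ (K * (1 + `|h|) ^+ N)).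
  rewrite (le_trans (H h))// /K -mulrA ler_wpM2l ?(ltW M0)// -exprMn.
  apply: (@le_trans _ _ ((1 + enorm h) `^ N%:R)).
    by apply: ler_powR; rewrite ?lerDl// ltW// truncnS_gt.
  rewrite powR_mulrn ?addr_ge0// lerXn2r ?nnegrE ?mulr_ge0 ?addr_ge0//.
  rewrite mulrDl !mul1r (le_trans (lerD (lexx 1) (enorm_le h)))//.
  by rewrite mulrDr mulr1 -addrA lerD2l addrA lerDr addr_ge0.
rewrite ler_pM ?exprn_ge0 ?addr_ge0//.
  by rewrite (le_trans (ltW (truncnS_gt K)))// ler_nat leq_maxr.
by rewrite ler_weXn2l ?lerDl// leq_maxl.
Qed.

(* T_h is not yet known to be continuous, so tame m need not be closed: Baire's
   theorem only makes some tame m dense in a ball. *)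
Lemma tame_baire : exists m, exists g0, exists2 r : R, 0 < r &
  forall g, rnorm (g - g0) < r -> forall e : R, 0 < e -> exists2 a, tame m a & rnorm (g - a) < e.
Proof.
apply/not_existsP => H.
(* From a ball at stage m to a smaller ball inside it, whose centre is at least twice its radius
   away from [tame m]. The premise makes the choice total; for a nonpositive radius any value will
   do. *)
have step : forall p : nat * (E * R), exists q : E * R, 0 < p.2.2 ->
    [/\ 0 < q.2, q.2 <= p.2.2 / 2, rnorm (q.1 - p.2.1) <= p.2.2 / 2 &
        forall a, tame p.1 a -> q.2 + q.2 <= rnorm (q.1 - a)].
  move=> [m [g0 r]] /=; have [r0|] := pselect (0 < r); last by exists (g0, r).
  have r20 : 0 < r / 2 by rewrite divr_gt0.
  have /forallNP/(_ g0)/forall2NP/(_ (r / 2))[//|] := H m.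
  move=> /existsNP[g /not_implyP[gr /existsNP[e /not_implyP[e0 /forall2NP ea]]]].
  exists (g, Num.min (e / 2) (r / 2)) => _ /=; split.
  - by rewrite lt_min !divr_gt0.
  - by rewrite ge_min lexx orbT.
  - exact: ltW.
  - move=> a Aa; have [//|/negP] := ea a; rewrite -leNgt; apply: le_trans.
    by rewrite [leRHS]splitr lerD// ge_min lexx.
have [F FP] := choice step.
pose fix c k : E * R := if k is k'.+1 then F (k', c k') else (0, 1).
have c0 k : 0 < (c k).2 by elim: k => //= k IH; have [] := FP (k, c k) IH.
have cP k : [/\ (c k.+1).2 <= (c k).2 / 2, rnorm ((c k.+1).1 - (c k).1) <= (c k).2 / 2 &
        forall a, tame k a -> (c k.+1).2 + (c k.+1).2 <= rnorm ((c k.+1).1 - a)].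
  by have [? ? ? ?] := FP (k, c k) (c0 k).
have nest k l : rnorm ((c (k + l)%N).1 - (c k).1) + (c (k + l)%N).2 <= (c k).2.
  elim: l k => [k|l IH k]; first by rewrite addn0 subrr rnorm0 add0r.
  have := IH k.+1; rewrite addSnnS => h; have [h1 h2 _] := cP k.
  rewrite [leRHS]splitr; apply: le_trans (lerD h2 h1).
  apply: le_trans (lerD (lexx _) h); rewrite addrA lerD2r addrC.
  by rewrite (le_trans _ (rnormD _ _ _))// addrA subrK.
have c2 k : (c k).2 <= 2^-1 ^+ k.
  elim: k => [|k IH]; first by rewrite expr0.
  by have [h _ _] := cP k; rewrite (le_trans h)// exprSr ler_wpM2r// invr_ge0.
have small (e : R) : 0 < e -> exists N, (c N).2 <= e.
  move=> e0; have /cvgrPdist_le/(_ e e0)[N _ HN] : (2^-1 : R) ^+ k @[k --> \oo] --> 0.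
    by apply: cvg_expr; rewrite ger0_norm ?invr_ge0// invf_lt1// ltr1n.
  exists N; rewrite (le_trans (c2 _))//; have := HN N (leqnn N).
  by rewrite sub0r normrN ger0_norm// exprn_ge0// invr_ge0.
have [|g gP] := @rnorm_cauchy_cvg _ _ (fun k => (c k).1).
  move=> e e0; have [N HN] := small (e / 2) (divr_gt0 e0 (ltr0n _ 2)).
  have far k : (N <= k)%N -> rnorm ((c k).1 - (c N).1) <= e / 2.
    move=> Nk; have := nest N (k - N)%N; rewrite subnKC// => h.
    by rewrite (le_trans _ HN)// (le_trans _ h)// lerDl ltW.
  exists N => k l Nk Nl; rewrite (_ : _ - _ = ((c k).1 - (c N).1) + ((c N).1 - (c l).1)).
    by rewrite (le_trans (rnormD _ _ _))// (splitr e) lerD ?far// rnormBC far.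
  by rewrite addrA subrK.
(* The limit is tame for some m, yet it lies within 3/2 of the radius from the centre [(c m.+1).1],
   where every vector of [tame m] is at least twice the radius away. *)
have [m Am] := tame_cover g.
have [_ _ /(_ g Am)] := cP m; apply/negP; rewrite -ltNge.
have [N HN] := gP ((c m.+1).2 / 2) (divr_gt0 (c0 _) (ltr0n _ 2)).
pose k := maxn N m.+1.
have h1 := HN k (leq_maxl _ _).
have h2 : rnorm ((c m.+1).1 - (c k).1) <= (c m.+1).2.
  have := nest m.+1 (k - m.+1)%N; rewrite subnKC ?leq_maxr// rnormBC; apply: le_trans.
  by rewrite lerDl ltW.
rewrite (_ : _ - _ = ((c m.+1).1 - (c k).1) + ((c k).1 - g)); last by rewrite addrA subrK.
rewrite (le_lt_trans (rnormD _ _ _))// ler_ltD//.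
by rewrite (le_lt_trans h1)// ltr_pdivrMr// mulr_natr mulr2n ltrDl.
Qed.

End translations.

Section uniform_boundedness.
Context {R : realType} {n : nat} {E : completeNormedModType R[i]}.
Variables (iota : {linear testfun R n -> E}) (j : {linear E -> distrib R n}).
Hypothesis tibE : translation_invariant_Banach_space iota j.
Local Notation Rn := 'rV[R]_n.
Local Notation T := (transl j).

Lemma jB g g' (f : testfun R n) : j (g - g') f = j g f - j g' f.
Proof. by rewrite -[LHS]/(jev j f (g - g')) linearB. Qed.

(** Density in a ball around [g0] moves to the origin by differences: if a1 approximates g0 + t x
    and a2 approximates g0, then (a1 - a2)/t approximates x, and T_h of it is still controlled. *)
Lemma tame_dense : exists m, exists2 C : R, 0 <= C & forall x : E, exists2 a,
  rnorm (x - a) <= rnorm x / 2 & forall h : Rn, rnorm (T h a) <= C * rnorm x * (1 + `|h|) ^+ m.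
Proof.
have [m [g0 [r r0 H]]] := tame_baire iota j tibE.
exists m, (4 * m%:R / r); first by rewrite !mulr_ge0// invr_ge0 ltW.
move=> x; have [->|x0] := eqVneq x 0.
  by exists 0 => [|h]; rewrite ?subr0 ?(transl_at0 iota j tibE) rnorm0 ?mul0r// mulr0 mul0r.
have rx : 0 < rnorm x.
  by rewrite lt_neqAle rnorm_ge0 andbT eq_sym; apply: contra_neq x0; exact: rnorm0_eq0.
pose t := r / 2 / rnorm x; have t0 : 0 < t by rewrite !divr_gt0.
have tx : rnorm (t%:C *: x) < r.
  rewrite rnormZ rnorm_real gtr0_norm// /t divfK ?gt_eqF//.
  by rewrite ltr_pdivrMr// mulr_natr mulr2n ltrDl.
(* Two errors below t |x| / 4, divided by t, add up to at most |x| / 2. Since t |x| = r/2, the bound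
   2m/t on the translates becomes (4m/r) |x|, the announced constant. *)
pose e := t * rnorm x / 4; have e0 : 0 < e by rewrite !divr_gt0// mulr_gt0.
have [|a1 A1 h1] := H (g0 + t%:C *: x) _ e e0; first by rewrite addrAC subrr add0r.
have [|a2 A2 h2] := H g0 _ e e0; first by rewrite subrr rnorm0.
have tV : 0 < t^-1 by rewrite invr_gt0.
exists ((t^-1)%:C *: (a1 - a2)) => [|h].
  rewrite (_ : x - _ = (t^-1)%:C *: ((g0 + t%:C *: x - a1) - (g0 - a2))); last first.
    rewrite (_ : _ - _ - _ = t%:C *: x - (a1 - a2)).
      by rewrite [in RHS]scalerBr scalerA -rmorphM/= mulVf ?gt_eqF// scale1r.
    rewrite [g0 + _]addrC -!addrA; congr (_ + _).
    by rewrite !opprB addrC addrA subrK addrC.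
  rewrite rnormZ rnorm_real gtr0_norm// -ler_pdivlMl ?invr_gt0// invrK.
  rewrite (le_trans (rnormD _ _ _))// rnormN (le_trans (lerD (ltW h1) (ltW h2)))//.
  by rewrite /e; lra.
rewrite (translZ iota j tibE) (translB iota j tibE) rnormZ rnorm_real gtr0_norm//.
rewrite -ler_pdivlMl ?invr_gt0// invrK (le_trans (rnormD _ _ _))// rnormN.
rewrite (le_trans (lerD (A1 h) (A2 h)))// -mulrDl !mulrA ler_wpM2r ?exprn_ge0 ?addr_ge0//.
rewrite (_ : t * _ * _ * _ * _ = (t * rnorm x) * (4 * m%:R) / r); last by ring.
rewrite /t divfK ?gt_eqF// (_ : r / 2 * _ / r = 2 * m%:R * (r / r)); last by field; rewrite gt_eqF.
by rewrite divff ?gt_eqF// mulr1 mulr_natl mulr2n.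
Qed.

(* By tame_dense, g is the sum of a series of tame vectors with geometrically
   decreasing norms. Their translates form a convergent series in E, whose sum
   is T_h g because it is so in D'. *)
Lemma transl_bound : exists m, exists2 C : R, 0 <= C &
  forall (g : E) (h : Rn), rnorm (T h g) <= C * rnorm g * (1 + `|h|) ^+ m.
Proof.
have [m [C C0 H]] := tame_dense; exists m, (2 * C); first by rewrite mulr_ge0.
have /choice[S SP] : forall x : E, exists a, rnorm (x - a) <= rnorm x / 2 /\
    forall h : Rn, rnorm (T h a) <= C * rnorm x * (1 + `|h|) ^+ m.
  by move=> x; have [a ? ?] := H x; exists a.
move=> g h.
pose x k := iter k (fun y => y - S y) g.
have xk k : rnorm (x k) <= rnorm g * 2^-1 ^+ k.
  elim: k => [|k IH]; first by rewrite expr0 mulr1.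
  by have [h1 _] := SP (x k); rewrite exprSr mulrA (le_trans h1)// ler_wpM2r// invr_ge0.
pose D := C * rnorm g * (1 + `|h|) ^+ m.
have D0 : 0 <= D by rewrite !mulr_ge0 ?rnorm_ge0 ?exprn_ge0 ?addr_ge0.
(* [g - x k] is the sum of the first k tame terms, so consecutive differences of [y] are translates
   of single tame vectors. Their bounds D/2^i add up to the telescoping difference below. *)
pose y k := T h (g - x k).
have yS k l : rnorm (y (k + l)%N - y k) <= 2 * D * 2^-1 ^+ k - 2 * D * 2^-1 ^+ (k + l).
  elim: l => [|l IH]; first by rewrite addn0 !subrr rnorm0.
  rewrite addnS (_ : y _ - _ = (y (k + l).+1 - y (k + l)%N) + (y (k + l)%N - y k)); last first.
    by rewrite addrA subrK.
  have h1 : rnorm (y (k + l).+1 - y (k + l)%N) <= D * 2^-1 ^+ (k + l).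
    rewrite /y -(translB iota j tibE) (_ : _ - _ = S (x (k + l)%N)); last first.
      by rewrite /x iterS -/(x _) !opprB addrC addrA subrK addrC subrK.
    have [_ h1] := SP (x (k + l)%N); rewrite (le_trans (h1 h))// /D.
    rewrite (@le_trans _ _ (C * (rnorm g * 2^-1 ^+ (k + l)) * (1 + `|h|) ^+ m))//.
      by rewrite ler_wpM2r ?exprn_ge0 ?addr_ge0// ler_wpM2l// xk.
    by rewrite mulrA mulrAC.
  rewrite (le_trans (rnormD _ _ _))// (le_trans (lerD h1 IH))//.
  by rewrite exprS; lra.
have y2 k l : (k <= l)%N -> rnorm (y l - y k) <= 2 * D * 2^-1 ^+ k.
  move=> kl; have := yS k (l - k)%N; rewrite subnKC// => /le_trans; apply.
  by rewrite lerBlDr lerDl !mulr_ge0 ?exprn_ge0 ?invr_ge0 ?rnorm_ge0.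
have small (e : R) : 0 < e -> exists N, forall k, (N <= k)%N -> 2^-1 ^+ k <= e.
  move=> e0; have /cvgrPdist_le/(_ e e0)[N _ HN] : (2^-1 : R) ^+ k @[k --> \oo] --> 0.
    by apply: cvg_expr; rewrite ger0_norm ?invr_ge0// invf_lt1// ltr1n.
  by exists N => k /HN; rewrite sub0r normrN ger0_norm// exprn_ge0// invr_ge0.
have [|e eP] := @rnorm_cauchy_cvg _ _ y.
  move=> e e0; have D1 : 0 < 4 * D + 1 by rewrite ltr_wpDl// mulr_ge0.
  have [N HN] := small (e / (4 * D + 1)) (divr_gt0 e0 D1).
  have Ne : 4 * D * 2^-1 ^+ N <= e.
    apply: (@le_trans _ _ ((4 * D + 1) * 2^-1 ^+ N)).
      by rewrite ler_wpM2r ?exprn_ge0 ?invr_ge0// lerDl.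
    by rewrite mulrC -ler_pdivlMr// HN.
  exists N => k l Nk Nl; rewrite (_ : _ - _ = (y k - y N) + (y N - y l)).
    rewrite (le_trans (rnormD _ _ _))// (le_trans _ Ne)//.
    rewrite (le_trans (lerD (y2 _ _ Nk) (lexx _)))// rnormBC.
    by rewrite (le_trans (lerD (lexx _) (y2 _ _ Nl)))//; lra.
  by rewrite addrA subrK.
have y0 : y 0%N = 0 by rewrite /y /x/= subrr (transl_at0 iota j tibE).
(* Against [f], the difference splits into [e - y k] tested on [f] and the remainder [x k] tested on
   the shifted [f]. Both functionals are bounded, so no continuity of T_h is used. *)
have -> : T h g = e.
  apply: (transl_unique iota j tibE) => f.
  have [_ cj _] := tib_distrib tibE.
  have [C1 C10 H1] := jev_bound j f cj.
  have [C2 C20 H2] := jev_bound j (shift_testfun (- h) f) cj.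
  apply/eqP; rewrite -subr_eq0; apply/eqP/rnorm0_eq0/le_anti; rewrite rnorm_ge0 andbT.
  apply/ler_addgt0Pr => d d0; rewrite add0r.
  have K0 : 0 < 2 * (C1 + C2 * rnorm g + 1).
    by rewrite mulr_gt0// ltr_wpDl// addr_ge0// mulr_ge0 ?rnorm_ge0.
  have dK := divr_gt0 d0 K0.
  have [N HN] := small _ dK; have [N' HN'] := eP _ dK.
  pose k := maxn N N'; have h1 := HN k (leq_maxl _ _); have h2 := HN' k (leq_maxr _ _).
  rewrite (_ : _ - _ = j (e - y k) f - j (x k) (shift_testfun (- h) f)); last first.
    by rewrite jB /y (translP iota j tibE) jB opprB addrA addrAC addrK.
  rewrite (le_trans (rnormD _ _ _))// rnormN (le_trans (lerD (H1 _) (H2 _)))//.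
  rewrite rnormBC.
  have q1 : C1 * rnorm (y k - e) <= C1 * (d / (2 * (C1 + C2 * rnorm g + 1))) by rewrite ler_wpM2l.
  have q2 : C2 * rnorm (x k) <= C2 * rnorm g * (d / (2 * (C1 + C2 * rnorm g + 1))).
    rewrite (@le_trans _ _ (C2 * (rnorm g * 2^-1 ^+ k)))// ?ler_wpM2l//.
    by rewrite mulrA ler_wpM2l// mulr_ge0// rnorm_ge0.
  rewrite (le_trans (lerD q1 q2))// -mulrDl mulrA ler_pdivrMr//.
  by rewrite mulrC ler_wpM2l ?(ltW d0)//; have := rnorm_ge0 _ g; nra.
have DE : 2 * C * rnorm g * (1 + `|h|) ^+ m = 2 * D by rewrite /D !mulrA.
rewrite DE; apply/ler_addgt0Pr => d d0; have [N HN] := eP d d0.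
rewrite (_ : e = (e - y N) + (y N - y 0%N)); last by rewrite addrA subrK y0 subr0.
rewrite (le_trans (rnormD _ _ _))// addrC lerD//; last by rewrite rnormBC HN.
by rewrite (le_trans (y2 _ _ (leq0n _)))// expr0 mulr1.
Qed.

End uniform_boundedness.

Section strong_continuity.
Context {R : realType} {n : nat} {E : completeNormedModType R[i]}.
Variables (iota : {linear testfun R n -> E}) (j : {linear E -> distrib R n}).
Hypothesis tibE : translation_invariant_Banach_space iota j.
Local Notation Rn := 'rV[R]_n.
Local Notation T := (transl j).

Definition mul_testfun (f : testfun R n) (g : Rn -> R[i]^o) (sg : smooth g) : testfun R n :=
  Testfun (mem_set (is_testfun_mulf f g (testfunP f) sg)).

Lemma norm_cont (F : Rn -> E) (h0 : Rn) :
  (forall e, 0 < e -> \forall h \near h0, rnorm (F h - F h0) <= e) ->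
  (fun h => rnorm (F h)) @ h0 --> rnorm (F h0).
Proof.
move=> cF; apply/(@cvgrPdist_le _ _ _ (nbhs h0)) => e e0.
have H := cF e e0; apply: filterS H => h he; rewrite (le_trans _ he)//.
rewrite ler_norml; apply/andP; split.
  by rewrite lerNl opprB lerBlDr (le_trans _ (rnormD _ _ _))// subrK.
by rewrite lerBlDr rnormBC (le_trans _ (rnormD _ _ _))// subrK.
Qed.

(** The values of a continuous map at the rational points are dense in its range. *)
Lemma cont_strongly_measurable (F : Rn -> E) :
  (forall h0 e, 0 < e -> \forall h \near h0, rnorm (F h - F h0) <= e) ->
  strongly_measurable F.
Proof.
move=> cF; split=> [v|].
  apply: continuous_measurable_rV => h0; apply: (norm_cont (fun h => F h - v)) => e e0.
  have H := cF h0 e e0; apply: filterS H => h.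
  by rewrite opprB addrA subrK.
exists (fun k => F (ratpoint k)) => h0 e e0.
have e20 : 0 < e / 2 by rewrite divr_gt0.
have /nbhs_ballP[d /= d0 H] := cF h0 _ e20; rewrite -ball_normE/= in H.
have [k kd] := ratpoint_dense h0 d d0; exists k.
rewrite rnormBC (le_lt_trans (H _ kd))// ltr_pdivrMr// mulr_natr mulr2n.
by rewrite ltrDl.
Qed.

Lemma near_norm_le (h0 : Rn) : \forall h \near h0, `|h| <= `|h0| + 1.
Proof.
apply/nbhs_ballP; exists 1 => //=; rewrite -ball_normE => h /= hh.
by rewrite -lerBlDl (le_trans _ (ltW hh))// distrC lerB_dist.
Qed.

(** For h near [h0] the difference is supported in a fixed ball, where [iota_bound] applies; the
    Leibniz rule and uniform continuity of the derivatives of [f] make it small. With [g] = 1 this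
    is strong continuity on D; with [g] Schwartz it makes the localised pieces depend continuously
    on h. *)
Lemma iota_mul_cont (f : testfun R n) (g : Rn -> R[i]^o) (sg : smooth g) (h0 : Rn) (e : R) :
  0 < e -> \forall h \near h0,
  rnorm (iota (mul_testfun (shift_testfun h f) g sg) -
         iota (mul_testfun (shift_testfun h0 f) g sg)) <= e.
Proof.
move=> e0; have [_ ci _] := tib_testfun tibE.
have [sf _] := testfunP f; have [r r0 fr] := testfun_supp _ (testfunP f).
pose r' := r + (`|h0| + 1).
have [m [C C0 HC]] := iota_bound iota r' ci.
have [B B0 HB] := locally_bounded_partials _ r' m sg.
pose A := e / (1 + C * (2 ^+ m * B)).
have K0 : 0 < 1 + C * (2 ^+ m * B).
  by rewrite ltr_pwDl// !mulr_ge0 ?exprn_ge0 ?(ltW B0).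
have A0 : 0 < A by rewrite divr_gt0.
have near1 : \forall h \near h0, forall s, (size s <= m)%N ->
    forall x, rnorm (partials s f (x + h) - partials s f (x + h0)) <= A.
  apply: (near_partials _ (nbhs h0) (fun s h =>
    forall x, rnorm (partials s f (x + h) - partials s f (x + h0)) <= A)) => s.
  have [c1 c2 _] := sf s.
  exact: (shift_unif_continuous _ r h0 A c1 c2 (partials_far r f fr s)).
apply: filterS2 near1 (near_norm_le h0) => h hA hh.
pose D := shift_testfun h f - shift_testfun h0 f.
have partD s x : partials s D x = partials s f (x + h) - partials s f (x + h0).
  have E1 : (D : Rn -> R[i]^o) = (-1) *: (shift_testfun h0 f : Rn -> R[i]^o) + shift_testfun h f.
    by rewrite scaleN1r addrC.
  rewrite E1 partialsD; [|exact: (testfunP (shift_testfun h0 f)).1|exact: (testfunP (shift_testfun h f)).1].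
  by rewrite !partials_shiftf scaleN1r addrC.
have -> : iota (mul_testfun (shift_testfun h f) g sg) - iota (mul_testfun (shift_testfun h0 f) g sg)
    = iota (mul_testfun D g sg).
  rewrite -linearB; congr (iota _); apply: val_inj; apply/funext => x.
  by rewrite -[RHS]/((f (x + h) - f (x + h0)) * g x) mulrBl.
have far x : r' < `|x| -> mul_testfun D g sg x = 0.
  move=> xr; have fz k : `|k| <= `|h0| + 1 -> f (x + k) = 0.
    move=> kh; apply: fr; have : `|x| - `|k| <= `|x + k| by have := lerB_normD x k.
    by apply: lt_le_trans; rewrite ltrBrDr (le_lt_trans _ xr)// lerD2l.
  rewrite -[LHS]/(D x * g x) -[D x]/(f (x + h) - f (x + h0)) !fz ?lerDl//.
  by rewrite subr0 mul0r.
have M0 : 0 <= 2 ^+ m * (A * B).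
  by apply: mulr_ge0; [exact: exprn_ge0|apply: mulr_ge0; exact: ltW].
have : rnorm (iota (mul_testfun D g sg)) <= C * (2 ^+ m * (A * B)).
  apply: HC => //.
  move=> s sm x; have [xr|xr] := leP `|x| r'; last first.
    by rewrite (partials_far r')// rnorm0.
  apply: (@le_trans _ _ (2 ^+ size s * (A * B))).
    apply: leibniz_le; [exact: (testfunP D).1|exact: sg|exact: ltW| |].
      by move=> s' s's; rewrite partD hA// (leq_trans s's).
    by move=> s' s's; apply: HB => //; rewrite (leq_trans s's).
  apply: ler_wpM2r; first by apply: mulr_ge0; exact: ltW.
  by rewrite ler_weXn2l// ler1n.
move=> /le_trans; apply.
rewrite (_ : C * _ = A * (C * (2 ^+ m * B))); last by ring.
rewrite /A mulrAC ler_pdivrMr// ler_wpM2l ?(ltW e0)//.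
by rewrite lerDr.
Qed.

Lemma smooth1 : smooth (cst 1 : Rn -> R[i]^o).
Proof.
have Re1 : ReF (cst 1 : Rn -> R[i]^o) = cst 1 by [].
have Im1 : ImF (cst 1 : Rn -> R[i]^o) = cst 0 by [].
have C11 : C1 (cst 1 : Rn -> R[i]^o).
  rewrite /C1 Re1 Im1; split; [exact: cst_continuous|exact: cst_continuous|].
  by move=> i x; split; apply: derivable_cst.
(* The last direction of the list is differentiated first, and it already annihilates the
   constant. *)
case/lastP => [//|s i]; rewrite /partials foldr_rcons.
have -> : partial i (cst 1 : Rn -> R[i]^o) = 0.
  by apply/funext => x; rewrite /partial Re1 Im1 !derive_cst.
exact: ((is_testfun0 R n).1 s).
Qed.

Lemma transl_iota_cont (f : testfun R n) (h0 : Rn) (e : R) : 0 < e ->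
  \forall h \near h0, rnorm (T h (iota f) - T h0 (iota f)) <= e.
Proof.
move=> e0; have H := iota_mul_cont f _ smooth1 h0 e e0; apply: filterS H => h.
have m1 (k : testfun R n) : mul_testfun k _ smooth1 = k.
  by apply: val_inj; apply/funext => x; exact: mulr1.
by rewrite !m1 !(transl_iota iota j tibE).
Qed.

Lemma iota_dense (g : E) (e : R) : 0 < e -> exists f, rnorm (g - iota f) < e.
Proof.
move=> e0; have [_ _ di] := tib_testfun tibE.
have oB : open (ball g (e%:C)).
  by apply: ball_open; rewrite ltcR.
have B0 : ball g e%:C !=set0 by exists g; apply: ballxx; rewrite ltcR.
have [x [/= + [f _ fx]]] := di _ B0 oB.
by rewrite -fx -ball_normE /= rnormE ltcR; exists f.
Qed.

Lemma transl_cont (g : E) (h0 : Rn) (e : R) : 0 < e ->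
  \forall h \near h0, rnorm (T h g - T h0 g) <= e.
Proof.
move=> e0; have [m [C C0 HC]] := transl_bound iota j tibE.
(* [W] bounds (1 + |k|)^m for all |k| <= |h0| + 1, so the error of approximating [g] in D is
   controlled uniformly for h near [h0]. *)
pose W := (2 + `|h0|) ^+ m; have W0 : 0 <= W by rewrite exprn_ge0// addr_ge0.
have K0 : 0 < 4 * (C * W + 1) by rewrite mulr_gt0// ltr_wpDl// mulr_ge0.
have [f fP] := iota_dense g _ (divr_gt0 e0 K0).
have e20 : 0 < e / 2 by rewrite divr_gt0.
apply: filterS2 (transl_iota_cont f h0 _ e20) (near_norm_le h0) => h h1 h2.
have Hk k : `|k| <= `|h0| + 1 -> rnorm (T k (g - iota f)) <= e / 4.
  move=> kh; rewrite (le_trans (HC _ _))//.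
  apply: (@le_trans _ _ (C * rnorm (g - iota f) * W)).
    rewrite ler_wpM2l ?mulr_ge0 ?rnorm_ge0// lerXn2r ?nnegrE ?addr_ge0//.
    by rewrite (_ : 2 + `|h0| = 1 + (`|h0| + 1)) ?lerD2l//; ring.
  rewrite mulrAC; apply: (@le_trans _ _ ((C * W + 1) * rnorm (g - iota f))).
    by rewrite ler_wpM2r ?rnorm_ge0// lerDl.
  rewrite mulrC -ler_pdivlMr; last by rewrite ltr_wpDl// mulr_ge0.
  rewrite (le_trans (ltW fP))// (_ : 4 * _ = (C * W + 1) * 4); last by rewrite mulrC.
  by rewrite invfM mulrA mulrAC.
rewrite (_ : _ - _ = T h (g - iota f) + (T h (iota f) - T h0 (iota f)) - T h0 (g - iota f)).
  rewrite (le_trans (rnormD _ _ _))// rnormN.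
  rewrite (le_trans (lerD (rnormD _ _ _) (lexx _)))//.
  have := Hk h h2; have := Hk h0 (_ : `|h0| <= `|h0| + 1); rewrite lerDl => /(_ ler01).
  by lra.
rewrite !(translB iota j tibE) opprB !addrA subrK.
by rewrite -!addrA; congr (_ + _); rewrite addrA addNr add0r.
Qed.

End strong_continuity.

(** * The action of the Beurling algebra *)

Section convolution_pairing.
Context {R : realType} {n : nat}.
Local Notation Rn := 'rV[R]_n.
Local Notation mu := (lebesgue_rV R n).
Implicit Types (u v G : Rn -> R[i]).

Lemma measurable_subl : measurable_fun setT (fun p : Rn * Rn => (p.1 - p.2, p.2)).
Proof.
apply: measurable_fun_pair; last exact: measurable_snd.
apply: measurable_fun_coordP => i; under eq_fun do rewrite !mxE.
apply: measurable_funB.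
  exact: measurableT_comp (measurable_coord i) measurable_fst.
exact: measurableT_comp (measurable_coord i) measurable_snd.
Qed.

Lemma measurable_add2 : measurable_fun setT (fun p : Rn * Rn => p.1 + p.2).
Proof.
apply: measurable_fun_coordP => i; under eq_fun do rewrite !mxE.
apply: measurable_funD.
  exact: measurableT_comp (measurable_coord i) measurable_fst.
exact: measurableT_comp (measurable_coord i) measurable_snd.
Qed.

Lemma prod_bound (H : Rn * Rn -> R[i]) (K : R) (a b : Rn -> R) :
  cmeas H -> 0 <= K -> (forall x, 0 <= a x) -> (forall x, 0 <= b x) ->
  measurable_fun setT a -> measurable_fun setT b ->
  (\int[mu]_x (a x)%:E < +oo)%E -> (\int[mu]_x (b x)%:E < +oo)%E ->
  (forall x y, rnorm (H (x, y)) <= K * (a x * b y)) ->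
  (\int[mu]_x \int[mu]_y (rnorm (H (x, y)))%:E < +oo)%E.
Proof.
move=> mH K0 a0 b0 ma mb ia ib HK.
have b0' : (0 <= \int[mu]_y (b y)%:E)%E by apply: integral_ge0 => y _; rewrite lee_fin.
have a0' : (0 <= \int[mu]_y (a y)%:E)%E by apply: integral_ge0 => y _; rewrite lee_fin.
have bf : (\int[mu]_y (b y)%:E)%E \is a fin_num by rewrite ge0_fin_numE.
have af : (\int[mu]_y (a y)%:E)%E \is a fin_num by rewrite ge0_fin_numE.
apply: (@le_lt_trans _ _ (\int[mu]_x ((K * fine (\int[mu]_y (b y)%:E)%E)%:E * (a x)%:E))%E).
  apply: ge0_le_integral => //.
  - by move=> x _; apply: integral_ge0 => y _; rewrite lee_fin rnorm_ge0.
  - exact: measurable_int_rnorm.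
  - by apply: measurable_funeM; exact/measurable_EFinP.
  - move=> x _; apply: (@le_trans _ _ (\int[mu]_y ((K * a x)%:E * (b y)%:E))%E).
      apply: ge0_le_integral => //.
      + by move=> y _; rewrite lee_fin rnorm_ge0.
      + apply/measurable_EFinP; apply: measurable_rnorm; exact: cmeas_pair1.
      + by apply: measurable_funeM; exact/measurable_EFinP.
      + by move=> y _; rewrite -EFinM lee_fin -mulrA HK.
    rewrite ge0_integralZl//=.
    + by rewrite -(fineK bf) -!EFinM lee_fin mulrAC.
    + exact/measurable_EFinP.
    + by move=> y _; rewrite lee_fin.
    + by rewrite lee_fin mulr_ge0.
rewrite ge0_integralZl//=.
- by rewrite -(fineK af) -EFinM ltry.
- exact/measurable_EFinP.
- by move=> y _; rewrite lee_fin.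
- by rewrite lee_fin mulr_ge0// fine_ge0.
Qed.

(** The shear (x, y) -> (x - y, y) preserves the product measure: for fixed y it is a translation in
    x, so exchanging the integrals reduces it to invariance. *)
Lemma tonelli_shift (r : Rn * Rn -> R) : measurable_fun setT r -> (forall p, 0 <= r p) ->
  (\int[mu]_x \int[mu]_y (r ((x - y)%R, y))%:E = \int[mu]_x \int[mu]_y (r (x, y))%:E)%E.
Proof.
move=> mr r0.
have mrs : measurable_fun setT (fun p : Rn * Rn => r (p.1 - p.2, p.2)).
  exact: measurableT_comp mr measurable_subl.
have mE1 : measurable_fun setT (fun p : Rn * Rn => (r (p.1 - p.2, p.2))%:E) by exact/measurable_EFinP.
have mE2 : measurable_fun setT (fun p : Rn * Rn => (r p)%:E) by exact/measurable_EFinP.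
have ge1 (p : Rn * Rn) : (0 <= (r (p.1 - p.2, p.2))%:E)%E by rewrite lee_fin.
have ge2 (p : Rn * Rn) : (0 <= (r p)%:E)%E by rewrite lee_fin.
transitivity (\int[mu]_y \int[mu]_x (r ((x - y)%R, y))%:E)%E.
  exact: (@fubini_tonelli _ _ _ _ _ mu mu _ mE1 ge1).
transitivity (\int[mu]_y \int[mu]_x (r (x, y))%:E)%E; last first.
  exact/esym/(@fubini_tonelli _ _ _ _ _ mu mu _ mE2 ge2).
apply: eq_integral => y _ /=.
rewrite (@ge0_integral_shift _ _ (- y) (fun x => (r (x, y))%:E))//.
apply/measurable_EFinP; apply: (measurableT_comp mr).
exact: measurable_fun_pair.
Qed.

Lemma cfubini_shift (H : Rn * Rn -> R[i]) : cmeas H ->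
  (\int[mu]_x \int[mu]_y (rnorm (H (x, y)))%:E < +oo)%E ->
  cint mu (fun x => cint mu (fun y => H (x - y, y))) =
  cint mu (fun x => cint mu (fun y => H (x, y))).
Proof.
move=> mH iH.
have mHs : cmeas (fun p : Rn * Rn => H (p.1 - p.2, p.2)).
  by apply: (@cmeas_comp _ _ _ _ _ H) => //; exact: measurable_subl.
have iHs : (\int[mu]_x \int[mu]_y (rnorm (H ((x - y)%R, y)))%:E < +oo)%E.
  rewrite (tonelli_shift (fun p : Rn * Rn => rnorm (H p)))//; last by move=> p; exact: rnorm_ge0.
  exact: measurable_rnorm.
transitivity (cint mu (fun y => cint mu (fun x => H (x - y, y)))).
  exact: (cfubini mu mu _ mHs iHs).
transitivity (cint mu (fun y => cint mu (fun x => H (x, y)))); last first.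
  exact/esym/(cfubini mu mu _ mH iH).
apply: eq_cint => y.
apply: (@cint_shift _ _ (- y) (fun x => H (x, y))).
by apply: (@cmeas_comp _ _ _ _ _ H (fun x => (x, y))).
Qed.

Lemma cmeas_conv_kernel u v : cmeas u -> cmeas v ->
  cmeas (fun p : Rn * Rn => u (p.1 - p.2) * v p.2).
Proof.
move=> mu_ mv; apply: cmeasM.
  apply: (@cmeas_comp _ _ _ _ _ u (fun p : Rn * Rn => p.1 - p.2)) => //.
  exact: measurableT_comp measurable_fst measurable_subl.
by apply: cmeas_comp => //; exact: measurable_snd.
Qed.

(** Moving [G x] under the inner integral is legitimate only where that integral converges, hence
    for almost every x; the shear then replaces x by x + y. It is applied with [G] an orbit of
    translations for associativity, and with [G] a test function for Schwartz functions. *)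
Lemma conv_pairing u v G : cmeas u -> cmeas v -> cmeas G ->
  (\int[mu]_x \int[mu]_y (rnorm (u x * (v y * G (x + y)%R)))%:E < +oo)%E ->
  cint mu (fun x => convolution u v x * G x) =
  cint mu (fun x => cint mu (fun y => u x * (v y * G (x + y)))).
Proof.
move=> mu_ mv mG iH.
pose H (p : Rn * Rn) := u p.1 * (v p.2 * G (p.1 + p.2)).
have mH : cmeas H.
  apply: cmeasM; first by apply: cmeas_comp => //; exact: measurable_fst.
  apply: cmeasM; first by apply: cmeas_comp => //; exact: measurable_snd.
  by apply: cmeas_comp => //; exact: measurable_add2.
have mHs : cmeas (fun p : Rn * Rn => H (p.1 - p.2, p.2)).
  by apply: (@cmeas_comp _ _ _ _ _ H) => //; exact: measurable_subl.
rewrite -(cfubini_shift H)//.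
have mk := cmeas_conv_kernel u v mu_ mv.
apply: ae_eq_cint.
- exact: (cmeasM _ _ (cmeas_cint mu _ mk) mG).
- exact: (cmeas_cint mu _ mHs).
have /(ae_cintegrable mu mu _ mHs) : (\int[mu]_x \int[mu]_y (rnorm (H ((x - y)%R, y)))%:E < +oo)%E.
  rewrite (tonelli_shift (fun p : Rn * Rn => rnorm (H p)))//; last by move=> p; exact: rnorm_ge0.
  exact: measurable_rnorm.
apply: filterS => x /= ix.
have HE y : H (x - y, y) = G x * (u (x - y) * v y).
  by rewrite /H/= subrK mulrA mulrC.
under [RHS]eq_cint do rewrite HE.
rewrite cintZ_integrable; first by rewrite mulrC.
by move: ix; congr cintegrable; apply/funext => y; exact: HE.
Qed.

End convolution_pairing.

Section action.
Context {R : realType} {n : nat} {E : completeNormedModType R[i]}.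
Variables (iota : {linear testfun R n -> E}) (j : {linear E -> distrib R n}).
Hypothesis tibE : translation_invariant_Banach_space iota j.
Local Notation Rn := 'rV[R]_n.
Local Notation T := (transl j).
Local Notation mu := (lebesgue_rV R n).

Lemma growth_ge (g : E) (h : Rn) : rnorm g <= 1 -> ((rnorm (T (- h) g))%:E <= growth j h)%E.
Proof. by move=> g1; apply: ereal_sup_ubound; exists g. Qed.

Lemma growth_ge0 (h : Rn) : (0 <= growth j h)%E.
Proof.
apply: le_trans (growth_ge 0 h _); last by rewrite rnorm0.
by rewrite lee_fin rnorm_ge0.
Qed.

Lemma growth_poly : exists m, exists2 C : R, 0 <= C &
  forall h, (growth j h <= (C * (1 + `|h|) ^+ m)%:E)%E.
Proof.
have [m [C C0 HC]] := transl_bound iota j tibE; exists m, C => // h.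
apply: ge_ereal_sup => _ [g /= g1 <-]; rewrite lee_fin (le_trans (HC _ _))// normrN.
by rewrite ler_wpM2r ?exprn_ge0 ?addr_ge0// ler_piMr.
Qed.

Lemma growth_fin h : growth j h \is a fin_num.
Proof.
have [m [C C0 HC]] := growth_poly; rewrite ge0_fin_numE ?growth_ge0//.
by rewrite (le_lt_trans (HC h))// ltry.
Qed.

Definition rgrowth (h : Rn) : R := fine (growth j h).

Lemma growthE h : growth j h = (rgrowth h)%:E.
Proof. by rewrite /rgrowth fineK// growth_fin. Qed.

Lemma rgrowth_ge0 h : 0 <= rgrowth h.
Proof. by rewrite fine_ge0// growth_ge0. Qed.

Lemma rgrowth_poly : exists m, exists2 C : R, 0 <= C & forall h, rgrowth h <= C * (1 + `|h|) ^+ m.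
Proof.
have [m [C C0 HC]] := growth_poly; exists m, C => // h.
by rewrite -lee_fin -growthE.
Qed.

Lemma transl_rgrowth g h : rnorm (T (- h) g) <= rgrowth h * rnorm g.
Proof.
have [->|g0] := eqVneq g 0.
  by rewrite (transl_at0 iota j tibE) rnorm0 mulr0.
have rg : 0 < rnorm g.
  by rewrite lt_neqAle rnorm_ge0 andbT eq_sym; apply: contra_neq g0; exact: rnorm0_eq0.
have : rnorm ((rnorm g)^-1%:C *: g) <= 1.
  by rewrite rnormZ rnorm_real gtr0_norm ?invr_gt0// mulVf// gt_eqF.
move=> /(growth_ge _ h); rewrite growthE lee_fin (translZ iota j tibE).
by rewrite rnormZ rnorm_real gtr0_norm ?invr_gt0// ler_pdivrMl// mulrC.
Qed.

Lemma rgrowthD x y : rgrowth (x + y) <= rgrowth x * rgrowth y.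
Proof.
rewrite -lee_fin -growthE; apply: ge_ereal_sup => _ [g /= g1 <-]; rewrite lee_fin.
rewrite opprD -(translD iota j tibE) (le_trans (transl_rgrowth _ _))//.
rewrite ler_wpM2l ?rgrowth_ge0// (le_trans (transl_rgrowth _ _))//.
by rewrite ler_piMr// rgrowth_ge0.
Qed.

Lemma transl_contN (g : E) (h0 : Rn) (e : R) : 0 < e ->
  \forall h \near h0, rnorm (T (- h) g - T (- h0) g) <= e.
Proof.
move=> e0; have /nbhs_ballP[d /= d0 H] := transl_cont iota j tibE g (- h0) e e0.
apply/nbhs_ballP; exists d => //= h; rewrite -ball_normE /= => hd; apply: H.
by rewrite -ball_normE/= opprK addrC distrC.
Qed.

(** A supremum of continuous functions is lower semicontinuous: one vector [g] showing that the
    growth exceeds [a] at [h0] also shows it nearby, by strong continuity. *)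
Lemma measurable_rgrowth : measurable_fun setT rgrowth.
Proof.
suff : measurable_fun setT (growth j).
  by move=> mg; apply: (@measurableT_comp _ _ _ _ _ _ (@fine R)).
apply: open_gt_measurable => a; rewrite openE => h0 /= ah0.
have [g [g1 ag]] : exists g, rnorm g <= 1 /\ a < rnorm (T (- h0) g).
  apply: contrapT => H; move: ah0; apply/negP; rewrite -leNgt.
  apply: ge_ereal_sup => _ [g /= g1 <-]; rewrite lee_fin leNgt; apply/negP => ag.
  by apply: H; exists g.
have e0 : 0 < (rnorm (T (- h0) g) - a) / 2 by rewrite divr_gt0// subr_gt0.
have H := transl_contN g h0 _ e0; apply: filterS H => h hh.
apply: (lt_le_trans _ (growth_ge g h g1)); rewrite lte_fin.
have := rnormD _ (T (- h0) g - T (- h) g) (T (- h) g); rewrite subrK rnormBC.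
by move: hh e0; lra.
Qed.

Definition acts (u : Rn -> R[i]^o) (g e : E) :=
  forall f : testfun R n, j e f = cint mu (fun y => u y * j (T (- y) g) f).

(** The default 0 is taken when no such vector exists; [acts_exists] rules this out on the Beurling
    algebra. *)
Definition act u g := xget 0 [set e | acts u g e].

Lemma act_eq u g e : acts u g e -> act u g = e.
Proof.
move=> ae; have /= ae' := @xgetPex _ 0 [set e | acts u g e] (ex_intro _ e ae).
by apply: (j_ext iota j tibE) => f; rewrite ae' ae.
Qed.

Lemma beurling_normE u : beurling_norm j u = (\int[mu]_x (rnorm (u x) * rgrowth x)%:E)%E.
Proof. by apply: eq_integral => x _; rewrite growthE. Qed.

Lemma beurling_cmeas u : beurling j u -> cmeas (u : Rn -> R[i]).
Proof. by case. Qed.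

Lemma cmeas_jev (F : Rn -> E) (f : testfun R n) :
  (forall h0 e, 0 < e -> \forall h \near h0, rnorm (F h - F h0) <= e) ->
  cmeas (fun h => j (F h) f : R[i]).
Proof.
move=> cF; have [_ cj _] := tib_distrib tibE.
have [C C0 HC] := jev_bound j f cj.
have cjF h0 (e : R) : 0 < e -> \forall h \near h0, rnorm (j (F h) f - j (F h0) f) <= e.
  move=> e0; have C1 : 0 < C + 1 by rewrite ltr_wpDl.
  have H := cF h0 _ (divr_gt0 e0 C1); apply: filterS H => h hh.
  rewrite -jB (le_trans (HC _))// (@le_trans _ _ ((C + 1) * rnorm (F h - F h0)))//.
    by rewrite ler_wpM2r ?rnorm_ge0// lerDl.
  by rewrite mulrC -ler_pdivlMr.
split; apply: continuous_measurable_rV => h0; apply/(@cvgrPdist_le _ _ _ (nbhs h0)) => e e0;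
  have H := cjF h0 e e0; apply: filterS H => h hh; rewrite distrC (le_trans _ hh)//.
  by rewrite -raddfB normRe_le.
by rewrite -raddfB normIm_le.
Qed.

Lemma cmeas_transl g f : cmeas (fun y : Rn => j (T (- y) g) f : R[i]).
Proof. by apply: cmeas_jev => h0 e; exact: transl_contN. Qed.

Lemma jtransl_bound g f : exists2 C : R, 0 <= C &
  forall y, rnorm (j (T (- y) g) f) <= C * rgrowth y.
Proof.
have [_ cj _] := tib_distrib tibE; have [C C0 HC] := jev_bound j f cj.
exists (C * rnorm g); first by rewrite mulr_ge0 ?rnorm_ge0.
move=> y; rewrite (le_trans (HC _))// -mulrA ler_wpM2l// mulrC.
exact: transl_rgrowth.
Qed.

Lemma measurable_beurling u : cmeas (u : Rn -> R[i]) ->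
  measurable_fun setT (fun x => rnorm (u x) * rgrowth x).
Proof.
by move=> mu_; apply: measurable_funM; [exact: measurable_rnorm|exact: measurable_rgrowth].
Qed.

Lemma cintegrable_acts u g f : beurling j u -> cintegrable mu (fun y => u y * j (T (- y) g) f).
Proof.
move=> [mu_]; rewrite beurling_normE => ui.
have [C C0 HC] := jtransl_bound g f.
apply: (@le_cintegrable _ _ _ _ _ (fun y => C%:E * (rnorm (u y) * rgrowth y)%:E)%E).
- exact: cmeasM _ _ mu_ (cmeas_transl g f).
- by apply: measurable_funeM; apply/measurable_EFinP; exact: measurable_beurling.
- move=> y; rewrite rnormM -EFinM lee_fin mulrCA ler_wpM2l ?rnorm_ge0//.
- rewrite ge0_integralZl//=.
  + by rewrite lte_mul_pinfty.
  + by apply/measurable_EFinP; exact: measurable_beurling.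
  + by move=> y _; rewrite lee_fin mulr_ge0 ?rnorm_ge0 ?rgrowth_ge0.
Qed.

Lemma scale_cont (a : Rn -> R) (F : Rn -> E) : continuous a ->
  (forall h0 e, 0 < e -> \forall h \near h0, rnorm (F h - F h0) <= e) ->
  forall h0 e, 0 < e -> \forall h \near h0, rnorm ((a h)%:C *: F h - (a h0)%:C *: F h0) <= e.
Proof.
move=> ca cF h0 e e0.
have half K : 0 < K -> K * (e / (2 * K)) = e / 2 by move=> K0; field; rewrite gt_eqF.
have F1 : 0 < 2 * (rnorm (F h0) + 1) by rewrite mulr_gt0// ltr_wpDl// rnorm_ge0.
have A1 : 0 < 2 * (`|a h0| + 1) by rewrite mulr_gt0// ltr_wpDl.
have H1 : \forall h \near h0, `|a h0 - a h| <= Num.min 1 (e / (2 * (rnorm (F h0) + 1))).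
  have /(@cvgrPdist_le _ _ _ (nbhs h0)) := ca h0; apply.
  by rewrite lt_min ltr01 divr_gt0.
have H2 := cF h0 _ (divr_gt0 e0 A1).
apply: filterS2 H1 H2 => h; rewrite le_min => /andP[h1 h2] h3.
rewrite (_ : _ - _ = (a h)%:C *: (F h - F h0) - (a h0 - a h)%:C *: F h0); last first.
  by rewrite scalerBr rmorphB/= scalerBl opprB addrA subrK.
rewrite (le_trans (rnormD _ _ _))// rnormN !rnormZ !rnorm_real (splitr e) lerD//.
  have ah : `|a h| <= `|a h0| + 1.
    by rewrite -lerBlDl (le_trans _ h1)// distrC lerB_dist.
  apply: (@le_trans _ _ ((`|a h0| + 1) * (e / (2 * (`|a h0| + 1))))).
    by rewrite ler_pM ?rnorm_ge0.
  by rewrite half// ltr_wpDl.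
apply: (@le_trans _ _ (e / (2 * (rnorm (F h0) + 1)) * (rnorm (F h0) + 1))).
  by rewrite ler_pM ?rnorm_ge0// lerDl.
by rewrite mulrC half// ltr_wpDl// rnorm_ge0.
Qed.

(* The integrand u(y) T_{-y} g is rewritten as u'(y) F'(y), where u' = u wgt is
   integrable because growth is bounded below by a multiple of wgt. *)
Lemma acts_exists u g : beurling j u -> exists e, acts u g e /\
  ((rnorm e)%:E <= beurling_norm j u * (rnorm g)%:E)%E.
Proof.
move=> bu; have [mu_ ui] := bu; rewrite beurling_normE in ui *.
(* The lower bound on the growth is found by comparing [g] with its translates and dividing by its
   norm, so the zero vector is set apart. *)
have [->|g0] := eqVneq g 0.
  exists 0; split; last by rewrite rnorm0 mule0.
  move=> f; rewrite -/(jev j f 0) linear0 -(cint0 mu); apply: eq_cint => y.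
  by rewrite (transl_at0 iota j tibE) -/(jev j f 0) linear0 mulr0.
have rg : 0 < rnorm g.
  by rewrite lt_neqAle rnorm_ge0 andbT eq_sym; apply: contra_neq g0; exact: rnorm0_eq0.
have [m [C C0 HC]] := transl_bound iota j tibE.
pose u' (y : Rn) : R[i] := u y * (wgt n m y)%:C.
pose F' (y : Rn) := ((1 + `|y|) ^+ m)%:C *: T (- y) g.
have wgtm y : wgt n m y * (1 + `|y|) ^+ m = 1.
  by rewrite /wgt mulVf// gt_eqF// onePnormX_gt0.
have mu' : cmeas u'.
  by apply: cmeasM => //; apply: cmeas_real; exact: measurable_wgt.
(* Translating [g] by -y and back gives |g| <= C (growth at y) |g| (1 + |y|)^m; division by |g|
   leaves the claim. *)
have low y : wgt n m y <= C * rgrowth y.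
  rewrite /wgt -[leLHS]mul1r ler_pdivrMr ?onePnormX_gt0//.
  have : rnorm g <= C * (rgrowth y * rnorm g) * (1 + `|y|) ^+ m.
    rewrite -{1}(transl0 iota j tibE g) -(addrN y) -(translD iota j tibE).
    rewrite (le_trans (HC _ _))// ler_wpM2r ?exprn_ge0 ?addr_ge0// ler_wpM2l//.
    exact: transl_rgrowth.
  by rewrite mulrA -mulrA (mulrC (rnorm g)) mulrA -[leLHS]mul1r ler_pM2r.
have iu' : cintegrable mu u'.
  apply: (@le_cintegrable _ _ _ _ _ (fun y => C%:E * (rnorm (u y) * rgrowth y)%:E)%E) => //.
  - by apply: measurable_funeM; apply/measurable_EFinP; exact: measurable_beurling.
  - move=> y; rewrite rnormM rnorm_real ger0_norm ?wgt_ge0// -EFinM lee_fin mulrCA.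
    by rewrite ler_wpM2l ?rnorm_ge0.
  - rewrite ge0_integralZl//=.
    + by rewrite lte_mul_pinfty.
    + by apply/measurable_EFinP; exact: measurable_beurling.
    + by move=> y _; rewrite lee_fin mulr_ge0 ?rnorm_ge0 ?rgrowth_ge0.
have cF' : forall h0 e, 0 < e -> \forall h \near h0, rnorm (F' h - F' h0) <= e.
  apply: (scale_cont (fun y => (1 + `|y|) ^+ m) (fun y => T (- y) g)).
    exact: continuous_onePnormX.
  by move=> h0 e; exact: transl_contN.
have u'F' y : rnorm (u' y) * rnorm (F' y) = rnorm (u y) * rnorm (T (- y) g).
  rewrite rnormM rnormZ !rnorm_real ger0_norm ?wgt_ge0// ger0_norm ?exprn_ge0 ?addr_ge0//.
  by rewrite -mulrA (mulrA (wgt n m y)) wgtm mul1r.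
have le_int : (\int[mu]_y (rnorm (u' y) * rnorm (F' y))%:E <=
    \int[mu]_y (rnorm (u y) * rgrowth y)%:E * (rnorm g)%:E)%E.
  rewrite -ge0_integralZr//=; last 3 first.
  - by apply/measurable_EFinP; exact: measurable_beurling.
  - by move=> y _; rewrite lee_fin mulr_ge0 ?rnorm_ge0 ?rgrowth_ge0.
  - by rewrite lee_fin rnorm_ge0.
  apply: ge0_le_integral => //.
  - by move=> y _; rewrite lee_fin mulr_ge0 ?rnorm_ge0.
  - apply/measurable_EFinP; apply: measurable_funM; first exact: measurable_rnorm.
    have [mF _] := cont_strongly_measurable _ cF'.
    by have := mF 0; under eq_fun do rewrite subr0.
  - apply: emeasurable_funM; last exact: measurable_cst.
    by apply/measurable_EFinP; exact: measurable_beurling.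
  - move=> y _; rewrite u'F' -EFinM lee_fin -mulrA ler_wpM2l ?rnorm_ge0//.
    exact: transl_rgrowth.
have fin' : (\int[mu]_y (rnorm (u' y) * rnorm (F' y))%:E < +oo)%E.
  by rewrite (le_lt_trans le_int)// muleC lte_mul_pinfty// lee_fin rnorm_ge0.
have [e [en eP]] := bochner mu u' iu' F' (cont_strongly_measurable _ cF') fin'.
exists e; split; last exact: le_trans le_int.
move=> f; have [_ cj _] := tib_distrib tibE; have [D D0 HD] := jev_bound j f cj.
rewrite -[LHS]/(jev j f e) (eP (jev j f) D HD (cmeas_jev F' f cF')).
apply: eq_cint => y; rewrite /F' linearZ/= -[_ *: _]/(_ * _) /u' -mulrA; congr (_ * _).
by rewrite mulrA -rmorphM/= wgtm mul1r.
Qed.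

End action.

(** * The module laws *)

Section module.
Context {R : realType} {n : nat} {E : completeNormedModType R[i]}.
Variables (iota : {linear testfun R n -> E}) (j : {linear E -> distrib R n}).
Hypothesis tibE : translation_invariant_Banach_space iota j.
Local Notation Rn := 'rV[R]_n.
Local Notation T := (transl j).
Local Notation mu := (lebesgue_rV R n).
Local Notation act := (act j).
Implicit Types (u v f : Rn -> R[i]^o) (g : E).

Lemma acts_act u g : beurling j u -> acts j u g (act u g).
Proof.
move=> bu; have [e [eP _]] := acts_exists iota j tibE u g bu.
by rewrite (act_eq iota j tibE _ _ _ eP).
Qed.

Lemma act_norm_le u g : beurling j u ->
  ((rnorm (act u g))%:E <= beurling_norm j u * (rnorm g)%:E)%E.
Proof.
move=> bu; have [e [eP en]] := acts_exists iota j tibE u g bu.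
by rewrite (act_eq iota j tibE _ _ _ eP).
Qed.

Lemma act_ae_eq u v g : beurling j u -> beurling j v ->
  {ae mu, forall x, u x = v x} -> act u g = act v g.
Proof.
move=> bu bv uv; apply: (act_eq iota j tibE) => k; rewrite (acts_act v g bv k).
apply/esym/ae_eq_cint.
- by have [] := cintegrable_acts iota j tibE u g k bu.
- by have [] := cintegrable_acts iota j tibE v g k bv.
by apply: filterS uv => x /= ->.
Qed.

Lemma act_linl (a : R[i]) u v g : beurling j u -> beurling j v ->
  act (a *: u + v) g = a *: act u g + act v g.
Proof.
move=> bu bv; apply: (act_eq iota j tibE) => k.
have iu := cintegrable_acts iota j tibE u g k bu.
have iv := cintegrable_acts iota j tibE v g k bv.
rewrite jD (acts_act u g bu k) (acts_act v g bv k) -cintZ// -cintD//; last exact: cintegrableZ.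
apply: eq_cint => y.
by rewrite -[(a *: u + v) y]/(a * u y + v y) mulrDl mulrA.
Qed.

Lemma act_linr u : beurling j u -> linear (act u).
Proof.
move=> bu a g h; apply: (act_eq iota j tibE) => k.
have ig := cintegrable_acts iota j tibE u g k bu.
have ih := cintegrable_acts iota j tibE u h k bu.
rewrite jD (acts_act u g bu k) (acts_act u h bu k) -cintZ// -cintD//; last exact: cintegrableZ.
apply: eq_cint => y.
by rewrite (transl_linear iota j tibE) jD mulrDr mulrCA.
Qed.

Let nw u (x : Rn) := rnorm (u x) * rgrowth j x.

Let nw_ge0 u x : 0 <= nw u x.
Proof. by rewrite mulr_ge0 ?rnorm_ge0// rgrowth_ge0. Qed.

Let mnw u : cmeas (u : Rn -> R[i]) -> measurable_fun setT (nw u).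
Proof. exact: measurable_beurling iota j tibE u. Qed.

Let inw u : beurling j u -> (\int[mu]_x (nw u x)%:E < +oo)%E.
Proof. by move=> [_]; rewrite (beurling_normE iota j tibE). Qed.

(** Submultiplicativity gives growth(x) <= growth(x - y) growth(y), so the weighted convolution is
    dominated by the convolution of the weighted moduli, which Tonelli and the shear bound. *)
Lemma beurling_conv u v : beurling j u -> beurling j v -> beurling j (convolution u v).
Proof.
move=> bu bv; have mu_ := beurling_cmeas j u bu; have mv := beurling_cmeas j v bv.
have mk := cmeas_conv_kernel u v mu_ mv.
have mc := cmeas_cint mu _ mk.
split; first exact: mc.
rewrite (beurling_normE iota j tibE).
pose r (p : Rn * Rn) := nw u p.1 * nw v p.2.
have mr : measurable_fun setT r.
  apply: measurable_funM.
    exact: measurableT_comp (mnw u mu_) measurable_fst.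
  exact: measurableT_comp (mnw v mv) measurable_snd.
have r0 p : 0 <= r p by rewrite mulr_ge0.
have mrs : measurable_fun setT (fun p : Rn * Rn => r (p.1 - p.2, p.2)).
  exact: measurableT_comp mr measurable_subl.
have ir : (\int[mu]_x \int[mu]_y (r ((x - y)%R, y))%:E < +oo)%E.
  rewrite tonelli_shift//.
  have mC : cmeas (fun p => (r p)%:C) by exact: cmeas_real.
  have := prod_bound (fun p => (r p)%:C) 1 (nw u) (nw v) mC ler01 (nw_ge0 u) (nw_ge0 v)
    (mnw u mu_) (mnw v mv) (inw u bu) (inw v bv).
  under eq_integral do (under eq_integral do rewrite rnorm_real ger0_norm//).
  by apply => x y; rewrite rnorm_real ger0_norm// mul1r.
apply: le_lt_trans ir; apply: ge0_le_integral => //.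
- by move=> x _; rewrite lee_fin mulr_ge0 ?rnorm_ge0 ?rgrowth_ge0.
- by apply/measurable_EFinP; exact: measurable_beurling iota j tibE _ mc.
- by apply: (measurable_fun_fubini_tonelli_F (fun p : Rn * Rn => (r (p.1 - p.2, p.2))%:E));
    [exact/measurable_EFinP|move=> p; rewrite lee_fin].
move=> x _.
apply: (@le_trans _ _ (\int[mu]_y ((rnorm (u (x - y) * v y))%:E * (rgrowth j x)%:E))%E).
  rewrite ge0_integralZr//=.
  - by rewrite EFinM lee_wpmul2r ?lee_fin ?rgrowth_ge0//; exact: (rnorm_cint_pair mu _ mk x).
  - apply/measurable_EFinP; apply: measurable_rnorm; exact: (cmeas_pair1 _ x mk).
  - by move=> y _; rewrite lee_fin rnorm_ge0.
  - by rewrite lee_fin rgrowth_ge0.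
apply: ge0_le_integral => //.
- by move=> y _; rewrite -EFinM lee_fin mulr_ge0 ?rnorm_ge0 ?rgrowth_ge0.
- apply: emeasurable_funM; last exact: measurable_cst.
  apply/measurable_EFinP; apply: measurable_rnorm; exact: (cmeas_pair1 _ x mk).
- by apply/measurable_EFinP; exact: (measurableT_comp mrs (pair1_measurable x)).
move=> y _; rewrite -EFinM lee_fin rnormM /r /nw/= mulrACA ler_wpM2l ?mulr_ge0 ?rnorm_ge0//.
by rewrite (le_trans _ (rgrowthD iota j tibE _ _))// subrK.
Qed.

(** With [G] x = <T_{-x} g, k>, the group law reads <T_{-y} g, k(. + z)> = [G] (z + y). Both sides
    then become the same double integral, absolutely convergent since |[G]| is at most a multiple of
    the submultiplicative growth. *)
Lemma act_conv u v g : beurling j u -> beurling j v ->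
  act (convolution u v) g = act u (act v g).
Proof.
move=> bu bv; have mu_ := beurling_cmeas j u bu; have mv := beurling_cmeas j v bv.
apply: (act_eq iota j tibE) => k.
pose G x := j (T (- x) g) k.
have mG : cmeas (G : Rn -> R[i]) := cmeas_transl iota j tibE g k.
have [C C0 HC] := jtransl_bound iota j tibE g k.
have GD z y : j (T (- y) g) (shift_testfun z k) = G (z + y).
  rewrite /G opprD -(translD iota j tibE).
  by rewrite [RHS](translP iota j tibE) opprK.
rewrite (conv_pairing u v G)//; last first.
  have mH : cmeas (fun p : Rn * Rn => u p.1 * (v p.2 * G (p.1 + p.2))).
    apply: cmeasM; first by apply: (cmeas_comp _ _ mu_); exact: measurable_fst.
    apply: cmeasM; first by apply: (cmeas_comp _ _ mv); exact: measurable_snd.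
    by apply: (cmeas_comp _ _ mG); exact: measurable_add2.
  apply: (prod_bound _ C (nw u) (nw v) mH C0 (nw_ge0 u) (nw_ge0 v) (mnw u mu_) (mnw v mv)
    (inw u bu) (inw v bv)) => x y /=.
  rewrite !rnormM /nw (_ : C * _ =
    rnorm (u x) * (rnorm (v y) * (C * (rgrowth j x * rgrowth j y)))); last by ring.
  apply: ler_wpM2l; first exact: rnorm_ge0.
  apply: ler_wpM2l; first exact: rnorm_ge0.
  rewrite (le_trans (HC _))// ler_wpM2l//.
  exact: rgrowthD iota j tibE _ _.
rewrite (acts_act u _ bu k); apply: eq_cint => z.
rewrite (translP iota j tibE) opprK (acts_act v g bv (shift_testfun z k)).
rewrite -cintZ; last exact: cintegrable_acts iota j tibE v g _ bv.
by apply: eq_cint => y; rewrite GD.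
Qed.

End module.

(** * Schwartz functions *)

Section schwartz.
Context {R : realType} {n : nat}.
Local Notation Rn := 'rV[R]_n.
Local Notation mu := (lebesgue_rV R n).

Lemma wgtM k l (x : Rn) : wgt n (k + l) x = wgt n k x * wgt n l x.
Proof. by rewrite /wgt exprD invfM. Qed.

Lemma wgtN k (x : Rn) : wgt n k (- x) = wgt n k x.
Proof. by rewrite /wgt normrN. Qed.

(** Peetre's inequality: 1 + |h| <= (1 + |x + h|)(1 + |x|), by the triangle inequality. *)
Lemma wgt_peetre k (x h : Rn) : wgt n k (x + h) * wgt n k x <= wgt n k h.
Proof.
rewrite /wgt -invfM -exprMn lef_pV2 ?posrE; last 2 first.
- by rewrite exprn_gt0// mulr_gt0// onePnorm_gt0.
- exact: onePnormX_gt0.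
rewrite lerXn2r ?nnegrE ?mulr_ge0 ?addr_ge0//.
rewrite mulrDl !mul1r -addrA lerD2l mulrDr mulr1.
have : `|h| <= `|x + h| + `|x|.
  by rewrite -[X in `|X| <= _](addKr x) addrC (le_trans (ler_normD _ _))// normrN.
by move=> /le_trans; apply; rewrite addrA [`|x| + _]addrC lerDl mulr_ge0.
Qed.

Lemma wgtK k l (x : Rn) : wgt n (k + l) x * (1 + `|x|) ^+ l = wgt n k x.
Proof. by rewrite wgtM -mulrA /wgt mulVf ?mulr1// gt_eqF// onePnormX_gt0. Qed.

Lemma schwartz_decay (f : Rn -> R[i]^o) : schwartz f -> forall m k, exists2 C : R, 0 <= C &
  forall s, (size s <= m)%N -> forall x, rnorm (partials s f x) <= C * wgt n k x.
Proof.
move=> [_ Sf] m k.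
suff : \forall C \near +oo, forall s, (size s <= m)%N ->
    forall x, rnorm (partials s f x) <= C * wgt n k x.
  move=> H; have [C [C0 HC]] : exists C : R, 0 < C /\ forall s, (size s <= m)%N ->
      forall x, rnorm (partials s f x) <= C * wgt n k x.
    near (pinfty_nbhs R) => C; exists C; split; near: C => //.
    exact: nbhs_pinfty_gt.
  by exists C => //; exact: ltW.
apply: (near_partials _ (pinfty_nbhs R)
  (fun s C => forall x, rnorm (partials s f x) <= C * wgt n k x)) => s.
have [C HC] := Sf s k; near=> D => x.
rewrite /wgt ler_pdivlMr ?onePnormX_gt0// mulrC.
apply: (@le_trans _ _ C); last by near: D; apply: nbhs_pinfty_ge; exact: num_real.
apply: le_trans (HC x); apply: ler_wpM2r; first exact: rnorm_ge0.
rewrite lerXn2r ?nnegrE ?addr_ge0 ?sqrtr_ge0//.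
by rewrite lerD2l le_enorm.
Unshelve. all: by end_near. Qed.

Lemma schwartz_cmeas (f : Rn -> R[i]^o) : schwartz f -> cmeas (f : Rn -> R[i]).
Proof. by move=> [sf _]; exact: C1_cmeas _ (sf [::]). Qed.

Lemma testfun_cintegrable (f : testfun R n) : cintegrable mu (f : Rn -> R[i]).
Proof.
have [C C0 HC] := testfun_decay f [::] n.*2.
exact: decay_cintegrable _ C (testfun_cmeas f) HC.
Qed.

Lemma shiftf_smooth (h : Rn) (f : Rn -> R[i]^o) : smooth f -> smooth (shiftf h f).
Proof. by move=> sf s; rewrite partials_shiftf; exact: C1_shiftf. Qed.

End schwartz.

Section schwartz_embedding.
Context {R : realType} {n : nat} {E : completeNormedModType R[i]}.
Variables (iota : {linear testfun R n -> E}) (j : {linear E -> distrib R n}).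
Hypothesis tibE : translation_invariant_Banach_space iota j.
Local Notation Rn := 'rV[R]_n.
Local Notation T := (transl j).
Local Notation mu := (lebesgue_rV R n).

(** The piece at h is T_h of [chi] times f(. - h), whose support no longer moves, so [iota_bound]
    applies with constants independent of h. On that support Peetre's inequality turns the decay of
    [f] into decay in h. *)
Lemma iota_window_bound (f : Rn -> R[i]^o) (chi : testfun R n) (sf : smooth f) :
  schwartz f -> exists2 K : R, 0 <= K & forall h : Rn,
  rnorm (iota (mul_testfun (shift_testfun h chi) f sf)) <= K * wgt n n.*2 h.
Proof.
move=> Sf; have [_ ci _] := tib_testfun tibE.
have [m1 [C1 C10 HC1]] := transl_bound iota j tibE.
have [sc _] := testfunP chi; have [r r0 cr] := testfun_supp _ (testfunP chi).
have [m [C C0 HC]] := iota_bound iota r ci.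
have [A A0 HA] := locally_bounded_partials _ r m sc.
(* Of the decay requested, [m1] is spent on the growth of T_h and 2n remains for integrability in
   h. *)
pose k := (n.*2 + m1)%N.
have [B B0 HB] := schwartz_decay f Sf m k.
pose M := 2 ^+ m * (A * (B * (1 + r) ^+ k)).
have rk : 0 <= (1 + r) ^+ k by rewrite exprn_ge0// addr_ge0.
have M0 : 0 <= M.
  by apply: mulr_ge0; [exact: exprn_ge0|apply: mulr_ge0; [exact: ltW|exact: mulr_ge0]].
exists (C1 * (C * M)); first by apply: mulr_ge0 => //; exact: mulr_ge0.
move=> h; pose g := shiftf (- h) f; have sg : smooth g by exact: shiftf_smooth.
have -> : iota (mul_testfun (shift_testfun h chi) f sf) = T h (iota (mul_testfun chi g sg)).
  rewrite (transl_iota iota j tibE); congr (iota _); apply: val_inj; apply/funext => x.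
  by rewrite /= /shiftf /mulf /g /shiftf addrK.
rewrite (le_trans (HC1 _ _))//.
have gb s x : (size s <= m)%N -> `|x| <= r ->
    rnorm (partials s g x) <= B * ((1 + r) ^+ k * wgt n k h).
  move=> sm xr; rewrite partials_shiftf (le_trans (HB s sm _))// ler_wpM2l//.
  have := wgt_peetre k x (- h); rewrite wgtN => p.
  have : wgt n k (x - h) <= wgt n k h * (1 + `|x|) ^+ k.
    by rewrite -ler_pdivrMr ?onePnormX_gt0.
  move=> /le_trans; apply; rewrite mulrC ler_wpM2r ?wgt_ge0//.
  by rewrite lerXn2r ?nnegrE ?addr_ge0// lerD2l.
have wk : 0 <= (1 + r) ^+ k * wgt n k h by rewrite mulr_ge0// wgt_ge0.
have bound : rnorm (iota (mul_testfun chi g sg)) <= C * (M * wgt n k h).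
  apply: HC.
  - by rewrite mulr_ge0// wgt_ge0.
  - by move=> x xr; rewrite /= /mulf cr// mul0r.
  move=> s sm x; have [xr|xr] := leP `|x| r; last first.
    rewrite (partials_far r)// ?rnorm0; first by apply: mulr_ge0 => //; exact: wgt_ge0.
    by move=> y yr; rewrite /= /mulf cr// mul0r.
  rewrite /M -!mulrA; apply: (@le_trans _ _ (2 ^+ size s * (A * (B * ((1 + r) ^+ k * wgt n k h))))).
    apply: leibniz_le; [exact: sc|exact: sg|exact: ltW| |].
      by move=> s' s's; apply: HA => //; rewrite (leq_trans s's).
    by move=> s' s's; apply: gb => //; rewrite (leq_trans s's).
  apply: ler_wpM2r; last by rewrite ler_weXn2l// ler1n.
  by apply: mulr_ge0; [exact: ltW|exact: mulr_ge0].
rewrite -(wgtK n.*2 m1) -/k [leRHS]mulrA; apply: ler_wpM2r; first by rewrite exprn_ge0// addr_ge0.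
by rewrite -[leRHS]mulrA; apply: ler_wpM2l => //; rewrite -(mulrA C).
Qed.

(* f is the integral over h of the test functions chi(. + h) f, whose norms in E
   decay rapidly. *)
Lemma represented_of_window (f : Rn -> R[i]^o) (chi : testfun R n) : schwartz f ->
  cint mu (chi : Rn -> R[i]) = 1 -> exists g, represents j g f.
Proof.
move=> Sf chi1; have [sf _] := Sf.
pose G h := iota (mul_testfun (shift_testfun h chi) f sf).
have [K K0 HK] := iota_window_bound f chi sf Sf.
(* The decay of [G] is transferred to the scalar density [u], which leaves a bounded continuous [F]
   with [u * F = G]. *)
pose u (h : Rn) : R[i] := (wgt n n.*2 h)%:C.
pose F (h : Rn) := ((1 + `|h|) ^+ n.*2)%:C *: G h.
have wK h : wgt n n.*2 h * (1 + `|h|) ^+ n.*2 = 1.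
  by rewrite /wgt mulVf// gt_eqF// onePnormX_gt0.
have cF : forall h0 e, 0 < e -> \forall h \near h0, rnorm (F h - F h0) <= e.
  apply: (scale_cont (fun y => (1 + `|y|) ^+ n.*2) G).
    exact: continuous_onePnormX.
  by move=> h0 e; exact: iota_mul_cont iota j tibE chi f sf h0 e.
have ru h : rnorm (u h) = wgt n n.*2 h by rewrite rnorm_real ger0_norm// wgt_ge0.
have iu : cintegrable mu u.
  split; first by apply: cmeas_real; exact: measurable_wgt.
  by under eq_integral do rewrite ru; exact: integral_wgt.
have FK h : rnorm (F h) <= K.
  rewrite rnormZ rnorm_real ger0_norm ?exprn_ge0 ?addr_ge0//.
  rewrite (@le_trans _ _ ((1 + `|h|) ^+ n.*2 * (K * wgt n n.*2 h)))//.
    by rewrite ler_wpM2l ?exprn_ge0 ?addr_ge0 ?HK.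
  by rewrite mulrC -mulrA wK mulr1.
have sF := cont_strongly_measurable _ cF.
have fin : (\int[mu]_y (rnorm (u y) * rnorm (F y))%:E < +oo)%E.
  apply: (@le_lt_trans _ _ (\int[mu]_y (K%:E * (wgt n n.*2 y)%:E))%E).
    apply: ge0_le_integral => //.
    - by move=> y _; rewrite lee_fin mulr_ge0 ?rnorm_ge0.
    - apply/measurable_EFinP; apply: measurable_funM.
        by apply: measurable_rnorm; case: iu.
      by have [mF _] := sF; have := mF 0; under eq_fun do rewrite subr0.
    - by apply: measurable_funeM; apply/measurable_EFinP; exact: measurable_wgt.
    - by move=> y _; rewrite -EFinM lee_fin ru mulrC ler_wpM2r ?wgt_ge0.
  rewrite ge0_integralZl//=.
  - by rewrite lte_mul_pinfty// integral_wgt.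
  - by apply/measurable_EFinP; exact: measurable_wgt.
  - by move=> y _; rewrite lee_fin wgt_ge0.
have [e [_ eP]] := bochner mu u iu F sF fin.
exists e => k; have [_ cj _] := tib_distrib tibE; have [D D0 HD] := jev_bound j k cj.
rewrite -[LHS]/(jev j k e) (eP (jev j k) D HD (cmeas_jev iota j tibE F k cF)) cintegralE.
pose H (p : Rn * Rn) : R[i] := (f p.1 * k p.1) * chi (p.1 + p.2).
have mf := schwartz_cmeas f Sf.
have mH : cmeas H.
  apply: cmeasM; last by apply: (cmeas_comp _ _ (testfun_cmeas chi)); exact: measurable_add2.
  apply: (@cmeas_comp _ _ _ _ _ (fun x : Rn => f x * k x : R[i]) fst); last exact: measurable_fst.
  exact: cmeasM _ _ mf (testfun_cmeas k).
have [Cf Cf0 HCf] := schwartz_decay f Sf 0 0.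
(* Twice the weight is requested: one copy makes the integral in x converge, the other is traded
   through Peetre's inequality to turn the decay of [chi] in x + y into decay in y. *)
have [Ck Ck0 HCk] := testfun_decay k [::] (n.*2 + n.*2).
have [Cc Cc0 HCc] := testfun_decay chi [::] n.*2.
have iH : (\int[mu]_x \int[mu]_y (rnorm (H (x, y)))%:E < +oo)%E.
  apply: (prod_bound H (Cf * Ck * Cc) (wgt n n.*2) (wgt n n.*2) mH) => //.
  - by rewrite !mulr_ge0.
  - exact: wgt_ge0.
  - exact: wgt_ge0.
  - exact: measurable_wgt.
  - exact: measurable_wgt.
  - exact: integral_wgt.
  - exact: integral_wgt.
  move=> x y; rewrite /H/= !rnormM.
  have h1 : rnorm (f x) <= Cf.
    by have := HCf [::] isT x; rewrite /wgt expr0 invr1 mulr1.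
  have h2 := HCk x; rewrite wgtM in h2.
  have h3 := HCc (x + y); have h4 := wgt_peetre n.*2 x y.
  apply: (@le_trans _ _ (Cf * (Ck * (wgt n n.*2 x * wgt n n.*2 x)) * (Cc * wgt n n.*2 (x + y)))).
    apply: ler_pM h3; [by rewrite mulr_ge0 ?rnorm_ge0|exact: rnorm_ge0|].
    by apply: ler_pM h2 => //; exact: rnorm_ge0.
  rewrite (_ : Cf * _ * _ = Cf * Ck * Cc * (wgt n n.*2 x * (wgt n n.*2 (x + y) * wgt n n.*2 x))); last by ring.
  apply: ler_wpM2l; first by rewrite !mulr_ge0.
  by apply: ler_wpM2l => //; exact: wgt_ge0.
transitivity (cint mu (fun h => cint mu (fun x => H (x, h)))).
  apply: eq_cint => h; rewrite /F linearZ/= -[_ *: _]/(_ * _) /u mulrA -rmorphM/= wK mul1r.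
  rewrite /jev (tib_inclusion tibE) cintegralE; apply: eq_cint => x.
  by rewrite /H /= /mulf /shiftf -mulrA mulrC.
(* For each x the integral of chi(x + h) over h equals that of [chi], which is 1, so only f(x) k(x)
   remains. *)
rewrite -(cfubini mu mu H mH iH); apply: eq_cint => x.
have ic : cintegrable mu (fun y => chi (x + y) : R[i]).
  have := testfun_cintegrable (shift_testfun x chi).
  by congr cintegrable; apply/funext => y; rewrite /= /shiftf addrC.
rewrite /H/= cintZ//; under eq_cint do rewrite addrC.
by rewrite (@cint_shift _ _ x (chi : Rn -> R[i]) (testfun_cmeas chi)) chi1 mulr1.
Qed.

Lemma schwartz_represented (f : Rn -> R[i]^o) : schwartz f -> exists g, represents j g f.
Proof.
move=> Sf.
have [[chi c0]|/forallNP H] := pselect (exists chi : testfun R n, cint mu (chi : Rn -> R[i]) <> 0).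
  pose c := cint mu (chi : Rn -> R[i]).
  apply: (represented_of_window f (c^-1 *: chi) Sf).
  have := cintZ mu c^-1 _ (testfun_cintegrable chi).
  rewrite -/c mulVf; last by apply/eqP.
  by move=> <-; exact: eq_cint.
(* A space D in which all integrals vanish is trivial. *)
have D0 (k : testfun R n) : k = 0.
  have [ii _ _] := tib_testfun tibE; apply: ii; rewrite linear0.
  (* [iota k] pairs with [l] as the integral of k l, itself a test function. *)
  apply: (j_ext iota j tibE) => l; rewrite (tib_inclusion tibE).
  rewrite -[RHS]/(jev j l 0) linear0.
  have [sl _] := testfunP l.
  by rewrite cintegralE; apply: contrapT; exact: (H (mul_testfun k l sl)).
exists 0 => k; rewrite (D0 k) -[LHS]/(jev j 0 0) linear0 cintegralE.
rewrite -(cint0 mu); apply: eq_cint => x.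
by rewrite -[(0 : testfun R n) x]/(0 : R[i]) mulr0.
Qed.

(** The growth is at most polynomial, of some degree m, so decay of order 2n + m leaves the
    integrable weight. *)
Lemma schwartz_beurling (f : Rn -> R[i]^o) : schwartz f -> beurling j f.
Proof.
move=> Sf; have mf := schwartz_cmeas f Sf; split; first exact: mf.
rewrite (beurling_normE iota j tibE).
have [m [C C0 HC]] := rgrowth_poly iota j tibE.
have [D D0 HD] := schwartz_decay f Sf 0 (n.*2 + m).
apply: (@le_lt_trans _ _ (\int[mu]_x ((D * C)%:E * (wgt n n.*2 x)%:E))%E).
  apply: ge0_le_integral => //.
  - by move=> x _; rewrite lee_fin mulr_ge0 ?rnorm_ge0 ?(rgrowth_ge0 j).
  - by apply/measurable_EFinP; exact: (measurable_beurling iota j tibE _ mf).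
  - by apply: measurable_funeM; apply/measurable_EFinP; exact: measurable_wgt.
  - move=> x _; rewrite -EFinM lee_fin -(wgtK n.*2 m).
    rewrite (_ : D * C * _ = D * wgt n (n.*2 + m) x * (C * (1 + `|x|) ^+ m)); last by ring.
    by apply: ler_pM; [exact: rnorm_ge0|exact: rgrowth_ge0|exact: (HD [::] isT x)|exact: HC].
rewrite ge0_integralZl//=.
- by rewrite lte_mul_pinfty ?lee_fin ?mulr_ge0// integral_wgt.
- by apply/measurable_EFinP; exact: measurable_wgt.
- by move=> x _; rewrite lee_fin wgt_ge0.
- by rewrite lee_fin mulr_ge0.
Qed.

(** The vector [g] is tested against shifts of [k], where it is integration against [f2];
    [conv_pairing] with [G] = [k] yields the same double integral. *)
Lemma act_schwartz (f1 f2 : Rn -> R[i]^o) g : schwartz f1 -> schwartz f2 ->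
  represents j g f2 -> represents j (act j f1 g) (convolution f1 f2).
Proof.
move=> S1 S2 gf k; have m1 := schwartz_cmeas f1 S1; have m2 := schwartz_cmeas f2 S2.
have mk := testfun_cmeas k.
have [C1 C10 HC1] := schwartz_decay f1 S1 0 n.*2.
have [C2 C20 HC2] := schwartz_decay f2 S2 0 n.*2.
have [Ck Ck0 HCk] := testfun_decay k [::] 0.
have kb x : rnorm (k x) <= Ck by have := HCk x; rewrite /wgt expr0 invr1 mulr1.
rewrite (acts_act iota j tibE f1 g (schwartz_beurling f1 S1) k) cintegralE.
rewrite (conv_pairing f1 f2 (k : Rn -> R[i]))//; last first.
  have mH : cmeas (fun p : Rn * Rn => f1 p.1 * (f2 p.2 * k (p.1 + p.2))).
    apply: cmeasM; first by apply: (cmeas_comp _ _ m1); exact: measurable_fst.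
    apply: cmeasM; first by apply: (cmeas_comp _ _ m2); exact: measurable_snd.
    by apply: (cmeas_comp _ _ mk); exact: measurable_add2.
  apply: (prod_bound _ (C1 * C2 * Ck) (wgt n n.*2) (wgt n n.*2) mH) => //.
  - by rewrite !mulr_ge0.
  - exact: wgt_ge0.
  - exact: wgt_ge0.
  - exact: measurable_wgt.
  - exact: measurable_wgt.
  - exact: integral_wgt.
  - exact: integral_wgt.
  move=> x y /=; rewrite !rnormM.
  rewrite (_ : C1 * _ * _ * _ = (C1 * wgt n n.*2 x) * ((C2 * wgt n n.*2 y) * Ck)); last by ring.
  apply: ler_pM; [exact: rnorm_ge0|by rewrite mulr_ge0 ?rnorm_ge0|exact: (HC1 [::] isT)|].
  by apply: ler_pM; [exact: rnorm_ge0|exact: rnorm_ge0|exact: (HC2 [::] isT)|exact: kb].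
apply: eq_cint => y.
rewrite (translP iota j tibE) opprK gf cintegralE -cintZ.
  by apply: eq_cint => x; rewrite /= /shiftf addrC.
apply: (decay_cintegrable _ (C2 * Ck)).
  by apply: cmeasM m2 _; exact: testfun_cmeas (shift_testfun y k).
move=> x; rewrite rnormM mulrAC; apply: ler_pM; [exact: rnorm_ge0|exact: rnorm_ge0| |exact: kb].
exact: (HC2 [::] isT).
Qed.

End schwartz_embedding.

Theorem proposition1 (R : realType) (n : nat) (n_gt0 : (0 < n)%N)
  (E : completeNormedModType R[i])
  (iota : {linear testfun R n -> E}) (j : {linear E -> distrib R n})
  (tibE : translation_invariant_Banach_space iota j) :
  exists act : ('rV[R]_n -> R[i]^o) -> E -> E,
    extends_convolution j act /\ beurling_module j act.
Proof.
exists (act j); split.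
  move=> f1 f2 S1 S2; split; first exact: (schwartz_beurling iota j tibE f1 S1).
  have [g gf] := schwartz_represented iota j tibE f2 S2.
  by exists g => //; exact: (act_schwartz iota j tibE f1 f2 g S1 S2 gf).
split.
- exact: (act_ae_eq iota j tibE).
- exact: (act_linl iota j tibE).
- exact: (act_linr iota j tibE).
- move=> u v g bu bv; split; first exact: (beurling_conv iota j tibE).
  exact: (act_conv iota j tibE).
- exact: (act_norm_le iota j tibE).
Qed.
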